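(* Let $K$ be an infinite field of arbitrary characteristic. Let $n,m\ge 1$ and $d\geq 2$ be integers and let $\mathcal{Q}\in\mathcal{Q}(n,d,m)$, i.e. $\mathcal{Q}$ is a strongly connected quiver with $n$ vertices, $d$ arrows and $m(\mathcal{Q})=m$. 1) If $\operatorname{char}(K)=2$, then $D(\mathcal{Q},(2,\ldots,2))\leq md$. Moreover, if $n,m$ are fixed (and such that $\mathcal{Q}(n,d,m)\neq\emptyset$ for all sufficiently large $d$), then $$\frac{\max\{D(\mathcal{Q},(2,\ldots,2))\mid \mathcal{Q}\in \mathcal{Q}(n,d,m)\}}{md}\to 1\quad\text{as } d\to\infty.$$ 2) If $\operatorname{char}(K)\neq 2$, then $D(\mathcal{Q},(2,\ldots,2))\leq 3n$. Moreover, if $d$ is sufficiently large with respect to $n,m$ (where $n,m$ are such that $\mathcal{Q}(n,d,m)\neq\emptyset$ for all sufficiently large $d$), then $$\max\{D(\mathcal{Q},(2,\ldots,2))\mid \mathcal{Q}\in \mathcal{Q}(n,d,m)\}=3n.$$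
   Context: A quiver $\mathcal{Q}$ is a finite oriented graph with vertex set $\mathrm{ver}(\mathcal{Q})$ and arrow set $\mathrm{arr}(\mathcal{Q})$; loops and multiple arrows are allowed. For an arrow $a$, $a'$ is its head and $a''$ its tail. A path is $a=a_1\cdots a_s$ ($s\ge1$, $a_i$ arrows) with $a_i'=a_{i+1}''$ for $1\le i<s$; its degree is $\deg(a)=s$; it is closed if $a_1''=a_s'$. A closed path $a=a_1\cdots a_s$ is primitive if the vertices $a_1',\ldots,a_s'$ are pairwise different (no self-intersections). $m(\mathcal{Q})$ is the maximal degree of primitive closed paths in $\mathcal{Q}$. A quiver is strongly connected if it has a closed path containing all its vertices (a quiver with one vertex and no arrows is also called strongly connected). $\mathcal{Q}(n,d,m)$ is the set of all strongly connected quivers $\mathcal{Q}$ with $\#\mathrm{ver}(\mathcal{Q})=n$, $\#\mathrm{arr}(\mathcal{Q})=d$, $m(\mathcal{Q})=m$. For a dimension vector $\boldsymbol{n}=(\boldsymbol{n}_v)_{v\in\mathrm{ver}(\mathcal{Q})}$, $I(\mathcal{Q},\boldsymbol{n})$ is the algebra of invariants of representations of $\mathcal{Q}$ of dimension $\boldsymbol n$: the subalgebra of the polynomial ring $K[x_{ij}(a)\mid a\in\mathrm{arr}(\mathcal{Q}),1\le i\le \boldsymbol{n}_{a'},1\le j\le\boldsymbol{n}_{a''}]$ (the coordinate ring of $\prod_a \mathrm{Mat}_{\boldsymbol{n}_{a'}\times\boldsymbol{n}_{a''}}(K)$) consisting of the invariants under $\prod_v GL_{\boldsymbol{n}_v}(K)$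 acting by $(h_a)_a\mapsto(g_{a'}h_ag_{a''}^{-1})_a$. It is known (Donkin) that it is generated by the elements $\sigma_k(X_{a_s}\cdots X_{a_1})$, for closed paths $a_1\cdots a_s$ and $1\le k\le \boldsymbol{n}_{a_1''}$, where $X_a=(x_{ij}(a))$ is the generic $\boldsymbol{n}_{a'}\times \boldsymbol{n}_{a''}$ matrix and $\sigma_k$ is the $k$-th coefficient of the characteristic polynomial, $\det(\lambda E-X)=\lambda^N-\sigma_1(X)\lambda^{N-1}+\cdots+(-1)^N\sigma_N(X)$. It is graded by the usual degree of polynomials. $D(\mathcal{Q},\boldsymbol{n})$ is the least upper bound for the degrees of elements of a minimal (by inclusion) homogeneous system of generators of $I(\mathcal{Q},\boldsymbol{n})$; equivalently, the highest degree of a homogeneous invariant that is indecomposable, i.e. does not lie in $(I(\mathcal{Q},\boldsymbol{n})^+)^2$, where $I(\mathcal{Q},\boldsymbol{n})^+$ is spanned by the homogeneous elements of positive degree. $(2,\ldots,2)$ denotes the dimension vector with all entries $2$. *)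

(* Defs.v *)
From HB Require Import structures.
From mathcomp Require Import all_boot all_order all_algebra.
From mathcomp Require Import mpoly.

Set Implicit Arguments.
Unset Strict Implicit.
Unset Printing Implicit Defensive.

Import Order.TTheory GRing.Theory Num.Theory.
Local Open Scope ring_scope.

Definition infinite_type (T : eqType) : Prop := forall s : seq T, exists x : T, x \notin s.

Definition is_max (E : nat -> Prop) (N : nat) : Prop :=
  E N /\ forall k : nat, E k -> (k <= N)%N.

Definition is_lub (E : nat -> Prop) (N : nat) : Prop :=
  (forall k : nat, E k -> (k <= N)%N) /\
  (forall N' : nat, (forall k : nat, E k -> (k <= N')%N) -> (N <= N')%N).

Definition seq_tends_to (u : nat -> rat) (l : rat) : Prop :=
  forall eps : rat, 0 < eps ->
    exists k0 : nat, forall k : nat, (k0 <= k)%N -> `|u k - l| < eps.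

Record quiver : Type := Quiver {
  ver : finType;
  arr : finType;
  ahead : arr -> ver;
  atail : arr -> ver }.

(* In a path a_1 ... a_s the head of a_i is the tail of a_(i+1), so paths are
   written in the order in which they are travelled. *)
Definition composable (Q : quiver) : rel (arr Q) :=
  fun a b => ahead a == atail b.

(* The path condition together with a_1'' = a_s' is [cycle]; the empty sequence,
   which [cycle] accepts, is not a path. *)
Definition closed_path (Q : quiver) (p : seq (arr Q)) : bool :=
  (p != [::]) && cycle (@composable Q) p.

Definition primitive_path (Q : quiver) (p : seq (arr Q)) : bool :=
  closed_path p && uniq [seq ahead a | a <- p].

(* Every vertex of a closed path is the head of one of its arrows. *)
Definition strongly_connected (Q : quiver) : Prop :=
  (exists p : seq (arr Q),
     closed_path p /\ forall v : ver Q, v \in [seq ahead a | a <- p]) \/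
  (#|ver Q| = 1%N /\ #|arr Q| = 0%N).

Definition primitive_degrees (Q : quiver) (k : nat) : Prop :=
  exists p : seq (arr Q), primitive_path p /\ size p = k.

(* The class Q(n, d, m). *)
Definition quiver_class (n d m : nat) (Q : quiver) : Prop :=
  [/\ strongly_connected Q, #|ver Q| = n, #|arr Q| = d
    & is_max (primitive_degrees Q) m].

Definition eventually_inhabited (n m : nat) : Prop :=
  exists d0 : nat, forall d : nat, (d0 <= d)%N ->
    exists Q : quiver, quiver_class n d m Q.

Definition rep (K : fieldType) (Q : quiver) (dv : ver Q -> nat) : Type :=
  forall a : arr Q, 'M[K]_(dv (ahead a), dv (atail a)).

Definition act (K : fieldType) (Q : quiver) (dv : ver Q -> nat)
    (g : forall v : ver Q, 'M[K]_(dv v)) (h : rep K dv) : rep K dv :=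
  fun a => g (ahead a) *m h a *m invmx (g (atail a)).

(* The index (a, (i, j)) stands for the variable x_ij(a). *)
Definition coord_index (Q : quiver) (dv : ver Q -> nat) : finType :=
  {a : arr Q & ('I_(dv (ahead a)) * 'I_(dv (atail a)))%type}.

Definition coord_ring (K : fieldType) (Q : quiver) (dv : ver Q -> nat) :=
  {mpoly K[#|coord_index dv|]}.

Definition coords (K : fieldType) (Q : quiver) (dv : ver Q -> nat)
    (h : rep K dv) : 'I_#|coord_index dv| -> K :=
  fun k => let u := enum_val k in h (tag u) (tagged u).1 (tagged u).2.

(* Invariance is tested on points, which is the invariance of the polynomial
   itself since the ground field is taken to be infinite. *)
Definition invariant (K : fieldType) (Q : quiver) (dv : ver Q -> nat)
    (f : coord_ring K dv) : Prop :=
  forall (g : forall v : ver Q, 'M[K]_(dv v)) (h : rep K dv),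
    (forall v : ver Q, g v \in unitmx) ->
    f.@[coords (act g h)] = f.@[coords h].

Inductive subalg_gen (N : nat) (K : fieldType) (S : {mpoly K[N]} -> Prop) :
    {mpoly K[N]} -> Prop :=
  | subalg_gen_in f : S f -> subalg_gen S f
  | subalg_gen_const (c : K) : subalg_gen S c%:MP
  | subalg_gen_add f g : subalg_gen S f -> subalg_gen S g -> subalg_gen S (f + g)
  | subalg_gen_mul f g : subalg_gen S f -> subalg_gen S g -> subalg_gen S (f * g).

Definition generates_invariants (K : fieldType) (Q : quiver) (dv : ver Q -> nat)
    (S : coord_ring K dv -> Prop) : Prop :=
  forall f : coord_ring K dv, subalg_gen S f <-> invariant f.

Definition minimal_homogeneous_generators (K : fieldType) (Q : quiver)
    (dv : ver Q -> nat) (S : coord_ring K dv -> Prop) : Prop :=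
  [/\ generates_invariants S,
      (forall f : coord_ring K dv, S f -> exists k : nat, f \is k.-homog)
    & forall S' : coord_ring K dv -> Prop,
        (forall f, S' f -> S f) -> generates_invariants S' ->
        forall f, S f -> S' f].

(* [is_D K dv N] reads D(Q, dv) = N; a minimal system does not contain 0, so
   [(msize f).-1] is the degree of each of its elements. *)
Definition is_D (K : fieldType) (Q : quiver) (dv : ver Q -> nat) (N : nat) : Prop :=
  exists S : coord_ring K dv -> Prop,
    minimal_homogeneous_generators S /\
    is_lub (fun k => exists f : coord_ring K dv, S f /\ (msize f).-1 = k) N.

Definition dim2 (Q : quiver) : ver Q -> nat := fun _ => 2%N.

Definition D_values (K : fieldType) (n d m : nat) (N : nat) : Prop :=
  exists Q : quiver, quiver_class n d m Q /\ is_D K (@dim2 Q) N.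

(* Main.v *)
(* The algebra of invariants is generated by tr and det of closed paths.  First
   the auxiliary vectors, then the arrows, are eliminated from a polynomial
   function invariant under a product of groups SL_2: it is determined, up to a
   multiple of a bracket [u, w] (resp. of det X_a), by its restriction to
   proportional u, w (resp. to X_a of rank one), where induction applies.

   Upper bounds.  det is multiplicative, so only primitive closed paths matter.
   Modulo invariants of lower degree, tr(ABC) = - tr(ACB) and tr(AAB) = 0 for
   closed paths A, B, C at a vertex.  If char K <> 2, a path through one vertex
   four times is decomposable, whence 3n.  If char K = 2, order does not matter,
   and a path of length > md is a skeleton through all its vertices with more
   inserted primitive closed paths than the dimension of the cycle space over
   F_2.  Some of them together use every arrow an even number of times; these can
   be rebased until one of them, A, appears as AA.

   Lower bounds.  On a line of vertices with loops and many arrows m-1 -> 0, the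
   trace of a suitable closed path is not 0 at a point where the invariants of any
   two complementary multidegrees do not both survive, by torus elements and
   coordinate swaps at the vertices. *)
From Stdlib Require Classical_Prop.
From Stdlib Require IndefiniteDescription.
From mathcomp Require Import all_boot all_order all_algebra.
From mathcomp Require Import mpoly.
From mathcomp Require Import ring zify.
Require Import Defs.

Set Implicit Arguments.
Unset Strict Implicit.
Unset Printing Implicit Defensive.

Import GRing.Theory.
Local Open Scope ring_scope.

(** * Polynomial functions over an infinite field *)

Section FunctionAlgebra.

Variable K : fieldType.

(** In arbitrary characteristic neither averaging nor full polarization is available, so invariants
    are rebuilt by restriction, lifting and exact division. The divisors, brackets and [detm], are
    invariant under SL_2 but only semi-invariant under GL_2. Hence the elimination is done for SL_2;
    scalar matrices enter last and force the degrees of incoming and outgoing arrows to balance at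
    each vertex. Auxiliary vectors appear because a rank one matrix is a vector times a covector.
    Functions on points are used, so that substitution is composition; over an infinite field
    nothing is lost.

    The bound md adds two counts: for n > 1 a skeleton has at most m(n-1) arrows, and the cycle
    space over F_2 has dimension d-n+1. So a path of more than md arrows has more than d-n+1
    inserted primitive paths. For n = 1 the skeleton still costs m, and that case is separate.

    One quiver gives both lower bounds. It has 3n arrows besides those from m-1 to 0: a tour through
    the former has degree 3n, and one lap for each of the latter gives degree m(d-3n). *)

Inductive alg (T : Type) (X : (T -> K) -> Prop) : (T -> K) -> Prop :=
  | alg_gen f : X f -> alg X f
  | alg_const c : alg X (fun=> c)
  | alg_add f g : alg X f -> alg X g -> alg X (fun t => f t + g t)
  | alg_mul f g : alg X f -> alg X g -> alg X (fun t => f t * g t)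
  | alg_ext f g : f =1 g -> alg X f -> alg X g.

Lemma alg_scale T (X : (T -> K) -> Prop) c f : alg X f -> alg X (fun t => c * f t).
Proof. by move=> Xf; apply: (alg_mul (f := fun=> c)) => //; apply: alg_const. Qed.

Lemma alg_opp T (X : (T -> K) -> Prop) f : alg X f -> alg X (fun t => - f t).
Proof. by move/(alg_scale (-1)); apply: alg_ext => t; rewrite mulN1r. Qed.

Lemma alg_sub T (X : (T -> K) -> Prop) f g :
  alg X f -> alg X g -> alg X (fun t => f t - g t).
Proof. by move=> Xf Xg; apply: alg_add => //; apply: alg_opp. Qed.

Lemma alg_sum T (X : (T -> K) -> Prop) J (r : seq J) (P : pred J) (F : J -> T -> K) :
  (forall j, P j -> alg X (F j)) -> alg X (fun t => \sum_(j <- r | P j) F j t).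
Proof.
move=> XF; elim: r => [|j r IHr].
  by apply: (alg_ext _ (alg_const X 0)) => t; rewrite big_nil.
case Pj: (P j); last by apply: alg_ext IHr => t; rewrite big_cons Pj.
by apply: (alg_ext _ (alg_add (XF j Pj) IHr)) => t; rewrite big_cons Pj.
Qed.

Lemma alg_prod T (X : (T -> K) -> Prop) J (r : seq J) (P : pred J) (F : J -> T -> K) :
  (forall j, P j -> alg X (F j)) -> alg X (fun t => \prod_(j <- r | P j) F j t).
Proof.
move=> XF; elim: r => [|j r IHr].
  by apply: (alg_ext _ (alg_const X 1)) => t; rewrite big_nil.
case Pj: (P j); last by apply: alg_ext IHr => t; rewrite big_cons Pj.
by apply: (alg_ext _ (alg_mul (XF j Pj) IHr)) => t; rewrite big_cons Pj.
Qed.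

Lemma alg_exp T (X : (T -> K) -> Prop) f n : alg X f -> alg X (fun t => f t ^+ n).
Proof.
move=> Xf; elim: n => [|n IHn]; first by apply: (alg_ext _ (alg_const X 1)).
by apply: (alg_ext _ (alg_mul Xf IHn)) => t; rewrite exprS.
Qed.

Lemma alg_comp T T' (X : (T -> K) -> Prop) (Y : (T' -> K) -> Prop) (phi : T' -> T) f :
  (forall g, X g -> alg Y (fun t => g (phi t))) -> alg X f -> alg Y (fun t => f (phi t)).
Proof.
move=> XY; elim=> [g /XY //|c|g h _ IHg _ IHh|g h _ IHg _ IHh|g h gh _ IHg].
- exact: alg_const.
- exact: alg_add.
- exact: alg_mul.
- by apply: alg_ext IHg => t; apply: gh.
Qed.

Lemma alg_mono T (X Y : (T -> K) -> Prop) f :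
  (forall g, X g -> alg Y g) -> alg X f -> alg Y f.
Proof. by move=> XY; apply: (alg_comp (phi := id)). Qed.

Hypothesis K_infinite : infinite_type K.

Lemma infinite_uniq n : exists s : seq K, uniq s /\ size s = n.
Proof.
elim: n => [|n [s [s_uniq s_size]]]; first by exists [::].
by have [x xs] := K_infinite s; exists (x :: s); rewrite /= xs s_uniq s_size.
Qed.

Lemma poly_fun0 (p : {poly K}) : (forall c, p.[c] = 0) -> p = 0.
Proof.
move=> p0; apply/eqP; apply: contraT => nz_p.
have [s [s_uniq s_size]] := infinite_uniq (size p).
have := max_poly_roots nz_p _ s_uniq; rewrite s_size ltnn; apply.
by apply/allP => c _; rewrite /root p0.
Qed.

Lemma poly_fun0_nz (p : {poly K}) : (forall c, c != 0 -> p.[c] = 0) -> p = 0.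
Proof.
move=> p0; have : 'X * p = 0.
  apply: poly_fun0 => c; rewrite hornerM hornerX.
  by have [->|/p0 ->] := eqVneq c 0; rewrite ?mul0r ?mulr0.
by move/eqP; rewrite mulf_eq0 polyX_eq0 => /eqP.
Qed.

Lemma poly_fun_inj (p q : {poly K}) : (forall c, p.[c] = q.[c]) -> p = q.
Proof.
by move=> pq; apply/eqP; rewrite -subr_eq0; apply/eqP/poly_fun0 => c; rewrite !hornerE pq subrr.
Qed.

(** Both sides are polynomials in c that agree at all nonzero c, so their coefficients of degree e
    agree. *)
Lemma separate_weights J (r : seq J) (k : J -> nat) (v : J -> K) e w :
  (forall c, c != 0 -> \sum_(j <- r) c ^+ k j * v j = c ^+ e * w) ->
  w = \sum_(j <- r | k j == e) v j.
Proof.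
move=> eq_w; pose p := \sum_(j <- r) v j *: 'X^(k j) - w *: 'X^e : {poly K}.
have p0 : p = 0.
  apply: poly_fun0_nz => c nz_c; rewrite /p hornerE horner_sum.
  under eq_bigr => j _ do rewrite !hornerE mulrC.
  by rewrite eq_w // !hornerE (mulrC w) subrr.
have := congr1 (fun q : {poly K} => q`_e) p0.
rewrite /p coefB coef_sum coefZ coefXn eqxx mulr1 coef0 => /eqP.
rewrite subr_eq0 => /eqP <-; rewrite [RHS]big_mkcond; apply: eq_bigr => j _.
by rewrite coefZ coefXn eq_sym; case: eqP; rewrite (mulr1, mulr0).
Qed.

Lemma exists_nonroot n : (0 < n)%N -> exists c : K, c != 0 /\ c ^+ n != 1.
Proof.
move=> n_gt0; have [//|/= nex] := boolP (('X^n - 1 : {poly K}) == 0).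
  by rewrite -size_poly_eq0 size_XnsubC.
have : ('X * ('X^n - 1) : {poly K}) != 0 by rewrite mulf_neq0 ?polyX_eq0.
move=> /max_poly_roots max_roots.
have [s [s_uniq s_size]] := infinite_uniq (size ('X * ('X^n - 1) : {poly K})).
have [/allP c_roots|] := boolP (all (root ('X * ('X^n - 1))) s).
  by have := max_roots _ (introT allP c_roots) s_uniq; rewrite s_size ltnn.
move=> /allPn[c _]; rewrite /root !hornerE mulf_eq0 negb_or subr_eq0 => /andP[c0 c1].
by exists c.
Qed.

Lemma graded_pieces T (X : (T -> K) -> Prop) (s : K -> T -> T) f :
  (forall t, f (s 1 t) = f t) -> (forall c c' t, f (s c (s c' t)) = f (s (c * c') t)) ->
  (forall g, X g -> exists w, forall c t, g (s c t) = c ^+ w * g t) ->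
  alg X f ->
  exists N (F : nat -> T -> K),
   [/\ forall k, alg X (F k),
       forall k c t, F k (s c t) = c ^+ k * F k t,
       forall t, f t = \sum_(k < N) F k t
     & forall (phi : T -> T) lam, (forall c t, f (phi (s c t)) = f (s c (phi t))) ->
         (forall t, f (phi t) = lam * f t) -> forall k t, F k (phi t) = lam * F k t].
Proof.
move=> s1 sM Xs Xf.
have [P [N [sP XP Pf]]] : exists (P : T -> {poly K}) (N : nat),
   [/\ forall t, (size (P t) <= N)%N, forall k, alg X (fun t => (P t)`_k)
     & forall t c, f (s c t) = (P t).[c]].
  elim: Xf => [g Xg|c|g h _ [P [N [sP XP Pg]]] _ [P' [N' [sP' XP' Ph]]]|
     g h _ [P [N [sP XP Pg]]] _ [P' [N' [sP' XP' Ph]]]|g h gh _ [P [N [sP XP Pg]]]].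
  - have [w gw] := Xs g Xg; exists (fun t => g t *: 'X^w), w.+1; split.
    + by move=> t; rewrite (leq_trans (size_scale_leq _ _)) // size_polyXn.
    + move=> k; apply: (alg_ext (f := fun t => (k == w)%:R * g t)).
        by move=> t; rewrite coefZ coefXn mulrC.
      by apply: alg_scale; apply: alg_gen.
    + by move=> t c; rewrite gw !hornerE mulrC.
  - exists (fun=> c%:P), 1%N; split.
    + by move=> t; apply: size_polyC_leq1.
    + by move=> k; apply: alg_const.
    + by move=> t c'; rewrite hornerC.
  - exists (fun t => P t + P' t), (maxn N N'); split.
    + by move=> t; rewrite (leq_trans (size_polyD _ _)) // geq_max !leq_max sP sP' orbT.
    + by move=> k; apply: alg_ext (alg_add (XP k) (XP' k)) => t; rewrite coefD.
    + by move=> t c; rewrite Pg Ph hornerD.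
  - exists (fun t => P t * P' t), (N + N')%N; split.
    + move=> t; rewrite (leq_trans (size_polyMleq _ _)) // (leq_trans (leq_pred _)) //.
      exact: leq_add.
    + move=> k; apply: (alg_ext (f := fun t => \sum_(j < k.+1) (P t)`_j * (P' t)`_(k - j))).
        by move=> t; rewrite coefM.
      by apply: alg_sum => j _; apply: alg_mul.
    + by move=> t c; rewrite Pg Ph hornerM.
  - by exists P, N; split=> // t c; rewrite -gh.
have Pphi phi lam (phis : forall c t, f (phi (s c t)) = f (s c (phi t)))
    (fphi : forall t, f (phi t) = lam * f t) t : P (phi t) = lam *: P t.
  by apply: poly_fun_inj => c; rewrite -Pf -phis fphi Pf hornerZ.
exists N, (fun k t => (P t)`_k); split=> //.
(* Scaling twice multiplies the scalars, so [P (s c t)] is [P t] with c 'X substituted, and its k-th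
   coefficient gains the factor c ^+ k. *)
- move=> k c t; have -> : P (s c t) = P t \Po (c *: 'X).
    apply: poly_fun_inj => c'; rewrite -Pf sM Pf horner_comp !hornerE.
    by rewrite (mulrC c).
  rewrite coef_comp_poly; have [k_lt|k_ge] := ltnP k (size (P t)).
    rewrite (bigD1 (Ordinal k_lt)) //= big1 ?addr0.
      by rewrite exprZn coefZ coefXn eqxx mulr1 mulrC.
    move=> i; rewrite exprZn coefZ coefXn -val_eqE eq_sym /= => /negPf ->.
    by rewrite !mulr0.
  rewrite big1 ?(nth_default _ k_ge) ?mulr0 // => i _.
  rewrite exprZn coefZ coefXn; case: eqP => [ki|]; last by rewrite !mulr0.
  by move: k_ge; rewrite ki leqNgt ltn_ord.
- move=> t; rewrite -s1 Pf (horner_coef_wide _ (sP t)).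
  by apply: eq_bigr => i _; rewrite expr1n mulr1.
- by move=> phi lam phis fphi k t; rewrite (Pphi _ lam) // coefZ.
Qed.

End FunctionAlgebra.

(** * Exact division by a coordinate and by a 2 x 2 determinant *)

Section PolynomialFunctions.

Variables (K : fieldType) (I : eqType).
Hypothesis K_infinite : infinite_type K.

Definition pol : ((I -> K) -> K) -> Prop := alg (fun f => exists i, f = (fun x => x i)).

Lemma pol_coord i : pol (fun x => x i).
Proof. by apply: alg_gen; exists i. Qed.

Definition upd (x : I -> K) i c : I -> K := fun j => if j == i then c else x j.

Lemma pol_comp f (phi : (I -> K) -> I -> K) :
  (forall i, pol (fun x => phi x i)) -> pol f -> pol (fun x => f (phi x)).
Proof. by move=> pphi; apply: alg_comp => _ [i ->]; apply: pphi. Qed.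

Lemma pol_ext_arg f : pol f -> forall x y, x =1 y -> f x = f y.
Proof.
elim=> [_ [i ->]|//|g h _ IHg _ IHh|g h _ IHg _ IHh|g h gh _ IHg] x y xy.
- exact: xy.
- by rewrite (IHg x y) // (IHh x y).
- by rewrite (IHg x y) // (IHh x y).
- by rewrite -!gh; apply: IHg.
Qed.

Lemma pol_upd f g i : pol f -> pol g -> pol (fun x => f (upd x i (g x))).
Proof.
move=> pf pg; apply: pol_comp pf => j; rewrite /upd.
by case: eqP => _ //; apply: pol_coord.
Qed.

Lemma pol_curve f (gam : I -> {poly K}) :
  pol f -> exists p : {poly K}, forall c, f (fun i => (gam i).[c]) = p.[c].
Proof.
elim=> [_ [i ->]|c|g h _ [p pg] _ [q qh]|g h _ [p pg] _ [q qh]|g h gh _ [p pg]].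
- by exists (gam i).
- by exists c%:P => c'; rewrite hornerC.
- by exists (p + q) => c; rewrite pg qh hornerD.
- by exists (p * q) => c; rewrite pg qh hornerM.
- by exists p => c; rewrite -gh.
Qed.

(** If only the coordinate i varies, f becomes a polynomial in one variable that vanishes at all
    nonzero values. *)
Lemma pol_dense_coord f i : pol f -> (forall x : I -> K, x i != 0 -> f x = 0) -> forall x, f x = 0.
Proof.
move=> pf f0 x; have [p pE] := pol_curve (fun j => if j == i then 'X else (x j)%:P) pf.
have p0 : p = 0.
  by apply: (poly_fun0_nz K_infinite) => c nz_c; rewrite -pE f0 // eqxx hornerX.
have := pE (x i); rewrite p0 horner0 => <-; apply: pol_ext_arg => // j.
by case: eqP => [->|_]; rewrite ?hornerX ?hornerC.
Qed.

Lemma pol_div_coord f i : pol f -> (forall x : I -> K, x i = 0 -> f x = 0) ->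
  exists2 g, pol g & forall x, f x = x i * g x.
Proof.
(* The stronger form, with the value at x_i = 0 split off, is the one preserved by sums and
   products. *)
move=> pf f0; suff [g pg fg] : exists2 g, pol g & forall x, f x = f (upd x i 0) + x i * g x.
  by exists g => // x; rewrite fg f0 ?add0r // /upd eqxx.
elim: pf {f0} => [_ [j ->]|c|g h pg [g' pg' gE] ph [h' ph' hE]|
    g h pg [g' pg' gE] ph [h' ph' hE]|g h gh pg [g' pg' gE]].
- exists (fun=> (j == i)%:R); first exact: alg_const.
  by move=> x; rewrite /upd; case: eqP => [->|_]; rewrite ?mulr1 ?add0r // mulr0 addr0.
- by exists (fun=> 0); [apply: alg_const | move=> x; rewrite mulr0 addr0].
- exists (fun x => g' x + h' x); first exact: alg_add.
  by move=> x; rewrite gE hE; ring.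
- exists (fun x => g' x * h x + g (upd x i 0) * h' x).
    apply: alg_add; first exact: alg_mul.
    by apply: alg_mul => //; apply: pol_upd => //; apply: alg_const.
  by move=> x; rewrite [in LHS]gE mulrDl {1}hE; ring.
- by exists g' => // x; rewrite -!gh.
Qed.

Lemma pol_graded (s : K -> (I -> K) -> I -> K) f :
  (forall x, s 1 x =1 x) -> (forall c c' x, s c (s c' x) =1 s (c * c') x) ->
  (forall i, exists w, forall c x, s c x i = c ^+ w * x i) -> pol f ->
  exists N (F : nat -> (I -> K) -> K),
   [/\ forall k, pol (F k),
       forall k c x, F k (s c x) = c ^+ k * F k x,
       forall x, f x = \sum_(k < N) F k x
     & forall (phi : (I -> K) -> I -> K) lam, (forall c x, phi (s c x) =1 s c (phi x)) ->
         (forall x, f (phi x) = lam * f x) -> forall k x, F k (phi x) = lam * F k x].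
Proof.
move=> s1 sM sw pf.
have [||_ [i ->]|N [F [pF Fs fF Fphi]]] := graded_pieces K_infinite (s := s) _ _ _ pf.
- by move=> x; apply: pol_ext_arg.
- by move=> c c' x; apply: pol_ext_arg.
- exact: sw.
exists N, F; split=> // phi lam phis; apply: Fphi => c x.
exact: pol_ext_arg.
Qed.

Definition hom_deg (s : K -> (I -> K) -> I -> K) e (f : (I -> K) -> K) :=
  forall c x, c != 0 -> f (s c x) = c ^+ e * f x.

(** Here f is a quotient by a form of degree p, of which only the scaled equation is known.
    Polynomiality along the scaling curve excludes a negative degree unless f vanishes. It is used
    with p = 1 for brackets and p = 2 for determinants of arrows. *)
Lemma homog_quot s p e f : (forall x, exists q : {poly K}, forall c, f (s c x) = q.[c]) ->
  (forall c x, c != 0 -> c ^+ p * f (s c x) = c ^+ e * f x) ->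
  (p <= e)%N /\ hom_deg s (e - p) f \/ forall x, f x = 0.
Proof.
move=> curve eqf; have [p_le|e_lt] := leqP p e; [left|right].
  split=> // c x nz_c; have nz_cp : c ^+ p != 0 by rewrite expf_neq0.
  by apply: (mulfI nz_cp); rewrite mulrA -exprD subnKC // eqf.
move=> x; have [q qE] := curve x.
have : 'X^(p - e) * q = (f x)%:P.
  apply/eqP; rewrite -subr_eq0; apply/eqP/(poly_fun0_nz K_infinite) => c nz_c.
  have nz_ce : c ^+ e != 0 by rewrite expf_neq0.
  apply: (mulfI nz_ce); rewrite !hornerE -qE mulrBr mulrA -exprD subnKC ?(ltnW e_lt) //.
  by rewrite eqf // subrr ?mulr0.
move/(congr1 (fun r : {poly K} => r.[0])); rewrite !hornerE expr0n subn_eq0 leqNgt e_lt /=.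
by rewrite mul0r => <-.
Qed.

Section Det.

Variables i1 i2 i3 i4 : I.
Hypothesis i_uniq : uniq [:: i1; i2; i3; i4].

Definition det4 (x : I -> K) : K := x i1 * x i4 - x i2 * x i3.

Lemma pol_det4 : pol det4.
Proof.
by apply: alg_sub; apply: alg_mul; apply: pol_coord.
Qed.

(** Adding t to the coordinates i1 and i4 turns the determinant into a monic quadratic in t, so it
    can be cancelled in K[t] on each such line. *)
Lemma det4_cancel f : pol f -> (forall x, det4 x * f x = 0) -> forall x, f x = 0.
Proof.
move=> pf f0 x; move: (i_uniq); rewrite /= !inE !negb_or -!andbA.
case/and5P=> n12 n13 n14 n23 /and3P[n24 n34 _].
pose gam j := if (j == i1) || (j == i4) then (x j)%:P + 'X else (x j)%:P.
have [p pE] := pol_curve gam pf; have [q qE] := pol_curve gam pol_det4.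
have qdef : q = ((x i1)%:P + 'X) * ((x i4)%:P + 'X) - (x i2 * x i3)%:P.
  apply: (poly_fun_inj K_infinite) => c; rewrite -qE /det4 /gam !eqxx orbT.
  by rewrite !(eq_sym _ i1) (negPf n12) (negPf n13) (negPf n24) (negPf n34) !hornerE.
have nz_q : q != 0.
  apply/eqP => q0; have := congr1 (fun r : {poly K} => size r) (esym qdef).
  have sz : size (('X + (x i1)%:P) * ('X + (x i4)%:P)) = 3%N.
    by rewrite size_Mmonic ?monicXaddC -?size_poly_eq0 ?size_XaddC.
  rewrite q0 size_poly0 ![_%:P + 'X]addrC size_polyDl ?sz //.
  by rewrite size_polyN (leq_ltn_trans (size_polyC_leq1 _)).
have /eqP : q * p = 0.
  by apply: (poly_fun0 K_infinite) => c; rewrite hornerM -pE -qE f0.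
rewrite mulf_eq0 (negPf nz_q) /= => /eqP p0.
have := pE 0; rewrite p0 horner0 => <-; apply: pol_ext_arg => // j.
by rewrite /gam; case: ifP => _; rewrite !hornerE.
Qed.

(** Modulo the determinant, a power of x_i1 times f has a remainder free of x_i4; solving for x_i4
    shows that this remainder is 0. The vanishing is only assumed where x_i1 and x_i3 are nonzero,
    because elimination of a vector needs the scalar x_i3 / x_i1 to be invertible. *)
Lemma pol_div_det4 f : pol f ->
  (forall x : I -> K, x i1 != 0 -> x i3 != 0 -> det4 x = 0 -> f x = 0) ->
  exists2 g, pol g & forall x, f x = det4 x * g x.
Proof.
move=> pf f0; move: (i_uniq); rewrite /= !inE !negb_or -!andbA.
case/and5P=> n12 n13 n14 n23 /and3P[n24 n34 _].
(* Pseudo-division: each product x_i1 x_i4 is replaced by the determinant plus x_i2 x_i3. *)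
have [N [G [H [pG pH Gi4 eqf]]]] : exists N G H, [/\ pol G, pol H,
    (forall x c, G (upd x i4 c) = G x) & (forall x, x i1 ^+ N * f x = G x + det4 x * H x)].
  elim: pf {f0} => [_ [j ->]|c|g h pg [N [G [H [pG pH Gi4 gE]]]] ph [N' [G' [H' [pG' pH' Gi4' hE]]]]|
    g h pg [N [G [H [pG pH Gi4 gE]]]] ph [N' [G' [H' [pG' pH' Gi4' hE]]]]|
    g h gh pg [N [G [H [pG pH Gi4 gE]]]]].
  - have [->|ji4] := eqVneq j i4.
      exists 1%N, (fun x => x i2 * x i3), (fun=> 1); split.
      + by apply: alg_mul; apply: pol_coord.
      + exact: alg_const.
      + by move=> x c; rewrite /upd (negPf n24) (negPf n34).
      + by move=> x; rewrite /det4; ring.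
    exists 0%N, (fun x => x j), (fun=> 0); split.
    + exact: pol_coord.
    + exact: alg_const.
    + by move=> x c; rewrite /upd (negPf ji4).
    + by move=> x; ring.
  - exists 0%N, (fun=> c), (fun=> 0); split; try exact: alg_const; first by [].
    by move=> x; ring.
  - exists (N + N')%N, (fun x => x i1 ^+ N' * G x + x i1 ^+ N * G' x),
      (fun x => x i1 ^+ N' * H x + x i1 ^+ N * H' x); split.
    + by apply: alg_add; apply: alg_mul => //; apply: alg_exp; apply: pol_coord.
    + by apply: alg_add; apply: alg_mul => //; apply: alg_exp; apply: pol_coord.
    + by move=> x c; rewrite Gi4 Gi4' /upd (negPf n14).
    + move=> x; rewrite mulrDr exprD -[in X in X + _]mulrA mulrCA gE -mulrA hE; ring.
  - exists (N + N')%N, (fun x => G x * G' x),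
      (fun x => G x * H' x + H x * G' x + det4 x * (H x * H' x)); split.
    + exact: alg_mul.
    + apply: alg_add; first by apply: alg_add; apply: alg_mul.
      by apply: alg_mul; [apply: pol_det4 | apply: alg_mul].
    + by move=> x c; rewrite Gi4 Gi4'.
    + by move=> x; rewrite exprD mulrACA gE hE; ring.
  - by exists N, G, H; split=> // x; rewrite -gh.
have G0 x : G x = 0.
  apply: (pol_dense_coord (i := i1) pG) => {}x x1.
  have pG1 : pol (fun y => G (upd y i1 (x i1))).
    by apply: (pol_upd (g := fun=> x i1)) => //; apply: alg_const.
  have -> : G x = G (upd x i1 (x i1)).
    by apply: pol_ext_arg => // j; rewrite /upd; case: eqP => // ->.
  move: {1}x; apply: (pol_dense_coord (i := i3) pG1) => z z3.
  have {}x1 : upd z i1 (x i1) i1 != 0 by rewrite /upd eqxx.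
  have {}z3 : upd z i1 (x i1) i3 != 0 by rewrite /upd [i3 == i1]eq_sym (negPf n13).
  move: (upd z i1 (x i1)) x1 z3 => {pG1}x x1 x3.
  (* The value of x_i4 that makes the determinant vanish; G does not see the change. *)
  pose y := upd x i4 (x i2 * x i3 / x i1).
  have y1 : y i1 = x i1 by rewrite /y /upd (negPf n14).
  have y3 : y i3 = x i3 by rewrite /y /upd (negPf n34).
  have y0 : det4 y = 0.
    by rewrite /det4 /y /upd eqxx (negPf n14) (negPf n24) (negPf n34) mulrC divfK // subrr.
  have := eqf y; rewrite f0 ?y1 ?y3 // y0 mul0r addr0 mulr0 => /esym.
  by rewrite Gi4.
have eqH x : x i1 ^+ N * f x = det4 x * H x by rewrite eqf G0 add0r.
(* The powers of x_i1 are cancelled one at a time. At x_i1 = 0 the determinant is - x_i2 x_i3, hence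
   H vanishes there and is divisible by x_i1. *)
elim: N H pH eqH {G pG Gi4 G0 eqf} => [|N IHN] H pH eqH; first by exists H => // x; rewrite -eqH expr0 mul1r.
have H0 x : x i1 = 0 -> H x = 0.
  move=> x0; have -> : H x = H (upd x i1 0).
    by apply: pol_ext_arg => // j; rewrite /upd; case: eqP => // ->.
  have pH1 : pol (fun x => H (upd x i1 0)).
    by apply: (pol_upd (g := fun=> 0)) => //; apply: alg_const.
  have H23 : forall x : I -> K, x i2 * H (upd x i1 0) = 0.
    apply: (pol_dense_coord (i := i3)); first by apply: alg_mul => //; apply: pol_coord.
    move=> {x0}x x3; have /eqP := eqH (upd x i1 0).
    rewrite /det4 /upd eqxx exprS !mul0r add0r.
    rewrite ![_ == i1]eq_sym (negPf n12) (negPf n13) eq_sym !mulf_eq0 oppr_eq0 mulf_eq0 (negPf x3).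
    by rewrite orbF => /orP[]/eqP ->; rewrite ?mul0r ?mulr0.
  apply: (pol_dense_coord (i := i2) pH1) => {x0}x x2.
  by have /eqP := H23 x; rewrite mulf_eq0 (negPf x2) => /eqP.
have [H' pH' HE] := pol_div_coord pH H0.
apply: (IHN _ pH') => x; apply/eqP; rewrite -subr_eq0; apply/eqP.
move: x; apply: (pol_dense_coord (i := i1)).
  apply: alg_sub.
    by apply: alg_mul => //; apply: alg_exp; apply: pol_coord.
  by apply: alg_mul => //; apply: pol_det4.
move=> x x1; apply: (mulfI x1); rewrite mulr0 mulrBr mulrA -exprS eqH HE; ring.
Qed.

End Det.

End PolynomialFunctions.

(** * Invariants of vectors and matrices under products of SL_2 *)

Section Tensors.

Variables (K : fieldType) (Q : quiver).

(* A label [(v, b, k)] names the k-th auxiliary vector ([b = true]) or covector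
   ([b = false]) at the vertex v.  A covector y is stored as (y1, - y0), on which
   SL2 acts as on vectors. *)
Definition label : eqType := (ver Q * bool * nat)%type.
Definition idx : eqType := (arr Q * (bool * bool) + label * bool)%type.
Definition vx (l : label) : ver Q := l.1.1.

Implicit Types (x : idx -> K) (l : label) (u w : bool -> K).

Definition setv x l u : idx -> K := fun k =>
  match k with
  | inl _ => x k
  | inr (l', i) => if l' == l then u i else x k
  end.

Definition vec x l : bool -> K := fun i => x (inr (l, i)).
Definition ent x a i j : K := x (inl (a, (i, j))).

(** With covectors stored as (y1, - y0), the bracket of a covector and a vector is their pairing, so
    one symbol covers all three kinds of contraction. *)
Definition br u w : K := u false * w true - u true * w false.
Definition bvec (i : bool) : bool -> K := fun k => (k == i)%:R.
(** The j-th dual basis covector in the stored form (y1, - y0). *)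
Definition cobvec (j : bool) : bool -> K :=
  fun k => (j && ~~ k)%:R - (~~ j && k)%:R.

Definition detm x a : K := ent x a false false * ent x a true true
  - ent x a false true * ent x a true false.

Definition bracket_list := seq (label * label).
Definition contraction_list := seq (label * label * arr Q).
Definition labs (bl : bracket_list) : seq label := flatten [seq [:: p.1; p.2] | p <- bl].
Definition clabs (cl : contraction_list) : seq label :=
  flatten [seq [:: c.1.1; c.1.2] | c <- cl].

Fixpoint vbl (bl : bracket_list) x : K :=
  if bl is p :: bl' then br (vec x p.1) (vec x p.2) * vbl bl' x else 1.

(** F is meant to be linear in the vector l and in the covector l'. These two slots are filled with
    the tensor X_a instead of a product of a vector and a covector. *)
Fixpoint con (cl : contraction_list) (F : (idx -> K) -> K) x : K :=
  if cl is (l, l', a) :: cl' then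
    let G i j := con cl' F (setv (setv x l (bvec i)) l' (cobvec j)) in
    ent x a false false * G false false + ent x a false true * G false true
    + (ent x a true false * G true false + ent x a true true * G true true)
  else F x.

Fixpoint dets (al : seq (arr Q)) x : K :=
  if al is a :: al' then detm x a * dets al' x else 1.

(** The symbolic form of an SL_2-invariant: determinants of arrows, arrows contracted into brackets,
    and the brackets. *)
Definition tensor_data : eqType :=
  (seq (arr Q) * contraction_list * bracket_list)%type.
Definition ev (e : tensor_data) x : K := dets e.1.1 x * con e.1.2 (vbl e.2) x.

Lemma pol_vec l i : pol (fun x => vec x l i).
Proof. exact: pol_coord. Qed.

Lemma pol_ent a i j : pol (fun x => ent x a i j).
Proof. exact: pol_coord. Qed.

Lemma pol_setv f l u : pol f -> pol (fun x => f (setv x l u)).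
Proof.
move=> pf; apply: pol_comp pf => -[p|[l' i]] /=; first exact: pol_coord.
by case: (l' == l); [apply: alg_const | apply: pol_coord].
Qed.

Lemma pol_setv_arg f x l u w : pol f -> u =1 w -> f (setv x l u) = f (setv x l w).
Proof. by move=> pf uw; apply: pol_ext_arg => // -[p|[l' i]] //=; rewrite uw. Qed.

Lemma pol_vbl bl : pol (vbl bl).
Proof.
elim: bl => [|p bl IHbl]; first exact: alg_const.
apply: alg_mul IHbl; apply: alg_sub; apply: alg_mul; exact: pol_coord.
Qed.

Lemma pol_con cl F : pol F -> pol (con cl F).
Proof.
move=> pF; elim: cl => [//|[[l l'] a] cl IHcl].
have IH2 i j : pol (fun x => con cl F (setv (setv x l (bvec i)) l' (cobvec j))).
  by have /(pol_setv l (bvec i)) := pol_setv l' (cobvec j) IHcl.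
by apply: alg_add; apply: alg_add; apply: alg_mul; (exact: pol_ent || exact: IH2).
Qed.

Lemma pol_detm a : pol (fun x => detm x a).
Proof. by apply: alg_sub; apply: alg_mul; apply: pol_ent. Qed.

Lemma pol_dets al : pol (dets al).
Proof.
elim: al => [|a al IH]; first exact: alg_const.
by apply: alg_mul => //; apply: pol_detm.
Qed.

Lemma pol_ev e : pol (ev e).
Proof. by apply: alg_mul; [apply: pol_dets | apply: pol_con; apply: pol_vbl]. Qed.

Lemma vec_setv x l u l' : vec (setv x l u) l' = if l' == l then u else vec x l'.
Proof. by rewrite /vec /=; case: eqP. Qed.

Lemma setvC f x l u l' w : pol f -> l != l' ->
  f (setv (setv x l u) l' w) = f (setv (setv x l' w) l u).
Proof.
move=> pf ll'; apply: pol_ext_arg => // -[p|[k i]] //=.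
by case: eqP => [->|//]; rewrite eq_sym (negPf ll').
Qed.

Lemma setv_id f x l : pol f -> f (setv x l (vec x l)) = f x.
Proof. by move=> pf; apply: pol_ext_arg => // -[p|[k i]] //=; case: eqP => // ->. Qed.

Definition lin l (F : (idx -> K) -> K) := forall x c u w,
  F (setv x l (fun i => c * u i + w i)) = c * F (setv x l u) + F (setv x l w).

Lemma lin_expand l F x u : pol F -> lin l F ->
  F (setv x l u) = u false * F (setv x l (bvec false)) + u true * F (setv x l (bvec true)).
Proof.
move=> pF linF.
have F0 : F (setv x l (fun=> 0)) = 0.
  apply: (addrI (F (setv x l (fun=> 0)))); rewrite addr0 -{1}[F _]mul1r -linF.
  by apply: pol_setv_arg => // i; rewrite mulr0 addr0.
have -> : F (setv x l u) = F (setv x l (fun i => u false * bvec false i +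
     (fun i => u true * bvec true i + 0) i)).
  by apply: pol_setv_arg => // -[]; rewrite /bvec /=; ring.
by rewrite linF linF F0 addr0.
Qed.

Lemma labs_cons p bl : labs (p :: bl) = p.1 :: p.2 :: labs bl.
Proof. by []. Qed.

Lemma vbl_indep bl x l u : l \notin labs bl -> vbl bl (setv x l u) = vbl bl x.
Proof.
elim: bl => [//|p bl IHbl]; rewrite labs_cons !inE !negb_or => /and3P[p1 p2 /IHbl IH] /=.
by rewrite IH !vec_setv ![_ == l]eq_sym (negPf p1) (negPf p2).
Qed.

Lemma vbl_lin bl l : count_mem l (labs bl) = 1%N -> lin l (vbl bl).
Proof.
elim: bl => [//|p bl IHbl]; rewrite labs_cons /= => cnt x c u w.
rewrite !vec_setv.
have [p1 | p1] := eqVneq p.1 l; have [p2 | p2] := eqVneq p.2 l;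
  move: cnt; rewrite ?p1 ?p2 ?eqxx ?(negPf p1) ?(negPf p2) ?add0n ?add1n.
- by [].
- move=> /succn_inj /eqP; rewrite eqn0Ngt -has_count has_pred1 => lbl.
  by rewrite !vbl_indep // /br; ring.
- move=> /succn_inj /eqP; rewrite eqn0Ngt -has_count has_pred1 => lbl.
  by rewrite !vbl_indep // /br; ring.
- by move=> /IHbl ->; ring.
Qed.

Lemma clabs_cons c cl : clabs (c :: cl) = c.1.1 :: c.1.2 :: clabs cl.
Proof. by []. Qed.

Lemma con_lin cl l F : pol F -> l \notin clabs cl -> lin l F -> lin l (con cl F).
Proof.
move=> pF; elim: cl => [//|[[k k'] a] cl IHcl].
rewrite clabs_cons !inE !negb_or => /and3P[/= lk lk' lcl] linF x c u w /=.
have {}IHcl := IHcl lcl linF; have pC := pol_con cl pF.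
have swap i j v : con cl F (setv (setv (setv x l v) k (bvec i)) k' (cobvec j)) =
    con cl F (setv (setv (setv x k (bvec i)) k' (cobvec j)) l v).
  have /= -> := setvC x v (bvec i) (pol_setv k' (cobvec j) pC) lk.
  by rewrite setvC.
by rewrite !swap !IHcl /ent /=; ring.
Qed.

(** A contraction evaluates F only at points where contracted labels are overwritten, so equality on
    a set stable under this overwriting is enough. *)
Lemma con_eq cl F G (P : (idx -> K) -> Prop) :
  (forall x l u, l \in clabs cl -> P x -> P (setv x l u)) ->
  (forall x, P x -> F x = G x) -> forall x, P x -> con cl F x = con cl G x.
Proof.
elim: cl => [|[[k k'] a] cl IHcl] Pset FG x Px /=; first exact: FG.
have {}IHcl : forall x, P x -> con cl F x = con cl G x.
  by apply: IHcl => // y l u lcl; apply: Pset; rewrite clabs_cons !inE lcl !orbT.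
have P2 i j : P (setv (setv x k (bvec i)) k' (cobvec j)).
  by do 2![apply: (Pset); first by rewrite clabs_cons !inE eqxx ?orbT].
by rewrite !IHcl.
Qed.

(* The tensor u (x) y on which a contraction is evaluated, with w = (y1, - y0). *)
Definition rank1 u w (i j : bool) : K := if j then u i * w false else - (u i * w true).

Lemma bilin_expand l l' F x u w : pol F -> l != l' -> lin l F -> lin l' F ->
  F (setv (setv x l u) l' w) =
    u false * (w false * F (setv (setv x l (bvec false)) l' (bvec false))
             + w true * F (setv (setv x l (bvec false)) l' (bvec true)))
    + u true * (w false * F (setv (setv x l (bvec true)) l' (bvec false))
             + w true * F (setv (setv x l (bvec true)) l' (bvec true))).
Proof.
move=> pF ll' linl linl'.
have linlw : lin l (fun y => F (setv y l' w)).
  by move=> y c u1 u2; rewrite !(setvC y _ w pF ll') linl.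
have /= -> := lin_expand x u (pol_setv l' w pF) linlw.
by congr (_ * _ + _ * _); apply: lin_expand.
Qed.

(** For X_a of rank one the sum over pairs of basis vectors is the bilinear expansion of the
    uncontracted value. *)
Lemma con_rank1 cl F x l l' a : pol F -> l != l' ->
  lin l (con cl F) -> lin l' (con cl F) ->
  (forall i j, ent x a i j = rank1 (vec x l) (vec x l') i j) ->
  con ((l, l', a) :: cl) F x = con cl F x.
Proof.
move=> pF ll' linl linl' xa; have pC := pol_con cl pF.
have <- : con cl F (setv (setv x l (vec x l)) l' (vec x l')) = con cl F x.
  by rewrite (setv_id x l (pol_setv l' (vec x l') pC)) setv_id.
have E u w := bilin_expand x u w pC ll' linl linl'.
rewrite /= !(E (bvec _) (cobvec _)) (E (vec x l)) !xa.
move: (con cl F) => C; rewrite /rank1 /cobvec /bvec /=.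
move: (vec x l) (vec x l') => u w.
move: (C _) (C _) (C _) (C _) => c1 c2 c3 c4; ring.
Qed.

End Tensors.

Arguments bvec {K}.
Arguments cobvec {K}.

(** * The action of SL_2 and the degrees of symbolic invariants *)

Section SLAction.

Variables (K : fieldType) (Q : quiver).
Hypothesis K_infinite : infinite_type K.

Local Notation idx := (idx Q).
Local Notation label := (label Q).
Implicit Types (x : idx -> K) (l : label) (u w : bool -> K) (g : ver Q -> bool -> bool -> K).

(** The adjugate: it is the inverse on SL_2 and keeps the action polynomial. *)
Definition adj2 (m : bool -> bool -> K) (i j : bool) : K :=
  if i then (if j then m false false else - m true false)
  else (if j then - m false true else m true true).

Definition mv (m : bool -> bool -> K) u (i : bool) : K :=
  m i false * u false + m i true * u true.

Definition det2 (m : bool -> bool -> K) : K :=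
  m false false * m true true - m false true * m true false.

Definition gact g x : idx -> K := fun k =>
  match k with
  | inl (a, (i, j)) =>
      g (ahead a) i false * ent x a false false * adj2 (g (atail a)) false j
    + g (ahead a) i false * ent x a false true * adj2 (g (atail a)) true j
    + (g (ahead a) i true * ent x a true false * adj2 (g (atail a)) false j
    + g (ahead a) i true * ent x a true true * adj2 (g (atail a)) true j)
  | inr (l, i) => mv (g (vx l)) (vec x l) i
  end.

Definition special g := forall v, det2 (g v) = 1.
Definition SLinv (f : (idx -> K) -> K) := forall g x, special g -> f (gact g x) = f x.

Lemma pol_gact f g : pol f -> pol (fun x => f (gact g x)).
Proof.
move=> pf; apply: pol_comp pf => -[[a [i j]]|[l i]] /=.
  have P c c' p q : pol (fun x => c * ent x a p q * c').
    apply: alg_mul; last exact: alg_const.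
    by apply: alg_scale; apply: pol_ent.
  by apply: alg_add; apply: alg_add; apply: P.
by apply: alg_add; apply: alg_scale; apply: pol_vec.
Qed.

Lemma br_gact g x l l' : vx l = vx l' ->
  br (vec (gact g x) l) (vec (gact g x) l') = det2 (g (vx l)) * br (vec x l) (vec x l').
Proof. by move=> e; rewrite /br /vec /= /mv /vec /det2 -e; ring. Qed.

Lemma detm_gact g x a :
  detm (gact g x) a = det2 (g (ahead a)) * det2 (g (atail a)) * detm x a.
Proof. by rewrite /detm /ent /= /ent /adj2 /det2; ring. Qed.

Definition okbl (bl : bracket_list Q) := all (fun p => vx p.1 == vx p.2) bl.
Definition okcl (cl : contraction_list Q) :=
  all (fun c => (c.1.1.1 == (ahead c.2, true)) && (c.1.2.1 == (atail c.2, false))) cl.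

Lemma vbl_inv bl : okbl bl -> SLinv (vbl bl).
Proof.
move=> okb g x SLg; elim: bl okb => [//|p bl IHbl] /= /andP[/eqP e /IHbl ->].
by rewrite br_gact // SLg mul1r.
Qed.

Lemma dets_inv al : SLinv (dets al).
Proof.
by move=> g x SLg; elim: al => [//|a al /= ->]; rewrite detm_gact !SLg !mul1r.
Qed.

Lemma gact_setv f g x l u : pol f ->
  f (gact g (setv x l u)) = f (setv (gact g x) l (mv (g (vx l)) u)).
Proof.
move=> pf; apply: pol_ext_arg => // -[[a [i j]]|[l' i]] //=.
by rewrite vec_setv; case: eqP => // ->.
Qed.

(** X_a transforms like the product of vector and covector that it replaces, so invariance passes
    from the uncontracted function to the contraction. *)
Lemma con_inv cl F : pol F -> okcl cl -> uniq (clabs cl) ->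
  (forall l, l \in clabs cl -> lin l F) -> SLinv F -> SLinv (con cl F).
Proof.
move=> pF okc ucl linF Finv g x SLg; elim: cl x okc ucl linF => [|[[l l'] a] cl IHcl] x.
  by move=> _ _ _; apply: Finv.
rewrite [okcl _]/=; case/andP=> /andP[/eqP /= el /eqP /= el'] okc.
rewrite clabs_cons /= inE negb_or => /andP[/andP[ll' lcl] /andP[l'cl ucl]] linF.
have {}IHcl y : con cl F (gact g y) = con cl F y.
  by apply: IHcl => // k kcl; apply: linF; rewrite !inE kcl !orbT.
have pC := pol_con cl pF.
have linl : lin l (con cl F) by apply: con_lin => //; apply: linF; rewrite !inE eqxx.
have linl' : lin l' (con cl F).
  by apply: con_lin => //; apply: linF; rewrite !inE eqxx orbT.
have E u w := bilin_expand (gact g x) u w pC ll' linl linl'.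
have G u w : con cl F (setv (setv x l u) l' w) =
    con cl F (setv (setv (gact g x) l (mv (g (ahead a)) u)) l' (mv (g (atail a)) w)).
  rewrite -IHcl gact_setv // (gact_setv _ _ _ _ (pol_setv _ _ pC)).
  by rewrite /vx el el'.
rewrite /= !G !(E (mv _ _)) !(E (bvec _) (cobvec _)) /ent /=.
move: (con cl F) => C; rewrite /mv /cobvec /bvec /adj2 /ent /=.
move: (C _) (C _) (C _) (C _) => c1 c2 c3 c4; ring.
Qed.

Definition scl l c x := setv x l (fun i => c * vec x l i).
Definition scm a c x : idx -> K := fun k =>
  match k with inl (a', _) => if a' == a then c * x k else x k | inr _ => x k end.

Lemma vbl_scl bl l c x : vbl bl (scl l c x) = c ^+ count_mem l (labs bl) * vbl bl x.
Proof.
elim: bl => [|p bl IHbl]; first by rewrite mul1r.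
rewrite labs_cons /= IHbl !vec_setv; have [->|p1] := eqVneq p.1 l.
  have [->|p2] := eqVneq p.2 l; rewrite ?eqxx ?(negPf p2) !exprD /br /=; ring.
by have [->|p2] := eqVneq p.2 l; rewrite ?eqxx ?(negPf p2) ?exprD /br /=; ring.
Qed.

Lemma con_scl cl F l n : pol F -> l \notin clabs cl ->
  (forall c x, F (scl l c x) = c ^+ n * F x) ->
  forall c x, con cl F (scl l c x) = c ^+ n * con cl F x.
Proof.
move=> pF + Fn c; elim: cl => [|[[k k'] a] cl IHcl] lcl x; first exact: Fn.
move: lcl; rewrite clabs_cons !inE !negb_or => /and3P[/= lk lk' lcl].
have pC := pol_con cl pF; have {}IHcl := IHcl lcl.
have E i j : con cl F (setv (setv (scl l c x) k (bvec i)) k' (cobvec j)) =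
    c ^+ n * con cl F (setv (setv x k (bvec i)) k' (cobvec j)).
  rewrite -IHcl /scl (setvC x _ (bvec i) (pol_setv k' (cobvec j) pC) lk) setvC //.
  by apply: pol_setv_arg => // b; rewrite !vec_setv (negPf lk) (negPf lk').
by rewrite !E /ent /=; ring.
Qed.

Lemma ev_scl e l c x : l \notin clabs e.1.2 ->
  ev e (scl l c x) = c ^+ count_mem l (labs e.2) * ev e x.
Proof.
move=> lcl; rewrite /ev (con_scl (pol_vbl _ _) lcl (fun c y => vbl_scl e.2 l c y)).
have -> : dets e.1.1 (scl l c x) = dets e.1.1 x by elim: e.1.1 => //= a al ->.
ring.
Qed.

Definition arrow_degree (e : tensor_data Q) a :=
  (2 * count_mem a e.1.1 + count_mem a [seq c.2 | c <- e.1.2])%N.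

Lemma ev_scm e a c x : ev e (scm a c x) = c ^+ arrow_degree e a * ev e x.
Proof.
rewrite /ev /arrow_degree exprD exprM mulrACA; congr (_ * _).
  elim: e.1.1 => [|a' al /= ->]; first by rewrite expr0 mul1r.
  rewrite /detm /ent /=; case: eqP => _; rewrite ?add0n ?exprD; ring.
elim: e.1.2 x => [|[[k k'] a'] cl IHcl] x /=.
  by rewrite mul1r; elim: e.2 => //= p bl ->.
have E i j : con cl (vbl e.2) (setv (setv (scm a c x) k (bvec i)) k' (cobvec j)) =
    con cl (vbl e.2) (scm a c (setv (setv x k (bvec i)) k' (cobvec j))).
  by apply: pol_ext_arg (pol_con _ (pol_vbl _ _)) _ _ _ => -[[? ?]|[? ?]].
rewrite !E !IHcl exprD /ent /=; case: eqP => _; rewrite ?expr0 ?expr1; ring.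
Qed.

(** This undoes the substitution of u_l for u_l': one occurrence of l becomes l', and values agree
    wherever the two vectors do. The count identity has terms on both sides in order to avoid
    subtraction. *)
Lemma rename1 bl l l' : l \in labs bl -> vx l' = vx l -> okbl bl ->
  exists bl', [/\ okbl bl',
    forall k, (count_mem k (labs bl') + (k == l) = count_mem k (labs bl) + (k == l'))%N
  & forall x, vec x l' =1 vec x l -> vbl bl' x = vbl bl x].
Proof.
move=> + el; elim: bl => [//|[p q] bl IHbl].
rewrite labs_cons !inE /= => lpq /andP[/= /eqP pq okb].
have [lp|lp] := eqVneq l p.
  exists ((l', q) :: bl); split=> [|k|x xl].
  - by rewrite /= el lp pq eqxx.
  - rewrite !labs_cons /= lp (eq_sym k p) (eq_sym k l').
    by rewrite addnC addnA addnAC.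
  - by rewrite /= /br !xl lp.
have [lq|lq] := eqVneq l q.
  exists ((p, l') :: bl); split=> [|k|x xl].
  - by rewrite /= el lq pq eqxx.
  - rewrite !labs_cons /= lq (eq_sym k q) (eq_sym k l') -!addnA; congr addn.
    by rewrite addnC -addnA addnCA.
  - by rewrite /= /br !xl lq.
move: lpq; rewrite (negPf lp) (negPf lq) => /IHbl/(_ okb)[bl' [okb' cnt vb]].
exists ((p, q) :: bl'); split=> [|k|x /vb /= -> //].
- by rewrite /= pq eqxx.
- by rewrite !labs_cons /= -!addnA cnt.
Qed.

Lemma rename_many n bl l l' : (n <= count_mem l (labs bl))%N -> l' != l -> vx l' = vx l ->
  okbl bl -> exists bl', [/\ okbl bl',
    forall k, (count_mem k (labs bl') + n * (k == l) = count_mem k (labs bl) + n * (k == l'))%N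
  & forall x, vec x l' =1 vec x l -> vbl bl' x = vbl bl x].
Proof.
move=> + l'l el okb; elim: n => [|n IHn] n_le.
  by exists bl; split=> // k; rewrite !mul0n.
have [bl1 [okb1 cnt1 vb1]] := IHn (ltnW n_le).
have l_bl1 : l \in labs bl1.
  rewrite -has_pred1 has_count; have := cnt1 l; rewrite eqxx eq_sym (negPf l'l) muln0 addn0 muln1.
  by move: n_le; set a := count_mem l _; set b := count_mem l _; lia.
have [bl2 [okb2 cnt2 vb2]] := rename1 l_bl1 el okb1.
exists bl2; split=> // [k|x xl]; last by rewrite vb2 ?vb1.
move: (cnt1 k) (cnt2 k); case: (k == l); case: (k == l');
  by set a := count_mem k _; set b := count_mem k _; set c := count_mem k _; lia.
Qed.

End SLAction.

(** * Combinations of symbolic invariants *)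

Section SLInvariants.

Variables (K : fieldType) (Q : quiver).
Hypothesis K_infinite : infinite_type K.

Local Notation idx := (idx Q).
Local Notation label := (label Q).
Local Notation pt := (idx -> K).
Local Notation data := (tensor_data Q).
Implicit Types (x y : pt) (l : label) (L : seq label) (A : seq (arr Q)) (f : pt -> K) (e : data).

(** Contracted labels are bound: each occurs exactly once in the brackets and lies outside L. Labels
    of L are free and may occur any number of times. *)
Record wf A L e : Prop := Wf {
  wf_al : {subset e.1.1 <= A};
  wf_cla : {subset [seq c.2 | c <- e.1.2] <= A};
  wf_cl : okcl e.1.2;
  wf_bl : okbl e.2;
  wf_uniq : uniq (clabs e.1.2);
  wf_one : forall l, l \in clabs e.1.2 -> count_mem l (labs e.2) = 1%N;
  wf_labs : forall l, l \in labs e.2 -> (l \in clabs e.1.2) || (l \in L);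
  wf_free : forall l, l \in L -> l \notin clabs e.1.2 }.

Definition evs (r : seq (K * data)) x : K := \sum_(p <- r) p.1 * ev p.2 x.

Definition span A L f := exists r : seq (K * data),
  (forall p, p \in r -> wf A L p.2) /\ forall x, f x = evs r x.

Definition rest A L x : pt := fun k =>
  match k with
  | inl (a, _) => if a \in A then x k else 0
  | inr (l, _) => if l \in L then x k else 0
  end.

(** There are infinitely many labels; this condition confines f to finitely many arrows and labels,
    which are then removed one by one. *)
Definition dep A L f := forall x, f (rest A L x) = f x.

Lemma pol_evs r : pol (evs r).
Proof. by apply: alg_sum => p _; apply: alg_scale; apply: pol_ev. Qed.

Lemma pol_rest A L f : pol f -> pol (fun x => f (rest A L x)).
Proof.
move=> pf; apply: pol_comp pf => -[[a ij]|[l i]] /=.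
  by case: (a \in A); [apply: pol_coord | apply: alg_const].
by case: (l \in L); [apply: pol_coord | apply: alg_const].
Qed.

Lemma span_ext A L f h : f =1 h -> span A L f -> span A L h.
Proof. by move=> fh [r [wfr fr]]; exists r; split=> // x; rewrite -fh. Qed.

Lemma span0 A L : span A L (fun=> 0).
Proof. by exists [::]; split=> // x; rewrite /evs big_nil. Qed.

Lemma span_add A L f h : span A L f -> span A L h -> span A L (fun x => f x + h x).
Proof.
move=> [r [wfr fr]] [s [wfs hs]]; exists (r ++ s); split.
  by move=> p; rewrite mem_cat => /orP[/wfr|/wfs].
by move=> x; rewrite fr hs /evs big_cat.
Qed.

Lemma span_sum A L N (F : nat -> pt -> K) :
  (forall k, span A L (F k)) -> span A L (fun x => \sum_(k < N) F k x).
Proof.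
move=> spF; elim: N => [|N IHN].
  by apply: span_ext (span0 A L) => x; rewrite big_ord0.
by apply: span_ext (span_add IHN (spF N)) => x; rewrite big_ord_recr.
Qed.

Lemma con_agree cl (bl : bracket_list Q) x y :
  (forall c, c \in cl -> forall i j, ent x c.2 i j = ent y c.2 i j) ->
  (forall k, k \in labs bl -> k \notin clabs cl -> vec x k =1 vec y k) ->
  con cl (vbl bl) x = con cl (vbl bl) y.
Proof.
elim: cl x y => [|[[l l'] a] cl IHcl] x y xyc xyl.
  rewrite /=; elim: bl xyl => [//|p bl IHbl] xyl /=.
  have vE k : k \in labs (p :: bl) -> vec x k =1 vec y k by move=> /xyl; apply.
  rewrite IHbl => [|k kbl _]; last by apply: vE; rewrite labs_cons !inE kbl !orbT.
  by rewrite /br !vE // labs_cons !inE eqxx ?orbT.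
have E i j : con cl (vbl bl) (setv (setv x l (bvec i)) l' (cobvec j)) =
     con cl (vbl bl) (setv (setv y l (bvec i)) l' (cobvec j)).
  apply: IHcl => [c ccl i' j'|k kbl kcl b].
    by apply: (xyc c); rewrite inE ccl orbT.
  rewrite !vec_setv; case: eqP => // /eqP kl'; case: eqP => // /eqP kl.
  by apply: xyl => //; rewrite clabs_cons !inE !negb_or kl kl'.
by rewrite /= !E !(xyc (l, l', a)) // inE eqxx.
Qed.

Lemma ev_agree A L e x y : wf A L e ->
  (forall a, a \in A -> forall i j, ent x a i j = ent y a i j) ->
  (forall k, k \in L -> vec x k =1 vec y k) -> ev e x = ev e y.
Proof.
move=> wfe xyA xyL; rewrite /ev; congr (_ * _).
  elim: e.1.1 (wf_al wfe) => [//|a al IHal] sub /=; rewrite IHal.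
    by rewrite /detm !xyA // sub // inE eqxx.
  by move=> b bal; apply: sub; rewrite inE bal orbT.
apply: con_agree => [c ccl|k /(wf_labs wfe) + kcl].
  by apply: xyA; apply: (wf_cla wfe); apply: map_f.
by rewrite (negPf kcl) => /= /xyL.
Qed.

Lemma ev_rest A L e x : wf A L e -> ev e (rest A L x) = ev e x.
Proof.
move=> wfe; apply: (ev_agree wfe) => [a aA i j|k kL i].
  by rewrite /ent /= aA.
by rewrite /vec /= kL.
Qed.

Lemma evs_agree A L r x y : (forall p, p \in r -> wf A L p.2) ->
  (forall a, a \in A -> forall i j, ent x a i j = ent y a i j) ->
  (forall k, k \in L -> vec x k =1 vec y k) -> evs r x = evs r y.
Proof.
move=> wfr xyA xyL; apply: eq_big_seq => p pr.
by rewrite (ev_agree (wfr p pr) xyA xyL).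
Qed.

Lemma ev_inv A L e : wf A L e -> SLinv (@ev K Q e).
Proof.
move=> wfe g x SLg; rewrite /ev dets_inv // con_inv //.
- exact: pol_vbl.
- exact: wf_cl wfe.
- exact: wf_uniq wfe.
- by move=> l lcl; apply: vbl_lin; apply: (wf_one wfe).
- exact: vbl_inv (wf_bl wfe).
Qed.

Lemma evs_inv A L r : (forall p, p \in r -> wf A L p.2) -> SLinv (evs r).
Proof.
by move=> wfr g x SLg; apply: eq_big_seq => p pr; rewrite (ev_inv (wfr p pr)).
Qed.

Lemma evs_filter r s (k : data -> nat) n f x :
  (forall p, p \in r -> forall c y, c != 0 -> ev p.2 (s c y) = c ^+ k p.2 * ev p.2 y) ->
  (forall y, f y = evs r y) -> hom_deg s n f ->
  f x = evs [seq p <- r | k p.2 == n] x.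
Proof.
move=> rs fr fs; rewrite /evs big_filter.
apply: (separate_weights K_infinite) => c nz_c; rewrite -fs // fr /evs.
by apply: eq_big_seq => p pr; rewrite (rs p pr) // mulrCA.
Qed.

Lemma lift_list (P P' : data -> Prop) (R : pt -> Prop) :
  (forall e, P e -> exists e', P' e' /\ forall x, R x -> ev e' x = ev e x) ->
  forall r, (forall p, p \in r -> P p.2) -> exists r', (forall p, p \in r' -> P' p.2) /\
    forall x, R x -> evs r' x = evs r x.
Proof.
move=> lift; elim=> [|p r IHr] Pr; first by exists [::].
have [r' [Pr' r'E]] : exists r', (forall p, p \in r' -> P' p.2) /\
    forall x, R x -> evs r' x = evs r x.
  by apply: IHr => q qr; apply: Pr; rewrite inE qr orbT.
have [e' [Pe' e'E]] := lift _ (Pr p (mem_head _ _)).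
exists ((p.1, e') :: r'); split.
  by move=> q; rewrite inE => /predU1P[->|/Pr'].
by move=> x Rx; rewrite /evs !big_cons e'E // -!/(evs _ _) r'E.
Qed.

Lemma gact_scl g l c x : gact g (scl l c x) =1 scl l c (gact g x).
Proof.
move=> [[a [i j]]|[l' i]] //=; rewrite /mv /scl !vec_setv.
by case: eqP => [->|_] //; rewrite /vec /= /mv /vec; ring.
Qed.

Lemma gact_scm g a c x : gact g (scm a c x) =1 scm a c (gact g x).
Proof. by move=> [[a' [i j]]|[l' i]] //=; rewrite /ent /=; case: eqP => _; ring. Qed.

Lemma rest_scl A L l c x : rest A L (scl l c x) =1 scl l c (rest A L x).
Proof.
move=> [[a [i j]]|[l' i]] //=; rewrite /vec /=.
by case: eqP => [->|_]; case: ifP => _ //; rewrite mulr0.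
Qed.

Lemma rest_scm A L a c x : rest A L (scm a c x) =1 scm a c (rest A L x).
Proof.
by move=> [[a' [i j]]|[l' i]] //=; case: ifP => _; case: eqP => _ //; rewrite mulr0.
Qed.

Lemma scl_scl l l' c c' x : scl l c (scl l' c' x) =1 scl l' c' (scl l c x).
Proof.
move=> [p|[k i]] //=; rewrite /vec /=.
by do ![case: eqP => //]; move=> *; subst => //; rewrite mulrCA.
Qed.

Lemma graded_scl l f : pol f -> exists N (F : nat -> pt -> K),
   [/\ forall k, pol (F k), forall k, hom_deg (scl l) k (F k),
       forall x, f x = \sum_(k < N) F k x
     & forall (phi : pt -> pt) lam, (forall c x, phi (scl l c x) =1 scl l c (phi x)) ->
         (forall x, f (phi x) = lam * f x) -> forall k x, F k (phi x) = lam * F k x].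
Proof.
move=> pf; have [||i|N [F [pF Fs fF Fphi]]] := pol_graded K_infinite (s := scl l) _ _ _ pf.
- by move=> x [p|[k i]] //=; case: eqP => // ->; rewrite mul1r.
- by move=> c c' x [p|[k i]] //=; rewrite /vec /= eqxx; case: eqP => // _; rewrite mulrA.
- case: i => [p|[k i]] /=; first by exists 0%N => c x; rewrite mul1r.
  exists (k == l); move=> c x; case: eqP => [->|_]; rewrite ?expr1 ?expr0 ?mul1r //.
by exists N, F; split=> // k c x _; apply: Fs.
Qed.

Lemma graded_scm a f : pol f -> exists N (F : nat -> pt -> K),
   [/\ forall k, pol (F k), forall k, hom_deg (scm a) k (F k),
       forall x, f x = \sum_(k < N) F k x
     & forall (phi : pt -> pt) lam, (forall c x, phi (scm a c x) =1 scm a c (phi x)) ->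
         (forall x, f (phi x) = lam * f x) -> forall k x, F k (phi x) = lam * F k x].
Proof.
move=> pf; have [||i|N [F [pF Fs fF Fphi]]] := pol_graded K_infinite (s := scm a) _ _ _ pf.
- by move=> x [[b p]|[k i]] //=; case: eqP => //; rewrite mul1r.
- by move=> c c' x [[b p]|[k i]] //=; case: eqP => // _; rewrite mulrA.
- case: i => [[b p]|[k i]] /=; last by exists 0%N => c x; rewrite mul1r.
  by exists (b == a); move=> c x; case: eqP => _; rewrite ?expr1 ?expr0 ?mul1r.
by exists N, F; split=> // k c x _; apply: Fs.
Qed.

Lemma curve_scl l f x : pol f -> exists q : {poly K}, forall c, f (scl l c x) = q.[c].
Proof.
move=> pf; pose gam (k : idx) : {poly K} := match k with
  | inl _ => (x k)%:P | inr (l', i) => if l' == l then x k *: 'X else (x k)%:P end.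
have [q qE] := pol_curve gam pf; exists q => c; rewrite -qE.
apply: pol_ext_arg => // -[p|[k i]] /=; rewrite ?hornerC //.
by case: eqP => [->|_]; rewrite !hornerE // mulrC.
Qed.

Lemma curve_scm a f x : pol f -> exists q : {poly K}, forall c, f (scm a c x) = q.[c].
Proof.
move=> pf; pose gam (k : idx) : {poly K} := match k with
  | inl (a', _) => if a' == a then x k *: 'X else (x k)%:P | inr _ => (x k)%:P end.
have [q qE] := pol_curve gam pf; exists q => c; rewrite -qE.
apply: pol_ext_arg => // -[[b p]|[k i]] /=; rewrite ?hornerC //.
by case: eqP => _; rewrite !hornerE // mulrC.
Qed.

Lemma wf_nil L e : wf [::] L e -> e.1.1 = [::] /\ e.1.2 = [::].
Proof.
move=> wfe; split.
  by case: e.1.1 (wf_al wfe) => [//|a al] /(_ a (mem_head _ _)).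
by case: e.1.2 (wf_cla wfe) => [//|c cl] /(_ c.2 (mem_head _ _)).
Qed.

Lemma wf_nilP L (bl : bracket_list Q) :
  okbl bl -> {subset labs bl <= L} -> wf [::] L ([::], [::], bl).
Proof. by move=> okb sub; split=> //= l lbl; rewrite sub. Qed.

End SLInvariants.

(** * Elimination of the auxiliary vectors *)

Section SLTheorem.

Variables (K : fieldType) (Q : quiver).
Hypothesis K_infinite : infinite_type K.

Local Notation idx := (idx Q).
Local Notation label := (label Q).
Local Notation pt := (idx -> K).
Local Notation data := (tensor_data Q).
Implicit Types (x y : pt) (l : label) (L : seq label) (A : seq (arr Q)) (f : pt -> K) (e : data).

(** Since h and the determinant are invariant, the determinant kills the difference of f at gx and
    at x, and it can be cancelled. *)
Lemma SLinv_cancel (i1 i2 i3 i4 : idx) f h : uniq [:: i1; i2; i3; i4] ->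
  pol f -> (forall x, h x = det4 i1 i2 i3 i4 x * f x) ->
  SLinv h -> SLinv (det4 i1 i2 i3 i4 : pt -> K) -> SLinv f.
Proof.
move=> iu pf hE hinv dinv g x SLg; apply/eqP; rewrite -subr_eq0; apply/eqP.
move: x; apply: (det4_cancel K_infinite iu).
  by apply: alg_sub => //; apply: (pol_gact g pf).
by move=> x; rewrite mulrBr -{1}(dinv g x SLg) -!hE hinv // subrr.
Qed.

Lemma pol_scl f l c : pol f -> pol (fun x : pt => f (scl l c x)).
Proof.
move=> pf; apply: pol_comp pf => -[p|[k i]] /=; first exact: pol_coord.
by case: (k == l); [apply: alg_scale; apply: pol_coord | apply: pol_coord].
Qed.

(* f with u_l replaced by u_(l2) is covered by the induction hypothesis; renaming
   some occurrences of l2 into l lifts it to an invariant which agrees with f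
   whenever u_l and u_(l2) are proportional, so the difference is divisible by
   the bracket [u_(l2), u_l]. *)
Lemma span_vec_step l l2 L : l \notin L -> l2 \in L -> vx l2 = vx l ->
  (forall f, pol f -> SLinv f -> dep [::] L f -> span [::] L f) ->
  forall (e1 e2 : nat) f, pol f -> SLinv f -> dep [::] (l :: L) f ->
    hom_deg (scl l) e1 f -> hom_deg (scl l2) e2 f -> span [::] (l :: L) f.
Proof.
move=> lL l2L vl IHL; have ll2 : l2 != l by apply: contraNneq lL => <-.
elim/ltn_ind=> e1 IHe e2 f pf finv fdep fh1 fh2.
pose sub x := setv x l (vec x l2).
pose h x := f (sub x).
have ph : pol h.
  apply: pol_comp pf => -[p|[k i]] /=; first exact: pol_coord.
  by case: (k == l); apply: pol_coord.
have hinv : SLinv h.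
  move=> g x SLg; rewrite /h -(finv g (sub x) SLg); apply: pol_ext_arg => // -[[a [i j]]|[k i]] //=.
  by rewrite vec_setv; case: eqP => // ->; rewrite -vl.
have hdep : dep [::] L h.
  move=> x; rewrite /h -(fdep (sub x)) -[in LHS]fdep; apply: pol_ext_arg => // -[[a ij]|[k i]] //=.
  rewrite !inE; case: eqP => [->|_] /=; first by rewrite /vec /= l2L.
  by case: (k \in L).
have hh : hom_deg (scl l2) (e1 + e2) h.
  move=> c x nz_c; rewrite /h exprD -mulrA -fh2 // -fh1 //; apply: pol_ext_arg => // -[p|[k i]] //=.
  by rewrite /vec /= !eqxx [l == l2]eq_sym (negPf ll2); case: (k == l).
have [r [wfr hr]] := IHL h ph hinv hdep.
pose cnt k (e : data) := count_mem k (labs e.2).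
pose P e := wf [::] L e /\ cnt l2 e = (e1 + e2)%N.
pose P' e := [/\ wf [::] (l :: L) e, cnt l e = e1 & cnt l2 e = e2].
pose R x := vec x l =1 vec x l2.
have lift e : P e -> exists e', P' e' /\ forall x, R x -> ev e' x = ev e x.
  case: e => [[al cl] bl] [wfe]; rewrite /cnt /= => n_bl.
  have [/= al0 cl0] := wf_nil wfe; rewrite {}al0 {}cl0 in wfe *.
  have n_le : (e1 <= count_mem l2 (labs bl))%N by rewrite n_bl leq_addr.
  have l2l : l != l2 by rewrite eq_sym.
  have [bl' [okb' cnt' vb']] := rename_many K n_le l2l (esym vl) (wf_bl wfe).
  have lbl : l \notin labs bl by apply: contra lL => /(wf_labs wfe).
  have l0 : count_mem l (labs bl) = 0%N by apply/count_memPn.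
  exists ([::], [::], bl'); split; last by move=> x Rx; rewrite /ev /= (vb' _ Rx).
  split; rewrite /cnt /=.
  - apply: wf_nilP => // k kbl; rewrite inE; case: eqP => //= /eqP kl.
    have : (0 < count_mem k (labs bl'))%N by rewrite -has_count has_pred1.
    have := cnt' k; rewrite (negPf kl) muln0 addn0 => cntk k_gt0.
    have : k \in labs bl by rewrite -has_pred1 has_count -cntk ltn_addr.
    by move/(wf_labs wfe).
  - have := cnt' l; rewrite eqxx [l == l2]eq_sym (negPf ll2) muln0 muln1 addn0.
    by move=> ->; rewrite l0.
  - have := cnt' l2; rewrite eqxx (negPf ll2) muln0 muln1 addn0 n_bl.
    by rewrite addnC => /addnI.
(* Only the terms with exactly e1 + e2 occurrences of l2 are kept, so that renaming e1 of them
   leaves e2. *)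
have hr' x : h x = evs [seq p <- r | cnt l2 p.2 == (e1 + e2)%N] x.
  apply: evs_filter hr hh => // p pr c y _; apply: ev_scl.
  by apply: (wf_free (wfr p pr)).
have [|r' [Pr' r'E]] := lift_list lift (r := [seq p <- r | cnt l2 p.2 == (e1 + e2)%N]).
  by move=> p; rewrite mem_filter => /andP[/eqP ? /wfr].
have wfr' p : p \in r' -> wf [::] (l :: L) p.2 by case/Pr'.
pose d x := f x - evs r' x.
have pd : pol d by apply: alg_sub => //; apply: pol_evs.
have dinv : SLinv d by move=> g x SLg; rewrite /d finv // (evs_inv wfr').
have dh1 : hom_deg (scl l) e1 d.
  move=> c x nz_c; rewrite /d fh1 // mulrBr /evs mulr_sumr; congr (_ - _).
  apply: eq_big_seq => p /Pr'[wfp <- _]; rewrite ev_scl 1?mulrCA //.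
  by apply: (wf_free wfp); apply: mem_head.
have dh2 : hom_deg (scl l2) e2 d.
  move=> c x nz_c; rewrite /d fh2 // mulrBr /evs mulr_sumr; congr (_ - _).
  apply: eq_big_seq => p /Pr'[wfp _ <-]; rewrite ev_scl 1?mulrCA //.
  by apply: (wf_free wfp); rewrite inE l2L orbT.
pose i1 : idx := inr (l2, false); pose i2 : idx := inr (l2, true).
pose i3 : idx := inr (l, false); pose i4 : idx := inr (l, true).
have iu : uniq [:: i1; i2; i3; i4].
  have E k b k' b' : (inr (k, b) == inr (k', b') :> idx) = (k == k') && (b == b') by [].
  by rewrite /= !inE !E (negPf ll2) !eqxx.
have d0 x : x i1 != 0 -> x i3 != 0 -> det4 i1 i2 i3 i4 x = 0 -> d x = 0.
  move=> x1 x3 /eqP; rewrite /det4 subr_eq0 => /eqP eqx.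
  (* Where the bracket vanishes, u_l is x_i3 / x_i1 times u_(l2), and homogeneity in u_l reduces to
     equal vectors. *)
  have nz_c : x i3 / x i1 != 0 by rewrite mulf_neq0 ?invr_eq0.
  have -> : d x = d (scl l (x i3 / x i1) (sub x)).
    apply: pol_ext_arg => // -[p|[k i]] //=; rewrite /vec /= eqxx; case: eqP => // ->.
    case: i; rewrite -/i1 -/i2 -/i3 -/i4; last by rewrite divfK.
    by rewrite mulrAC [x i3 * _]mulrC -eqx mulrAC divff ?mul1r.
  rewrite dh1 // /d r'E; last by move=> i; rewrite !vec_setv eqxx (negPf ll2).
  rewrite -/(h x) hr' (_ : evs _ (sub x) = evs [seq p <- r | cnt l2 p.2 == (e1 + e2)%N] x).
    by rewrite subrr mulr0.
  apply: (evs_agree (A := [::]) (L := L)) => // [p|k kL i].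
    by rewrite mem_filter => /andP[_ /wfr].
  by rewrite vec_setv; case: eqP kL => // ->; rewrite (negPf lL).
have [q0 pq0 dq0] := pol_div_det4 K_infinite iu pd d0.
(* The division gives no control over the other coordinates of the quotient. Setting them to zero
   keeps the equation and yields [dep]. *)
pose q x := q0 (rest [::] (l :: L) x).
have pq : pol q by apply: pol_rest.
have dq x : d x = det4 i1 i2 i3 i4 x * q x.
  have <- : d (rest [::] (l :: L) x) = d x.
    rewrite /d fdep; congr (_ - _).
    by apply: eq_big_seq => p pr; rewrite (ev_rest _ (wfr' p pr)).
  by rewrite dq0 /det4 /= !inE l2L eqxx orbT.
have detinv : SLinv (det4 i1 i2 i3 i4 : pt -> K).
  by move=> g x SLg; have := br_gact g x vl; rewrite SLg mul1r /br /vec /det4.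
have qinv := SLinv_cancel iu pq dq dinv detinv.
have qdep : dep [::] (l :: L) q.
  move=> x; apply: (pol_ext_arg pq0) => -[[a ij]|[k i]] //=.
  by case: (k \in l :: L).
have qh k (e : nat) : k = l \/ k = l2 -> hom_deg (scl k) e d ->
    (1 <= e)%N /\ hom_deg (scl k) (e - 1) q \/ forall x, q x = 0.
  move=> kl dh; apply: (homog_quot K_infinite) => [x|c x nz_c]; first exact: curve_scl.
  apply/eqP; rewrite -subr_eq0; apply/eqP; move: x; apply: (det4_cancel K_infinite iu).
    apply: alg_sub; apply: alg_scale => //.
    by apply: pol_scl.
  move=> x; have dc : det4 i1 i2 i3 i4 (scl k c x) = c * det4 i1 i2 i3 i4 x.
    rewrite /det4 /i1 /i2 /i3 /i4 /= /vec /=.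
    by case: kl => ->; rewrite !eqxx ?[l == l2]eq_sym (negPf ll2); ring.
  by rewrite mulrBr expr1 mulrA [det4 _ _ _ _ x * c]mulrC -dc -dq dh // dq; ring.
have r'span : span [::] (l :: L) (evs r') by exists r'.
suff qspan : span [::] (l :: L) (fun x => det4 i1 i2 i3 i4 x * q x).
  apply: span_ext (span_add r'span qspan) => x; rewrite -dq /d; ring.
have [[e1_gt0 qh1]|q0E] := qh l e1 (or_introl erefl) dh1; last first.
  by apply: span_ext (span0 _ _ _) => x; rewrite q0E mulr0.
have [[e2_gt0 qh2]|q0E] := qh l2 e2 (or_intror erefl) dh2; last first.
  by apply: span_ext (span0 _ _ _) => x; rewrite q0E mulr0.
have [|s [wfs qs]] := IHe (e1 - 1)%N _ (e2 - 1)%N q pq qinv qdep qh1 qh2.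
  by rewrite subn1 prednK.
exists [seq (p.1, ([::], [::], (l2, l) :: p.2.2)) | p <- s]; split.
  move=> _ /mapP[p ps ->]; have wfp := wfs p ps; have [/= al0 cl0] := wf_nil wfp.
  apply: wf_nilP => [|k]; first by rewrite /= vl eqxx (wf_bl wfp).
  rewrite labs_cons !inE => /or3P[/eqP->|/eqP->|/(wf_labs wfp)]; rewrite ?eqxx ?l2L ?orbT //.
  by rewrite cl0 inE.
move=> x; rewrite qs /evs big_map mulr_sumr; apply: eq_big_seq => p /wfs /wf_nil[al0 cl0].
by rewrite mulrCA /ev al0 cl0 /= !mul1r.
Qed.

End SLTheorem.

(** * Rank one matrices and contractions *)

Section SLTheoremMatrix.

Variables (K : fieldType) (Q : quiver).
Hypothesis K_infinite : infinite_type K.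

Local Notation idx := (idx Q).
Local Notation label := (label Q).
Local Notation pt := (idx -> K).
Local Notation data := (tensor_data Q).
Implicit Types (x y : pt) (l : label) (L : seq label) (A : seq (arr Q)) (f : pt -> K) (e : data).

Lemma span_nil_mono l L f : span [::] L f -> span [::] (l :: L) f.
Proof.
move=> [r [wfr fr]]; exists r; split=> // p /wfr wfp; have [al0 cl0] := wf_nil wfp.
case: p al0 cl0 wfp => [c [[al cl] bl]] /= -> -> wfp.
apply: wf_nilP; first exact: wf_bl wfp.
by move=> k /(wf_labs wfp); rewrite inE /= => ->; rewrite orbT.
Qed.

(** SL_2 is transitive on nonzero vectors, and when u_l is moved to the first basis vector nothing
    else that f depends on lives at this vertex. *)
Lemma vec_const l L f : pol f -> SLinv f -> dep [::] (l :: L) f ->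
  (forall l2, l2 \in L -> vx l2 != vx l) ->
  forall x, f x = f (setv x l (bvec false)).
Proof.
move=> pf finv fdep lone x; apply/eqP; rewrite -subr_eq0; apply/eqP; move: x.
apply: (pol_dense_coord K_infinite (i := inr (l, false))).
  by apply: alg_sub => //; apply: pol_setv.
move=> x u0; set c := x _ in u0; apply/eqP; rewrite subr_eq0; apply/eqP.
(* At the vertex of l this is the lower triangular matrix of determinant one that sends u_l, with
   first coordinate c, to (1, 0). *)
pose g v i j : K := if v == vx l then
   (if i then (if j then c else - x (inr (l, true))) else (if j then 0 else c^-1))
   else (i == j)%:R.
have SLg : special g.
  by move=> v; rewrite /det2 /g; case: eqP => _; rewrite /= ?mulVf //; ring.
rewrite -(finv g x SLg) -[LHS]fdep -[RHS]fdep; apply: pol_ext_arg => // -[[a ij]|[k i]] //=.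
rewrite !inE; case: (eqVneq k l) => [->|kl] /=.
  rewrite /mv /vec /= /g !eqxx -/c; case: i => /=; rewrite /bvec /=; last by field.
  by ring.
case: (boolP (k \in L)) => [/lone kl'|//].
by rewrite /mv /vec /= /g (negPf kl'); case: i => /=; ring.
Qed.

(** A label with a companion at the same vertex is handled by [span_vec_step], applied to the
    bihomogeneous pieces; a solitary label has no influence on f. *)
Lemma span_vec L f : uniq L -> pol f -> SLinv f -> dep [::] L f -> span [::] L f.
Proof.
elim: L f => [|l L IHL] f /=.
  move=> _ pf finv fdep; exists [:: (f (fun=> 0), ([::], [::], [::]))]; split.
    by move=> p; rewrite inE => /eqP ->; apply: wf_nilP.
  move=> x; rewrite -fdep /evs big_seq1 /ev /= !mulr1; apply: pol_ext_arg => //.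
  by move=> [[a ij]|[k i]].
case/andP=> lL uL pf finv fdep; have {}IHL h := IHL h uL.
have [/hasP[l2 l2L /eqP vl]|/hasPn lone] := boolP (has (fun l2 => vx l2 == vx l) L).
  have [N [F [pF Fs fF Fphi]]] := graded_scl K_infinite l pf.
  apply: (span_ext (f := fun x => \sum_(k < N) F k x)) => //.
  apply: span_sum => k.
  have [N' [F' [pF' Fs' fF' Fphi']]] := graded_scl K_infinite l2 (pF k).
  apply: (span_ext (f := fun x => \sum_(j < N') F' j x)) => //.
  apply: span_sum => j.
  have Finv : SLinv (F' j).
    move=> g x SLg; rewrite (Fphi' (gact g) 1) ?mul1r // => [c y|y]; first exact: gact_scl.
    rewrite (Fphi (gact g) 1) // => [c z|z]; first exact: gact_scl.
    by rewrite mul1r finv.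
  have Fdep : dep [::] (l :: L) (F' j).
    move=> x; rewrite (Fphi' (rest [::] (l :: L)) 1) ?mul1r // => [c y|y].
      exact: rest_scl.
    rewrite (Fphi (rest [::] (l :: L)) 1) // => [c z|z]; first exact: rest_scl.
    by rewrite mul1r fdep.
  apply: (span_vec_step K_infinite lL l2L vl IHL (pF' j) Finv Fdep _ (Fs' j) (e1 := k)).
  move=> c x nz_c; apply: (Fphi' (scl l c)) => [c' y|y]; first exact: scl_scl.
  exact: Fs.
apply: span_nil_mono; apply: IHL => // x.
rewrite (vec_const pf finv fdep lone) [RHS](vec_const pf finv fdep lone) -[LHS]fdep -[RHS]fdep.
apply: pol_ext_arg => // -[[a ij]|[k i]] //=.
by rewrite !inE; case: eqP => //= _; case: (k \in L).
Qed.

Definition setm x a (m : bool -> bool -> K) : pt := fun k =>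
  match k with
  | inl (a', (i, j)) => if a' == a then m i j else x k
  | inr _ => x k
  end.

Lemma gact_rank1 g x a u w :
  setm (gact g x) a (rank1 (mv (g (ahead a)) u) (mv (g (atail a)) w))
    =1 gact g (setm x a (rank1 u w)).
Proof.
move=> [[a' [i j]]|[k i]] //=; rewrite /ent /=; case: eqP => [->|//].
by rewrite /rank1 /mv /adj2; case: j => /=; ring.
Qed.

Lemma fresh_label v b (s : seq label) : exists k, ((v, b, k) : label) \notin s.
Proof.
exists (\max_(l <- s) l.2).+1; apply/negP => /(@leq_bigmax_seq _ s xpredT (fun l => l.2)).
by move=> /(_ isT); rewrite ltnn.
Qed.

Lemma count_gt0 (l : label) s : (0 < count_mem l s)%N = (l \in s).
Proof. by rewrite -has_count has_pred1. Qed.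

(* Replaces one occurrence of the vector lx and one of the covector ly, which stand
   for a rank one matrix X_a = lx (x) ly, by a contraction with X_a. *)
Lemma lift1 A a lx ly L n e : a \in A -> lx.1 = (ahead a, true) -> ly.1 = (atail a, false) ->
  wf A [:: lx, ly & L] e ->
  count_mem lx (labs e.2) = n.+1 -> count_mem ly (labs e.2) = n.+1 ->
  exists e', [/\ wf A [:: lx, ly & L] e',
     count_mem lx (labs e'.2) = n /\ count_mem ly (labs e'.2) = n,
     arrow_degree e' a = (arrow_degree e a).+1
   & forall x, (forall i j, ent x a i j = rank1 (vec x lx) (vec x ly) i j) ->
        ev e' x = ev e x].
Proof.
move=> aA lxa lya wfe; case: e wfe => [[al cl] bl] wfe /= cx cy.
have lxly : lx != ly by apply/eqP => E; move: lxa; rewrite E lya.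
have [kx fx_new] := fresh_label (ahead a) true [:: lx, ly & labs bl ++ clabs cl ++ L].
have [ky fy_new] := fresh_label (atail a) false [:: lx, ly & labs bl ++ clabs cl ++ L].
move: fx_new fy_new; set fx : label := (_, _, kx); set fy : label := (_, _, ky).
have fxy : fx != fy by apply/eqP => /(congr1 (fun l : label => l.1.2)).
rewrite !inE !mem_cat !negb_or => /and5P[fxlx fxly fxbl fxcl fxL] /and5P[fylx fyly fybl fycl fyL].
have lxbl : lx \in labs bl by rewrite -count_gt0 cx.
have vfx : vx fx = vx lx by rewrite /vx lxa.
have vfy : vx fy = vx ly by rewrite /vx lya.
have [bl1 [ok1 cnt1 vb1]] := rename1 K lxbl vfx (wf_bl wfe).
have lybl1 : ly \in labs bl1.
  have := cnt1 ly; rewrite eq_sym (negPf lxly) [ly == fx]eq_sym (negPf fxly) !addn0 => E.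
  by rewrite -count_gt0 E cy.
have [bl2 [ok2 cnt2 vb2]] := rename1 K lybl1 vfy ok1.
have c0 k : k \notin labs bl -> count_mem k (labs bl) = 0%N by move/count_memPn.
have cnt k : (count_mem k (labs bl2) + (k == lx) + (k == ly) =
    count_mem k (labs bl) + (k == fx) + (k == fy))%N.
  by rewrite addnAC cnt2 addnAC cnt1 addnAC.
have lxcl : lx \notin clabs cl by apply: (wf_free wfe); rewrite inE eqxx.
have lycl : ly \notin clabs cl by apply: (wf_free wfe); rewrite !inE eqxx orbT.
have cnt_other k : k \in clabs cl -> count_mem k (labs bl2) = count_mem k (labs bl).
  move=> kcl; have := cnt k.
  have -> : (k == lx) = false by apply: contraNF lxcl => /eqP <-.
  have -> : (k == ly) = false by apply: contraNF lycl => /eqP <-.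
  have -> : (k == fx) = false by apply: contraNF fxcl => /eqP <-.
  have -> : (k == fy) = false by apply: contraNF fycl => /eqP <-.
  by rewrite !addn0.
have cx2 : count_mem lx (labs bl2) = n.
  have := cnt lx; rewrite eqxx (negPf lxly) ![lx == _]eq_sym (negPf fxlx) (negPf fylx) cx.
  by rewrite !addn0 addn1 => -[].
have cy2 : count_mem ly (labs bl2) = n.
  have := cnt ly; rewrite eqxx [ly == lx]eq_sym (negPf lxly).
  by rewrite [ly == fx]eq_sym [ly == fy]eq_sym (negPf fxly) (negPf fyly) cy !addn0 addn1 => -[].
have cfx : count_mem fx (labs bl2) = 1%N.
  by have := cnt fx; rewrite eqxx (negPf fxlx) (negPf fxly) (negPf fxy) c0 // !addn0.
have cfy : count_mem fy (labs bl2) = 1%N.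
  by have := cnt fy; rewrite eqxx (negPf fylx) (negPf fyly) [fy == fx]eq_sym (negPf fxy) c0 // !addn0.
exists (al, (fx, fy, a) :: cl, bl2); split=> //=.
- split=> //=.
  + exact: wf_al wfe.
  + by move=> b; rewrite inE => /predU1P[->|/(wf_cla wfe)].
  + by rewrite !eqxx (wf_cl wfe).
  + by rewrite inE negb_or fxy fxcl fycl (wf_uniq wfe).
  + move=> k; rewrite clabs_cons !inE => /or3P[/eqP->|/eqP->|kcl] //.
    by rewrite cnt_other // (wf_one wfe).
  + move=> k; rewrite -count_gt0 => k2; rewrite clabs_cons inE [(k \in fy :: _)]inE -orbA.
    case: eqP => //= /eqP kfx; case: eqP => //= /eqP kfy.
    have : (0 < count_mem k (labs bl))%N.
      have := cnt k; rewrite (negPf kfx) (negPf kfy) !addn0 => <-.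
      by rewrite -addnA ltn_addr.
    by rewrite count_gt0 => /(wf_labs wfe).
  + move=> k; rewrite /= !inE !negb_or => /or3P[/eqP->|/eqP->|kL].
    * by rewrite ![lx == _]eq_sym fxlx fylx.
    * by rewrite ![ly == _]eq_sym fxly fyly.
    rewrite (wf_free wfe) ?inE ?kL ?orbT // andbT.
    by apply/andP; split; [apply: contraNneq fxL => E|apply: contraNneq fyL => E]; move: kL; rewrite E.
- by rewrite /arrow_degree /= eqxx addnCA.
move=> x xa; rewrite /ev; congr (_ * _).
(* Giving the fresh labels the values of lx and ly is harmless: they are bound in the new expression
   and absent from the old one. *)
pose y := setv (setv x fx (vec x lx)) fy (vec x ly).
have yx : vec y fx = vec x lx by rewrite !vec_setv (negPf fxy) eqxx.
have yy : vec y fy = vec x ly by rewrite !vec_setv eqxx.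
have ylx : vec y lx = vec x lx by rewrite !vec_setv ![lx == _]eq_sym (negPf fxlx) (negPf fylx).
have yly : vec y ly = vec x ly by rewrite !vec_setv ![ly == _]eq_sym (negPf fxly) (negPf fyly).
have pv := pol_vbl K.
have linf l : count_mem l (labs bl2) = 1%N -> l \notin clabs cl -> lin l (con cl (vbl bl2 : pt -> K)).
  by move=> l1 lcl; apply: con_lin => //; apply: vbl_lin.
transitivity (con ((fx, fy, a) :: cl) (vbl bl2) y).
  apply: con_agree => [c _ i j //|k _]; rewrite clabs_cons !inE !negb_or => /and3P[kx' ky' _] i.
  by rewrite /y !vec_setv (negPf kx') (negPf ky').
transitivity (con cl (vbl bl2) y).
  apply: con_rank1 => //; [exact: linf | exact: linf |].
  by move=> i j; rewrite yx yy -xa.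
transitivity (con cl (vbl bl) y).
  apply: (con_eq (P := fun z => vec z fx =1 vec z lx /\ vec z fy =1 vec z ly)).
  - move=> z l u lcl [zx zy]; rewrite !vec_setv.
    have nl k : k \notin clabs cl -> (k == l) = false by apply: contraNF => /eqP ->.
    by rewrite !nl.
  - by move=> z [zx zy]; rewrite vb2 // vb1.
  - by rewrite yx yy ylx yly.
apply: con_agree => [c _ i j //|k kbl _ i].
have nk l : l \notin labs bl -> (k == l) = false by apply: contraNF => /eqP <-.
by rewrite /y !vec_setv !nk.
Qed.

Lemma lift_many A a lx ly L n e : a \in A -> lx.1 = (ahead a, true) -> ly.1 = (atail a, false) ->
  wf A [:: lx, ly & L] e ->
  count_mem lx (labs e.2) = n -> count_mem ly (labs e.2) = n ->
  exists e', [/\ wf A L e', arrow_degree e' a = (arrow_degree e a + n)%N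
   & forall x, (forall i j, ent x a i j = rank1 (vec x lx) (vec x ly) i j) ->
        ev e' x = ev e x].
Proof.
move=> aA lxa lya; elim: n e => [|n IHn] e wfe cx cy.
  exists e; split; rewrite ?addn0 //; case: wfe => w1 w2 w3 w4 w5 w6 w7 w8; split=> //.
    move=> l lbl; have := w7 l lbl; rewrite !inE.
    have -> : (l == lx) = false by apply: contraTF lbl => /eqP ->; rewrite -count_gt0 cx.
    by have -> : (l == ly) = false by apply: contraTF lbl => /eqP ->; rewrite -count_gt0 cy.
  by move=> l lL; apply: w8; rewrite !inE lL !orbT.
have [e1 [wf1 [cx1 cy1] deg1 ev1]] := lift1 aA lxa lya wfe cx cy.
have [e2 [wf2 deg2 ev2]] := IHn e1 wf1 cx1 cy1.
exists e2; split=> // [|x xa]; last by rewrite ev2 ?ev1.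
by rewrite deg2 deg1 addSnnS.
Qed.

End SLTheoremMatrix.

(** * Elimination of the arrows *)

Section SLTheoremFinal.

Variables (K : fieldType) (Q : quiver).
Hypothesis K_infinite : infinite_type K.

Local Notation idx := (idx Q).
Local Notation label := (label Q).
Local Notation pt := (idx -> K).
Local Notation data := (tensor_data Q).
Implicit Types (x y : pt) (l : label) (L : seq label) (A : seq (arr Q)) (f : pt -> K) (e : data).

(* f is restricted to matrices X_a of rank one; lifting the resulting combination
   gives an invariant which agrees with f where det X_a = 0. *)
Lemma span_mat_step a A L : a \notin A -> uniq L ->
  (forall L f, uniq L -> pol f -> SLinv f -> dep A L f -> span A L f) ->
  forall (n : nat) f, pol f -> SLinv f -> dep (a :: A) L f ->
    hom_deg (scm a) n f -> span (a :: A) L f.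
Proof.
move=> aA uL IHA; elim/ltn_ind=> n IHn f pf finv fdep fh.
have [kx lxL] := fresh_label (ahead a) true L.
have [ky lyL] := fresh_label (atail a) false L.
move: lxL lyL; set lx : label := (_, _, kx); set ly : label := (_, _, ky) => lxL lyL.
have lxy : lx != ly by apply/eqP => /(congr1 (fun l : label => l.1.2)).
pose sub x := setm x a (rank1 (vec x lx) (vec x ly)).
pose h x := f (sub x).
have psub i : pol (fun x => sub x i).
  case: i => [[b [i j]]|k] /=; last exact: pol_coord.
  case: (b == a); last exact: pol_coord.
  rewrite /rank1; case: j; first by apply: alg_mul; apply: pol_vec.
  by apply: alg_opp; apply: alg_mul; apply: pol_vec.
have ph : pol h by apply: pol_comp pf.
have hinv : SLinv h.
  move=> g x SLg; rewrite /h -(finv g (sub x) SLg); apply: pol_ext_arg => //.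
  exact: gact_rank1.
have hdep : dep A [:: lx, ly & L] h.
  move=> x; rewrite /h -(fdep (sub x)) -[in LHS]fdep; apply: pol_ext_arg => // -[[b [i j]]|[k i]] /=.
    rewrite inE; case: eqP => [->|_] //=; last by case: (b \in A).
    by rewrite /rank1 /vec /= !inE !eqxx orbT.
  by rewrite !inE; case: (boolP (k \in L)); rewrite ?orbT.
have hhx : hom_deg (scl lx) n h.
  move=> c x nz_c; rewrite /h -fh //; have -> : f (sub (scl lx c x)) = f (scl lx c (scm a c (sub x))).
    apply: pol_ext_arg => // -[[b [i j]]|[k i]] //=; rewrite ?/vec //=.
    case: eqP => // _; rewrite /rank1 /vec /= eqxx [ly == lx]eq_sym (negPf lxy).
    by case: j; ring.
  rewrite -[LHS]fdep -[RHS]fdep; apply: pol_ext_arg => // -[[b [i j]]|[k i]] //=.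
  by case: (boolP (k \in L)) => // kL; case: eqP => // E; rewrite -E kL in lxL.
have hhy : hom_deg (scl ly) n h.
  move=> c x nz_c; rewrite /h -fh //; have -> : f (sub (scl ly c x)) = f (scl ly c (scm a c (sub x))).
    apply: pol_ext_arg => // -[[b [i j]]|[k i]] //=; rewrite ?/vec //=.
    case: eqP => // _; rewrite /rank1 /vec /= eqxx (negPf lxy).
    by case: j; ring.
  rewrite -[LHS]fdep -[RHS]fdep; apply: pol_ext_arg => // -[[b [i j]]|[k i]] //=.
  by case: (boolP (k \in L)) => // kL; case: eqP => // E; rewrite -E kL in lyL.
have uL2 : uniq [:: lx, ly & L] by rewrite /= inE negb_or lxy lxL lyL.
have [r [wfr hr]] := IHA _ h uL2 ph hinv hdep.
pose cnt k (e : data) := count_mem k (labs e.2).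
(* In the remaining terms lx and ly both occur n times, so they can be paired off completely into
   contractions with X_a. *)
pose r1 := [seq p <- r | cnt lx p.2 == n]; pose r2 := [seq p <- r1 | cnt ly p.2 == n].
have hr1 x : h x = evs r1 x.
  apply: (evs_filter K_infinite (r := r)) hhx => // p pr c y _; apply: ev_scl.
  by apply: (wf_free (wfr p pr)); apply: mem_head.
have hr2 x : h x = evs r2 x.
  apply: (evs_filter K_infinite (r := r1)) hhy => // p; rewrite mem_filter => /andP[_ pr] c y _.
  by apply: ev_scl; apply: (wf_free (wfr p pr)); rewrite !inE eqxx orbT.
pose P e := [/\ wf A [:: lx, ly & L] e, cnt lx e = n & cnt ly e = n].
pose P' e := wf (a :: A) L e /\ arrow_degree e a = n.
pose R x := forall i j, ent x a i j = rank1 (vec x lx) (vec x ly) i j.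
have lift e : P e -> exists e', P' e' /\ forall x, R x -> ev e' x = ev e x.
  move=> [wfe cx cy].
  have wfe' : wf (a :: A) [:: lx, ly & L] e.
    by case: wfe => *; split=> // b; rewrite inE => bE; apply/orP; right; auto.
  have [e' [wf' deg' ev']] := lift_many K (mem_head a A) (erefl : lx.1 = _) (erefl : ly.1 = _) wfe' cx cy.
  exists e'; split=> //; split=> //; rewrite deg' /arrow_degree.
  have -> : count_mem a e.1.1 = 0%N by apply/count_memPn; apply: contra aA => /(wf_al wfe).
  by have -> : count_mem a [seq c.2 | c <- e.1.2] = 0%N
    by apply/count_memPn; apply: contra aA => /(wf_cla wfe).
have [|r' [Pr' r'E]] := lift_list lift (r := r2).
  by move=> p; rewrite !mem_filter => /andP[/eqP ? /andP[/eqP ? /wfr]].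
have wfr' p : p \in r' -> wf (a :: A) L p.2 by case/Pr'.
pose d x := f x - evs r' x.
have pd : pol d by apply: alg_sub => //; apply: pol_evs.
have dinv : SLinv d by move=> g x SLg; rewrite /d finv // (evs_inv wfr').
have dh : hom_deg (scm a) n d.
  move=> c x nz_c; rewrite /d fh // mulrBr /evs mulr_sumr; congr (_ - _).
  by apply: eq_big_seq => p /Pr'[wfp <-]; rewrite ev_scm 1?mulrCA.
pose i1 : idx := inl (a, (false, false)); pose i2 : idx := inl (a, (false, true)).
pose i3 : idx := inl (a, (true, false)); pose i4 : idx := inl (a, (true, true)).
have iu : uniq [:: i1; i2; i3; i4].
  have E k b k' b' : (inl (k, b) == inl (k', b') :> idx) = (k == k') && (b == b') by [].
  by rewrite /= !inE !E !eqxx.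
have d0 x : x i1 != 0 -> x i3 != 0 -> det4 i1 i2 i3 i4 x = 0 -> d x = 0.
  move=> x1 _ /eqP; rewrite /det4 subr_eq0 => /eqP eqx.
  pose u i := x (inl (a, (i, false))).
  (* A singular X_a with nonzero upper left entry is its first column times the covector (1, x_i2 /
     x_i1), whose stored form is (x_i2 / x_i1, -1). *)
  pose w i : K := if i then -1 else x i2 / x i1.
  pose y := setv (setv x lx u) ly w.
  have ylx : vec y lx = u by rewrite !vec_setv (negPf lxy) eqxx.
  have yly : vec y ly = w by rewrite !vec_setv eqxx.
  have Ry : R y.
    move=> i j; rewrite ylx yly /rank1 /ent /= /w /u.
    case: i; case: j; rewrite ?mulrN1 ?opprK //.
      by rewrite -/i4 -/i3 mulrA [x i3 * _]mulrC -eqx mulrAC divff ?mul1r.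
    by rewrite -/i2 -/i1 mulrC divfK.
  have yL k : k \in L -> vec y k =1 vec x k.
    move=> kL i; rewrite !vec_setv; case: eqP => [E|_]; first by rewrite -E kL in lyL.
    by case: eqP => [E|_] //; rewrite -E kL in lxL.
  rewrite /d -(evs_agree wfr' (x := y)) // r'E // -hr2 /h.
  apply/eqP; rewrite subr_eq0 -[f x]fdep -[f (sub y)]fdep; apply/eqP.
  apply: pol_ext_arg => // -[[b [i j]]|[k i]] /=.
    by case: ifP => // _; case: eqP => [->|//]; rewrite -Ry.
  by case: (boolP (k \in L)) => // kL; exact/esym/(yL k kL i).
have [q0 pq0 dq0] := pol_div_det4 K_infinite iu pd d0.
pose q x := q0 (rest (a :: A) L x).
have pq : pol q by apply: pol_rest.
have dq x : d x = det4 i1 i2 i3 i4 x * q x.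
  have <- : d (rest (a :: A) L x) = d x.
    rewrite /d fdep; congr (_ - _).
    by apply: eq_big_seq => p pr; rewrite (ev_rest _ (wfr' p pr)).
  by rewrite dq0 /det4 /= !inE eqxx.
have detinv : SLinv (det4 i1 i2 i3 i4 : pt -> K).
  by move=> g x SLg; have := detm_gact g x a; rewrite !SLg !mul1r.
have qinv := SLinv_cancel K_infinite iu pq dq dinv detinv.
have qdep : dep (a :: A) L q.
  move=> x; apply: (pol_ext_arg pq0) => -[[b ij]|[k i]] /=.
    by case: (b \in a :: A).
  by case: (k \in L).
have qh : (2 <= n)%N /\ hom_deg (scm a) (n - 2) q \/ forall x, q x = 0.
  apply: (homog_quot K_infinite) => [x|c x nz_c]; first exact: curve_scm.
  apply/eqP; rewrite -subr_eq0; apply/eqP; move: x; apply: (det4_cancel K_infinite iu).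
    apply: alg_sub; apply: alg_scale => //.
    apply: pol_comp pq => -[[b ij]|k] /=; last exact: pol_coord.
    by case: (b == a); [apply: alg_scale; apply: pol_coord | apply: pol_coord].
  move=> x; have dc : det4 i1 i2 i3 i4 (scm a c x) = c ^+ 2 * det4 i1 i2 i3 i4 x.
    by rewrite /det4 /i1 /i2 /i3 /i4 /= !eqxx; ring.
  by rewrite mulrBr mulrA [det4 _ _ _ _ x * _]mulrC -dc -dq dh // dq; ring.
have r'span : span (a :: A) L (evs r') by exists r'.
suff qspan : span (a :: A) L (fun x => det4 i1 i2 i3 i4 x * q x).
  apply: span_ext (span_add r'span qspan) => x; rewrite -dq /d; ring.
have [[n_ge2 qh1]|q0E] := qh; last first.
  by apply: span_ext (span0 _ _ _) => x; rewrite q0E mulr0.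
have [|s [wfs qs]] := IHn (n - 2)%N _ q pq qinv qdep qh1.
  by rewrite ltn_subrL (ltn_trans _ n_ge2).
exists [seq (p.1, (a :: p.2.1.1, p.2.1.2, p.2.2)) | p <- s]; split.
  move=> _ /mapP[p ps ->]; case: (wfs p ps) => w1 *; split=> //= b.
  by rewrite inE => /predU1P[->|/w1 //]; apply: mem_head.
move=> x; rewrite qs /evs big_map mulr_sumr; apply: eq_big_seq => p _.
by rewrite mulrCA; congr (_ * _); rewrite /ev /= -mulrA.
Qed.

(** Removing an arrow introduces a vector at its head and a covector at its tail, so the induction
    over A must allow arbitrary L. *)
Lemma span_mat A L f : uniq A -> uniq L -> pol f -> SLinv f -> dep A L f -> span A L f.
Proof.
elim: A L f => [|a A IHA] L f /=; first by move=> _; apply: span_vec.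
case/andP=> aA uA uL pf finv fdep.
have [N [F [pF Fs fF Fphi]]] := graded_scm K_infinite a pf.
apply: (span_ext (f := fun x => \sum_(k < N) F k x)) => //.
apply: span_sum => k.
apply: (span_mat_step aA uL (fun L f uL => IHA L f uA uL) (pF k) _ _ (Fs k)).
  move=> g x SLg; rewrite (Fphi (gact g) 1) ?mul1r // => [c y|y]; first exact: gact_scm.
  by rewrite mul1r finv.
move=> x; rewrite (Fphi (rest (a :: A) L) 1) ?mul1r // => [c y|y]; first exact: rest_scm.
by rewrite mul1r fdep.
Qed.

End SLTheoremFinal.

(** * Traces and determinants of closed paths *)

Section Paths.

Variables (K : fieldType) (Q : quiver).

Local Notation idx := (idx Q).
Local Notation label := (label Q).
Local Notation pt := (idx -> K).
Implicit Types (x y : pt) (l : label) (f : pt -> K) (P : seq (arr Q)).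

Fixpoint ptv (u : ver Q) P (v : ver Q) : bool :=
  if P is a :: P' then (atail a == u) && ptv (ahead a) P' v else u == v.

Lemma ptv_cat u P v P' w : ptv u P v -> ptv v P' w -> ptv u (P ++ P') w.
Proof.
elim: P u => [|a P IHP] u /=; first by move/eqP ->.
by case/andP=> -> /IHP; apply.
Qed.

Definition mm (m m' : bool -> bool -> K) (i j : bool) : K :=
  m i false * m' false j + m i true * m' true j.
Definition tr2 (m : bool -> bool -> K) : K := m false false + m true true.

Fixpoint pmb x P : bool -> bool -> K :=
  if P is a :: P' then mm (pmb x P') (ent x a) else fun i j => (i == j)%:R.

Definition pv x P u : bool -> K := mv (pmb x P) u.

Lemma pmb_cat x P P' i j : pmb x (P ++ P') i j = mm (pmb x P') (pmb x P) i j.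
Proof.
elim: P i j => [|a P IHP] i j /=; first by rewrite /mm; case: j => /=; ring.
by rewrite /mm !IHP /mm; ring.
Qed.

Lemma det_mm m m' : det2 (mm m m') = det2 m * det2 m'.
Proof. by rewrite /det2 /mm; ring. Qed.

Lemma det_pmb_cat x P P' : det2 (pmb x (P ++ P')) = det2 (pmb x P) * det2 (pmb x P').
Proof.
by rewrite mulrC -det_mm /det2 !pmb_cat.
Qed.

Lemma pmb_agree x y P : (forall a i j, ent x a i j = ent y a i j) -> pmb x P =2 pmb y P.
Proof.
move=> xy; elim: P => [//|a P IHP] i j /=; by rewrite /mm !IHP !xy.
Qed.

Definition path_gen f := exists u P, [/\ P != [::], ptv u P u
  & f = (fun x => tr2 (pmb x P)) \/ f = (fun x => det2 (pmb x P))].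

Definition palg : (pt -> K) -> Prop := alg path_gen.

Lemma palg_tr u P : P != [::] -> ptv u P u -> palg (fun x => tr2 (pmb x P)).
Proof. by move=> P0 uP; apply: alg_gen; exists u, P; split=> //; left. Qed.

Lemma palg_det u P : P != [::] -> ptv u P u -> palg (fun x => det2 (pmb x P)).
Proof. by move=> P0 uP; apply: alg_gen; exists u, P; split=> //; right. Qed.

Lemma palg_agree f x y : (forall a i j, ent x a i j = ent y a i j) -> palg f -> f x = f y.
Proof.
move=> xy; elim=> [g [u [P [_ _ [->|->]]]]|//|g h _ IHg _ IHh|g h _ IHg _ IHh|g h gh _ IHg].
- by rewrite /tr2 !(pmb_agree P xy).
- by rewrite /det2 !(pmb_agree P xy).
- by rewrite IHg IHh.
- by rewrite IHg IHh.
- by rewrite -!gh.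
Qed.

Definition heads (v : ver Q) (al : seq (arr Q)) := count (fun a => ahead a == v) al.
Definition tails (v : ver Q) (al : seq (arr Q)) := count (fun a => atail a == v) al.

Lemma heads_rem a al v : a \in al -> heads v al = ((ahead a == v) + heads v (rem a al))%N.
Proof. by move=> aal; rewrite /heads (permP (perm_to_rem aal)). Qed.

Lemma tails_rem a al v : a \in al -> tails v al = ((atail a == v) + tails v (rem a al))%N.
Proof. by move=> aal; rewrite /tails (permP (perm_to_rem aal)). Qed.

Lemma dets_rem a al x : a \in al -> dets al x = detm x a * dets (rem a al) x.
Proof.
elim: al => [//|b al IHal]; rewrite inE eq_sym /=; case: eqP => [->//|_] /= /IHal -> /=.
by rewrite mulrCA.
Qed.

Lemma det_path1 x a : det2 (pmb x [:: a]) = detm x a.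
Proof. by rewrite /= /det2 /mm /detm /=; ring. Qed.

(** An Eulerian trail argument: by the balance a trail that is still open can be prolonged at its
    end v. Once it closes, its determinant is a generator, and the remaining arrows are balanced
    again. *)
Lemma dets_trail al P u v : P != [::] -> ptv u P v ->
  (forall w, heads w al + (w == v) = tails w al + (w == u))%N ->
  palg (fun x => det2 (pmb x P) * dets al x).
Proof.
have [n] := ubnP (size al); elim: n al P u v => // n IHn al P u v al_n P0 uPv bal.
have [uv|nuv] := eqVneq u v.
  subst v; apply: alg_mul; first exact: palg_det P0 uPv.
  case: al bal al_n => [|a al] bal al_n; first exact: alg_const.
  have := IHn al [:: a] (atail a) (ahead a) al_n isT.
  rewrite /= !eqxx => /(_ isT) IH.
  apply: (alg_ext _ (IH _)) => [x|w]; first by rewrite det_path1.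
  have := bal w; rewrite /heads /tails /= => /addIn.
  by rewrite ![_ == w]eq_sym ![(_ + count _ _)%N]addnC.
have v_out : (0 < tails v al)%N.
  by have := bal v; rewrite eqxx eq_sym (negPf nuv) addn0 addn1 => <-.
move: v_out; rewrite -has_count => /hasP[a aal /eqP av].
have sz : (size (rem a al) < n)%N.
  by rewrite size_rem //; case: (al) aal al_n => // b s _; rewrite ltnS.
apply: (alg_ext _ (IHn (rem a al) (rcons P a) u (ahead a) sz _ _ _)).
- by move=> x; rewrite -cats1 det_pmb_cat det_path1 -mulrA -dets_rem.
- by case: (P).
- by rewrite -cats1; apply: ptv_cat uPv _; rewrite /= av !eqxx.
- move=> w; have := bal w; rewrite (heads_rem w aal) (tails_rem w aal) av.
  rewrite [v == w]eq_sym [ahead a == w]eq_sym.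
  move: (heads _ _) (tails _ _) => h t.
  by case: (w == v); case: (w == ahead a); case: (w == u) => /=; clear; lia.
Qed.

Lemma dets_balanced al : (forall w, heads w al = tails w al) -> palg (dets al).
Proof.
case: al => [|a al] bal; first exact: alg_const.
have aP : ptv (atail a) [:: a] (ahead a) by rewrite /= !eqxx.
apply: (alg_ext (f := fun x => det2 (pmb x [:: a]) * dets al x)).
  by move=> x; rewrite det_path1.
apply: (@dets_trail al [:: a] _ _ isT aP) => w.
have := bal w; rewrite /heads /tails /= [ahead a == w]eq_sym [atail a == w]eq_sym.
by rewrite addnC => ->; rewrite addnC.
Qed.

Lemma br_det (m : bool -> bool -> K) u w : br (mv m u) (mv m w) = det2 m * br u w.
Proof. by rewrite /br /mv /det2; ring. Qed.

(* A state is a product of brackets of vectors P x (xx), of brackets of covectors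
   (yy) and of terms <y, P x> (tl). *)
Definition xitem := ((label * seq (arr Q)) * (label * seq (arr Q)))%type.
Definition xval (t : xitem) x : K :=
  br (pv x t.1.2 (vec x t.1.1)) (pv x t.2.2 (vec x t.2.1)).
Definition xok (v : ver Q) (t : xitem) : bool :=
  [&& t.1.1.1.2, t.2.1.1.2, ptv (vx t.1.1) t.1.2 v & ptv (vx t.2.1) t.2.2 v].
Definition yval (t : label * label) x : K := br (vec x t.1) (vec x t.2).
Definition yok (v : ver Q) (t : label * label) : bool :=
  [&& ~~ t.1.1.2, ~~ t.2.1.2, vx t.1 == v & vx t.2 == v].
Definition term : eqType := (label * seq (arr Q) * label)%type.
Definition tval (t : term) x : K := br (vec x t.1.1) (pv x t.1.2 (vec x t.2)).
Definition tok (t : term) : bool :=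
  [&& ~~ t.1.1.1.2, t.2.1.2 & ptv (vx t.2) t.1.2 (vx t.1.1)].

Definition tlabs (tl : seq term) : seq label := flatten [seq [:: t.1.1; t.2] | t <- tl].
Definition tprod (tl : seq term) x : K := \prod_(t <- tl) tval t x.

(** Combinations of products of pairings with coefficients in [palg], where every product uses
    exactly the labels of s. This is the form on which contractions can be computed. *)
Inductive tspan (s : seq label) : (pt -> K) -> Prop :=
  | tspan0 : tspan s (fun=> 0)
  | tspan_cons b tl f : palg b -> all tok tl -> perm_eq (tlabs tl) s ->
      tspan s f -> tspan s (fun x => b x * tprod tl x + f x)
  | tspan_ext f h : f =1 h -> tspan s f -> tspan s h.

Lemma tspan_add s f h : tspan s f -> tspan s h -> tspan s (fun x => f x + h x).
Proof.
move=> sf sh; elim: sf => [|b tl k pb ok sl _ IH|k k' kk' _ IH].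
- by apply: tspan_ext sh => x; rewrite add0r.
- by apply: (tspan_ext _ (tspan_cons pb ok sl IH)) => x; rewrite addrA.
- by apply: tspan_ext IH => x; rewrite kk'.
Qed.

Lemma tspan_scale s c f : palg c -> tspan s f -> tspan s (fun x => c x * f x).
Proof.
move=> pc; elim=> [|b tl k pb ok sl _ IH|k k' kk' _ IH].
- by apply: (tspan_ext _ (tspan0 s)) => x; rewrite mulr0.
- by apply: (tspan_ext _ (tspan_cons (alg_mul pc pb) ok sl IH)) => x; ring.
- by apply: tspan_ext IH => x; rewrite kk'.
Qed.

Lemma tspan_perm s s' f : perm_eq s s' -> tspan s f -> tspan s' f.
Proof.
move=> ss'; elim=> [|b tl k pb ok sl _ IH|k k' kk' _ IH]; first exact: tspan0.
  by apply: tspan_cons => //; apply: perm_trans ss'.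
exact: tspan_ext IH.
Qed.

Lemma tspan1 tl : all tok tl -> tspan (tlabs tl) (tprod tl).
Proof.
move=> ok; apply: (tspan_ext _ (tspan_cons (alg_const _ 1) ok (perm_refl _) (tspan0 _))) => x.
by rewrite mul1r addr0.
Qed.

Definition xlabs (xx : seq xitem) : seq label := flatten [seq [:: t.1.1; t.2.1] | t <- xx].

Lemma tlabs_cons t tl : tlabs (t :: tl) = t.1.1 :: t.2 :: tlabs tl.
Proof. by []. Qed.

(** Brackets of vectors are dissolved by two moves. Against a bracket of covectors at the same
    vertex, [p,q][y,z] = <y,p><z,q> - <y,q><z,p>. Otherwise an arrow a of [al] leaving the vertex is
    absorbed, det X_a [p,q] = [X_a p, X_a q], and the bracket travels to the head of a. The balance
    guarantees that one of the moves applies. *)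
Lemma state_span (al : seq (arr Q)) (xx : seq (ver Q * xitem)) (yy : seq (ver Q * (label * label)))
    (tl : seq term) :
  all (fun t => xok t.1 t.2) xx -> all (fun t => yok t.1 t.2) yy -> all tok tl ->
  (forall v, count (fun t => t.1 == v) xx + heads v al = count (fun t => t.1 == v) yy + tails v al)%N ->
  tspan (xlabs [seq t.2 | t <- xx] ++ labs [seq t.2 | t <- yy] ++ tlabs tl)
    (fun x => dets al x * (\prod_(t <- xx) xval t.2 x) * (\prod_(t <- yy) yval t.2 x) * tprod tl x).
Proof.
have [n] := ubnP (size xx + size al); elim: n al xx yy tl => // n IHn al xx yy tl.
case: xx => [|[v t] xx] sz okx oky okt bal.
  have heads_sum (s : seq (arr Q)) : \sum_v heads v s = size s.
    elim: s => [|a s IHs]; first by rewrite big1.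
    rewrite /heads /= big_split /= -/(heads _ _) IHs (bigD1 (ahead a)) //= eqxx big1 ?addn0 //.
    by move=> w; rewrite eq_sym => /negPf ->.
  have tails_sum (s : seq (arr Q)) : \sum_v tails v s = size s.
    elim: s => [|a s IHs]; first by rewrite big1.
    rewrite /tails /= big_split /= -/(tails _ _) IHs (bigD1 (atail a)) //= eqxx big1 ?addn0 //.
    by move=> w; rewrite eq_sym => /negPf ->.
  (* Once no bracket of vectors is left, the balance summed over all vertices leaves none of
     covectors either. *)
  have yy0 : yy = [::].
    case: yy oky bal => [//|[w t] yy] _ bal.
    have : (\sum_v heads v al = \sum_v (count (fun t => t.1 == v) ((w, t) :: yy) + tails v al))%N.
      by apply: eq_bigr => v _; rewrite -bal.
    rewrite big_split /= heads_sum tails_sum (bigD1 w) //= eqxx.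
    by move/eqP; rewrite -{1}[size al]add0n eqn_add2r.
  subst yy; have bal' w : heads w al = tails w al by have := bal w.
  apply: (tspan_ext _ (tspan_scale (dets_balanced bal') (tspan1 okt))) => x.
  by rewrite !big_nil !mulr1.
case: t okx sz bal => [[l1 P1] [l2 P2]] /= /andP[/and4P[/= t1 t2 p1 p2] okx] sz bal.
have [/hasP[[w [k1 k2]] yyt /= /eqP wv]|noy] := boolP (has (fun t => t.1 == v) yy).
  subst w; have oky' := oky; rewrite (perm_all _ (perm_to_rem yyt)) /= in oky'.
  case/andP: oky' => /and4P[/= s1 s2 /eqP k1v /eqP k2v] oky'.
  set yy' := rem _ yy in oky'.
  have cy u : count (fun t => t.1 == u) yy = ((v == u) + count (fun t => t.1 == u) yy')%N.
    by rewrite (permP (perm_to_rem yyt)).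
  have bal' u : (count (fun t => t.1 == u) xx + heads u al =
      count (fun t => t.1 == u) yy' + tails u al)%N.
    by have := bal u; rewrite cy /= -!addnA => /addnI.
  have sz' : (size xx + size al < n)%N by move: sz; rewrite /= addSn ltnS.
  have okt1 : all tok [:: (k1, P1, l1), (k2, P2, l2) & tl].
    by rewrite /= okt /tok /= t1 t2 s1 s2 k1v k2v p1 p2.
  have okt2 : all tok [:: (k1, P2, l2), (k2, P1, l1) & tl].
    by rewrite /= okt /tok /= t1 t2 s1 s2 k1v k2v p1 p2.
  have py : perm_eq (labs [seq t.2 | t <- yy]) [:: k1, k2 & labs [seq t.2 | t <- yy']].
    have -> : [:: k1, k2 & labs [seq t.2 | t <- yy']] = labs [seq t.2 | t <- (v, (k1, k2)) :: yy'] by [].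
    by apply: perm_flatten; do 2!apply: perm_map; apply: perm_to_rem.
  have sp1 := IHn al xx yy' _ sz' okx oky' okt1 bal'.
  have sp2 := IHn al xx yy' _ sz' okx oky' okt2 bal'.
  have pe s : perm_eq s [:: k1; l1; k2; l2] ->
    perm_eq (xlabs [seq t.2 | t <- xx] ++ labs [seq t.2 | t <- yy'] ++ s ++ tlabs tl)
    (xlabs [seq t.2 | t <- (v, ((l1, P1), (l2, P2))) :: xx] ++ labs [seq t.2 | t <- yy] ++ tlabs tl).
    move=> ps; apply/permP => p; rewrite !count_cat (permP ps) (permP py) /=.
    move: (nat_of_bool (p k1)) (nat_of_bool (p k2)) (nat_of_bool (p l1)) (nat_of_bool (p l2)).
    move: (count p (xlabs _)) (count p (tlabs _)) (count p (labs _)); clear; lia.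
  have {}sp1 := tspan_perm (pe [:: k1; l1; k2; l2] (perm_refl _)) sp1.
  have pe2 : perm_eq [:: k1; l2; k2; l1] [:: k1; l1; k2; l2].
    apply/permP => p /=; move: (nat_of_bool (p k1)) (nat_of_bool (p k2)).
    by move: (nat_of_bool (p l1)) (nat_of_bool (p l2)); clear; lia.
  have {}sp2 := tspan_scale (alg_const _ (-1)) (tspan_perm (pe _ pe2) sp2).
  apply: (tspan_ext _ (tspan_add sp1 sp2)) => x.
  rewrite (perm_big _ (perm_to_rem yyt)) /= -/yy' /tprod !big_cons /=.
  by rewrite /xval /yval /tval /br /=; ring.
have v_out : (0 < tails v al)%N.
  have := bal v; rewrite /= eqxx (_ : count _ yy = 0%N) ?add0n; first by move=> <-.
  by apply/eqP; rewrite eqn0Ngt -has_count.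
move: v_out; rewrite -has_count => /hasP[a aal /eqP av].
pose xx' := (ahead a, ((l1, rcons P1 a), (l2, rcons P2 a))) :: xx.
have sz' : (size xx' + size (rem a al) < n)%N.
  by move: sz; rewrite /= size_rem //; case: (al) aal => // b s _ /=; rewrite ltnS addnS addSn.
have okx' : all (fun t => xok t.1 t.2) xx'.
  rewrite /= okx andbT /xok /= t1 t2 -!cats1.
  by rewrite (ptv_cat p1) ?(ptv_cat p2) //= av !eqxx.
have bal' u : (count (fun t => t.1 == u) xx' + heads u (rem a al) =
      count (fun t => t.1 == u) yy + tails u (rem a al))%N.
  have := bal u; rewrite /= (heads_rem u aal) (tails_rem u aal) av.
  by move: (heads _ _) (tails _ _) (count _ _) (count _ _) => h t c1 c2; 
    case: (v == u); case: (ahead a == u) => /=; clear; lia.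
apply: (tspan_ext _ (IHn _ _ _ _ sz' okx' oky okt bal')) => x.
rewrite !big_cons (dets_rem x aal) /xval /=; congr (_ * _ * _); rewrite -!cats1.
have E P l : pv x (P ++ [:: a]) (vec x l) =1 mv (ent x a) (pv x P (vec x l)).
  by move=> i; rewrite /pv /mv !pmb_cat /mm /=; case: i; rewrite /mm /=; ring.
have -> : br (pv x (P1 ++ [:: a]) (vec x l1)) (pv x (P2 ++ [:: a]) (vec x l2)) =
   detm x a * br (pv x P1 (vec x l1)) (pv x P2 (vec x l2)).
  by rewrite {1}/br !E -/(br _ _) br_det.
ring.
Qed.

End Paths.

(** * Contraction of products of pairings *)

Section Contraction.

Variables (K : fieldType) (Q : quiver).

Local Notation idx := (idx Q).
Local Notation label := (label Q).
Local Notation pt := (idx -> K).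
Local Notation data := (tensor_data Q).
Implicit Types (x y : pt) (l : label) (f : pt -> K).

(** Brackets are sorted by the kinds of their two labels; s collects the signs of those pairings
    that have the vector first. The count identity is what [ev_palg] turns into the balance of
    [state_span]. *)
Lemma bl_state (bl : bracket_list Q) : okbl bl ->
  exists (s : K) (xx : seq (ver Q * xitem Q)) (yy : seq (ver Q * (label * label)))
    (tl : seq (term Q)),
  [/\ [/\ all (fun t => xok t.1 t.2) xx, all (fun t => yok t.1 t.2) yy & all (@tok Q) tl],
      perm_eq (xlabs [seq t.2 | t <- xx] ++ labs [seq t.2 | t <- yy] ++ tlabs tl) (labs bl),
      forall v, (count (fun l => l.1 == (v, true)) (labs bl) + 2 * count (fun t => t.1 == v) yy =
                 count (fun l => l.1 == (v, false)) (labs bl) + 2 * count (fun t => t.1 == v) xx)%N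
    & forall x, vbl bl x = s * ((\prod_(t <- xx) xval t.2 x) * (\prod_(t <- yy) yval t.2 x)
                                * tprod tl x)].
Proof.
elim: bl => [|[l k] bl IHbl] /=.
  exists 1, [::], [::], [::]; split=> // x.
  by rewrite /tprod !big_nil !mulr1.
case/andP=> /eqP lk /IHbl[s [xx [yy [tl [[okx oky okt] pe cnt vb]]]]].
case: l k lk => [[v b] i] [[v' b'] i']; rewrite {1 2}/vx /= => vv; subst v'.
have pe' u : perm_eq (xlabs [seq t.2 | t <- xx] ++ labs [seq t.2 | t <- yy] ++ tlabs tl ++ u) (labs bl ++ u).
  by rewrite !catA perm_cat2r -catA.
case: b; case: b'.
- exists s, ((v, (((v, true, i), [::]), ((v, true, i'), [::]))) :: xx), yy, tl; split=> //.
  + by split=> //=; rewrite okx /xok /= eqxx.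
  + by rewrite /= !perm_cons.
  + move=> w; have := cnt w; rewrite /= !xpair_eqE !andbT !andbF !add0n.
    by move: (count _ _) (count _ _) (count _ _) (count _ _); case: (v == w); clear; lia.
  + move=> x; rewrite vb !big_cons /xval /= /pv /br /mv /=; ring.
- exists (- s), xx, yy, (((v, false, i'), [::], (v, true, i)) :: tl); split=> //.
  + by split=> //=; rewrite okt /tok /= eqxx.
  + rewrite tlabs_cons labs_cons /=; apply/permP => p; have := permP (pe' [::]) p.
    rewrite !cats0 !count_cat /= => <-.
    by move: (nat_of_bool _) (nat_of_bool _) (count _ _) (count _ _) (count _ _); clear; lia.
  + move=> w; have := cnt w; rewrite /= !xpair_eqE !andbT !andbF !add0n.
    by move: (count _ _) (count _ _) (count _ _) (count _ _); case: (v == w); clear; lia.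
  + move=> x; rewrite vb /tprod !big_cons /tval /= /pv /br /mv /=; ring.
- exists s, xx, yy, (((v, false, i), [::], (v, true, i')) :: tl); split=> //.
  + by split=> //=; rewrite okt /tok /= eqxx.
  + rewrite tlabs_cons labs_cons /=; apply/permP => p; have := permP (pe' [::]) p.
    rewrite !cats0 !count_cat /= => <-.
    by move: (nat_of_bool _) (nat_of_bool _) (count _ _) (count _ _) (count _ _); clear; lia.
  + move=> w; have := cnt w; rewrite /= !xpair_eqE !andbT !andbF !add0n.
    by move: (count _ _) (count _ _) (count _ _) (count _ _); case: (v == w); clear; lia.
  + move=> x; rewrite vb /tprod !big_cons /tval /= /pv /br /mv /=; ring.
- exists s, xx, ((v, ((v, false, i), (v, false, i'))) :: yy), tl; split=> //.
  + by split=> //=; rewrite oky /yok /= eqxx.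
  + rewrite !labs_cons /=; apply/permP => p; have := permP (pe' [::]) p.
    rewrite !cats0 !count_cat /= !count_cat => <-.
    by move: (nat_of_bool _) (nat_of_bool _) (count _ _) (count _ _) (count _ _); clear; lia.
  + move=> w; have := cnt w; rewrite /= !xpair_eqE !andbT !andbF !add0n.
    by move: (count _ _) (count _ _) (count _ _) (count _ _); case: (v == w); clear; lia.
  + move=> x; rewrite vb !big_cons /yval /= /br /=; ring.
Qed.

Lemma tprod_indep (tl : seq (term Q)) x l u :
  l \notin tlabs tl -> tprod tl (setv x l u) = tprod tl x.
Proof.
move=> ltl; apply: eq_big_seq => t ttl.
have nl k : k \in [:: t.1.1; t.2] -> (k == l) = false.
  move=> kt; apply: contraNF ltl => /eqP <-; apply/flattenP; exists [:: t.1.1; t.2] => //.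
  by apply: map_f.
rewrite /tval !vec_setv !nl ?inE ?eqxx ?orbT // /br /pv /mv.
by rewrite !(@pmb_agree _ _ (setv x l u) x).
Qed.

Lemma tok_in (t : term Q) l : tok t -> l.1.2 -> l \in [:: t.1.1; t.2] -> t.2 = l.
Proof.
case/and3P=> ty _ _ lt; rewrite !inE => /orP[/eqP E|/eqP ->//].
by rewrite E (negPf ty) in lt.
Qed.

Lemma tok_out (t : term Q) l : tok t -> ~~ l.1.2 -> l \in [:: t.1.1; t.2] -> t.1.1 = l.
Proof.
case/and3P=> _ tx _ lt; rewrite !inE => /orP[/eqP ->//|/eqP E].
by rewrite E tx in lt.
Qed.

Lemma tlabs_rem (t : term Q) tl : t \in tl -> perm_eq (tlabs tl) (t.1.1 :: t.2 :: tlabs (rem t tl)).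
Proof.
move=> ttl; rewrite -tlabs_cons.
by apply: perm_flatten; apply: perm_map; apply: perm_to_rem.
Qed.

Lemma all_rem (T : eqType) (p : pred T) (t : T) s : all p s -> all p (rem t s).
Proof. by move=> /allP ps; apply/allP => u /mem_rem /ps. Qed.

(** Contraction with X_a glues <y, P u_l> and <y_l', P' u'> into <y, P X_a P' u'>. If both labels
    stand in one pairing, the path closes and a trace splits off. *)
Lemma con_terms (cl : contraction_list Q) (tl : seq (term Q)) :
  okcl cl -> uniq (clabs cl) -> all (@tok Q) tl -> uniq (tlabs tl) ->
  {subset clabs cl <= tlabs tl} ->
  exists b (tl' : seq (term Q)), [/\ @palg K Q b, all (@tok Q) tl',
    perm_eq (tlabs tl) (clabs cl ++ tlabs tl')
    & forall x, con cl (tprod tl) x = b x * tprod tl' x].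
Proof.
elim: cl => [|[[l l'] a] cl IHcl] okc ucl okt utl sub.
  exists (fun=> 1), tl; split=> //; first exact: alg_const.
  by move=> x; rewrite mul1r.
move: okc ucl; rewrite [okcl _]/= => /andP[/andP[/eqP /= el /eqP /= el'] okc] ucl.
have [ll' lcl l'cl ucl'] : [/\ l != l', l \notin clabs cl, l' \notin clabs cl & uniq (clabs cl)].
  by move: ucl; rewrite /= inE negb_or => /andP[/andP[-> ->] /andP[-> ->]].
have [|b [tl1 [pb ok1 pe1 cE]]] := IHcl okc ucl' okt utl.
  by move=> k kcl; apply: sub; rewrite clabs_cons !inE kcl !orbT.
have utl1 : uniq (tlabs tl1).
  by move: utl; rewrite (perm_uniq pe1) cat_uniq => /and3P[].
have in1 k : k \in [:: l; l'] -> k \notin clabs cl -> k \in tlabs tl1.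
  move=> kl kcl; have : k \in tlabs tl.
    by apply: sub; move: kl; rewrite clabs_cons !inE => /orP[]->; rewrite ?orbT.
  by rewrite (perm_mem pe1) mem_cat (negPf kcl).
have ltl : l \in tlabs tl1 by apply: in1 => //; rewrite inE eqxx.
have l'tl : l' \in tlabs tl1 by apply: in1 => //; rewrite !inE eqxx orbT.
have bE i j x : b (setv (setv x l (bvec i)) l' (cobvec j)) = b x.
  exact: palg_agree pb.
have [_ /mapP[t ttl ->] lt] := flattenP ltl.
have lx : t.2 = l by apply: tok_in lt; [apply: (allP ok1) | rewrite el].
have pt1 := perm_to_rem ttl; have plt := tlabs_rem ttl.
have okr := all_rem t ok1; set tl2 := rem t tl1 in pt1 plt okr.
have ut : uniq (t.1.1 :: t.2 :: tlabs tl2) by rewrite -(perm_uniq plt).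
have tokt : tok t by apply: (allP ok1).
have [ty tx tp] : [/\ ~~ t.1.1.1.2, t.2.1.2 & ptv (vx t.2) t.1.2 (vx t.1.1)] by apply/and3P.
have vl : vx l = ahead a by rewrite /vx el.
have vl' : vx l' = atail a by rewrite /vx el'.
have l_tl2 : l \notin tlabs tl2 by move: ut; rewrite lx /= => /and3P[].
have tE (u w : bool -> K) x : tprod tl1 (setv (setv x l u) l' w) =
    tval t (setv (setv x l u) l' w) * tprod tl2 (setv (setv x l u) l' w).
  by rewrite {1}/tprod (perm_big _ pt1) big_cons.
have [ty_l'|ty_l'] := eqVneq t.1.1 l'.
  have l'_tl2 : l' \notin tlabs tl2.
    by move: ut; rewrite ty_l' /= !inE negb_or => /and3P[/andP[]].
  have aP : ptv (atail a) (a :: t.1.2) (atail a) by rewrite /= eqxx -vl -vl' -lx -ty_l'.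
  exists (fun x => b x * tr2 (pmb x (a :: t.1.2))), tl2; split=> //.
  - by apply: alg_mul => //; apply: palg_tr aP.
  - apply: (perm_trans pe1); apply/permP => p /=.
    rewrite count_cat (permP plt) /= count_cat lx ty_l'.
    by move: (nat_of_bool _) (nat_of_bool _) (count _ _) (count _ _); clear; lia.
  move=> x /=; rewrite !cE !bE !tE !(tprod_indep _ _ l'_tl2) !(tprod_indep _ _ l_tl2).
  rewrite /tval ty_l' lx !vec_setv (negPf ll') !eqxx /pv.
  have pE i j : pmb (setv (setv x l (bvec i)) l' (cobvec j)) t.1.2 =2 pmb x t.1.2.
    exact: pmb_agree.
  rewrite /br /mv !pE /bvec /cobvec /tr2 /mm /=; ring.
have : l' \in t.1.1 :: t.2 :: tlabs tl2 by rewrite -(perm_mem plt).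
rewrite !inE lx [l' == l]eq_sym (negPf ll') [l' == _]eq_sym (negPf ty_l') /=.
case/flattenP=> _ /mapP[t' t'tl ->] l't'.
have tokt' : tok t' by apply: (allP okr).
have ly : t'.1.1 = l' by apply: tok_out l't'; rewrite ?el'.
have pt2 := perm_to_rem t'tl; have plt2 := tlabs_rem t'tl.
have okr2 := all_rem t' okr; set tl3 := rem t' tl2 in pt2 plt2 okr2.
have [ty' tx' tp'] : [/\ ~~ t'.1.1.1.2, t'.2.1.2 & ptv (vx t'.2) t'.1.2 (vx t'.1.1)] by apply/and3P.
have ut2 : uniq (t'.1.1 :: t'.2 :: tlabs tl3).
  by rewrite -(perm_uniq plt2); move: ut => /= /and3P[].
have l'_tl3 : l' \notin tlabs tl3.
  by move: ut2; rewrite ly /= !inE negb_or => /and3P[/andP[]].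
have l't2 : (t'.2 == l') = false.
  by move: ut2; rewrite ly /= !inE negb_or eq_sym => /and3P[/andP[/negPf]].
have l_tl3 : l \notin tlabs tl3.
  by apply: contra l_tl2; rewrite (perm_mem plt2) !inE => ->; rewrite !orbT.
have lt2 : (t'.2 == l) = false.
  by apply: contraNF l_tl2 => /eqP <-; rewrite (perm_mem plt2) !inE eqxx orbT.
have tyl : (t.1.1 == l) = false.
  by apply/eqP => E; move: ty; rewrite E el.
exists b, ((t.1.1, t'.1.2 ++ a :: t.1.2, t'.2) :: tl3); split=> //.
- rewrite /= okr2 andbT /tok /= ty tx' /=; apply: ptv_cat tp' _.
  by rewrite /= ly vl' eqxx -vl -lx.
- apply: (perm_trans pe1); apply/permP => p /=.
  rewrite count_cat (permP plt) /= (permP plt2) /= count_cat /= lx ly.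
  move: (nat_of_bool (p l)) (nat_of_bool (p l')) (nat_of_bool _) (nat_of_bool _).
  by move: (count _ _) (count _ _); clear; lia.
have tE2 (u w : bool -> K) x : tprod tl2 (setv (setv x l u) l' w) =
    tval t' (setv (setv x l u) l' w) * tprod tl3 x.
  by rewrite {1}/tprod (perm_big _ pt2) big_cons -/(tprod _ _) !tprod_indep.
move=> x /=; rewrite !cE !bE !tE !tE2.
have -> : tprod ((t.1.1, t'.1.2 ++ a :: t.1.2, t'.2) :: tl3) x =
  tval (t.1.1, t'.1.2 ++ a :: t.1.2, t'.2) x * tprod tl3 x by rewrite /tprod big_cons.
rewrite /tval /= ly lx !vec_setv (negPf ll') (negPf ty_l') tyl lt2 l't2 !eqxx /pv.
have pE P i j : pmb (setv (setv x l (bvec i)) l' (cobvec j)) P =2 pmb x P.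
  exact: pmb_agree.
rewrite /br /mv !pE !pmb_cat /bvec /cobvec /mm /= /mm.
move: (tprod tl3 x) (b x) (vec x t.1.1) (vec x t'.2) (pmb x t.1.2) (pmb x t'.1.2) => c1 c2 u w m m'.
ring.
Qed.

End Contraction.

(** * Balanced multidegrees and invariance under scalar matrices *)

Section FFT.

Variables (K : fieldType) (Q : quiver).
Hypothesis K_infinite : infinite_type K.

Local Notation idx := (idx Q).
Local Notation label := (label Q).
Local Notation pt := (idx -> K).
Local Notation data := (tensor_data Q).
Implicit Types (x y : pt) (l : label) (f : pt -> K).

Lemma con_add (cl : contraction_list Q) (F G : pt -> K) x :
  con cl (fun x => F x + G x) x = con cl F x + con cl G x.
Proof. by elim: cl x => [//|[[l l'] a] cl IHcl] x /=; rewrite !IHcl; ring. Qed.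

Lemma con_mull (cl : contraction_list Q) b (F : pt -> K) x : palg b ->
  con cl (fun x => b x * F x) x = b x * con cl F x.
Proof.
move=> pb; elim: cl x => [//|[[l l'] a] cl IHcl] x /=; rewrite !IHcl.
have bE i j : b (setv (setv x l (bvec i)) l' (cobvec j)) = b x by apply: palg_agree pb.
by rewrite !bE; ring.
Qed.

Lemma con_ext (cl : contraction_list Q) (F G : pt -> K) : F =1 G -> con cl F =1 con cl G.
Proof. by move=> FG x; apply: (con_eq (P := fun=> True)). Qed.

(** The contraction uses up all labels, so no pairing is left and only coefficients from [palg]
    remain. *)
Lemma con_tspan (cl : contraction_list Q) s f : tspan s f -> okcl cl -> uniq (clabs cl) ->
  perm_eq s (clabs cl) -> palg (con cl f).
Proof.
move=> + okc ucl pe; elim=> [|b tl k pb ok sl _ IH|k k' kk' _ IH].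
- have con0 x : con cl (fun=> 0 : K) x = 0.
    by elim: cl {okc ucl pe} x => [//|[[l l'] a] cl IHcl] x /=; rewrite !IHcl; ring.
  by apply: (alg_ext _ (alg_const _ 0)) => x; rewrite con0.
- have pe' := perm_trans sl pe.
  have [||b' [tl' [pb' ok' pt' cE]]] := con_terms K okc ucl ok.
  + by rewrite (perm_uniq pe').
  + by move=> l; rewrite (perm_mem pe').
  have : perm_eq (clabs cl ++ [::]) (clabs cl ++ tlabs tl').
    by rewrite cats0 -(permPl pe') .
  rewrite perm_cat2l => /perm_size /=.
  case: tl' {ok' pt'} cE => [cE _|t tl' _ //].
  apply: (alg_ext (f := fun x => b x * b' x + con cl k x)).
    by move=> x; rewrite con_add con_mull // cE /tprod big_nil mulr1.
  by apply: alg_add => //; apply: alg_mul.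
- by apply: alg_ext IH; apply: con_ext.
Qed.

Definition balanced_data (e : data) := forall v,
  (2 * heads v e.1.1 + heads v [seq c.2 | c <- e.1.2] =
   2 * tails v e.1.1 + tails v [seq c.2 | c <- e.1.2])%N.

Lemma con_dets (cl : contraction_list Q) al (F : pt -> K) x :
  con cl (fun x => dets al x * F x) x = dets al x * con cl F x.
Proof.
elim: cl x => [//|[[l l'] a] cl IHcl] x /=; rewrite !IHcl.
have dE i j : dets al (setv (setv x l (bvec i)) l' (cobvec j)) = dets al x by elim: (al) => //= b s ->.
by rewrite !dE; ring.
Qed.

(** Contracted labels are vectors at heads and covectors at tails of arrows, which translates the
    balance of arrow degrees into that of [state_span]. *)
Lemma ev_palg A e : wf A [::] e -> balanced_data e -> palg (@ev K Q e).
Proof.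
case: e => [[al cl] bl] wfe bal.
have [/= okc okb ucl] := And3 (wf_cl wfe) (wf_bl wfe) (wf_uniq wfe).
have [s [xx [yy [tl [[okx oky okt] pe cnt vb]]]]] := bl_state K okb.
have pbl : perm_eq (labs bl) (clabs cl).
  apply/allP => k _ /=; apply/eqP; rewrite [RHS](count_uniq_mem _ ucl).
  have [kcl|kcl] := boolP (k \in clabs cl); first by rewrite (wf_one wfe).
  by apply/count_memPn; apply: contra kcl => /(wf_labs wfe); rewrite orbF.
have cin v b : count (fun l : label => l.1 == (v, b)) (clabs cl) =
    if b then heads v [seq c.2 | c <- cl] else tails v [seq c.2 | c <- cl].
  case: b; elim: cl okc {wfe bal ucl pbl} => [//|[[l l'] a] cl IHcl];
    rewrite [okcl _]/= => /andP[/andP[/eqP /= -> /eqP /= ->] /IHcl] /= ->;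
    by rewrite !xpair_eqE ?andbT ?andbF.
have bal' v : (count (fun t => t.1 == v) xx + heads v al = count (fun t => t.1 == v) yy + tails v al)%N.
  have := cnt v; have := bal v; rewrite !(permP pbl) !cin /=.
  by move: (heads _ _) (heads _ _) (tails _ _) (tails _ _) (count _ _) (count _ _); clear; lia.
have sp := state_span K okx oky okt bal'.
have := con_tspan (tspan_scale (alg_const _ s) (tspan_perm pe sp)) okc ucl pbl.
apply: alg_ext => x; rewrite /ev /= -con_dets; apply: con_ext => z.
by rewrite vb; ring.
Qed.

Definition mscm (kap : arr Q -> K) x : pt := fun k =>
  match k with inl (a, _) => kap a * x k | inr _ => x k end.

(** Invariance under the scalar matrix c at the vertex v. *)
Definition scinv f := forall v c x, c != 0 ->
  f (mscm (fun a => (if ahead a == v then c else 1) * (if atail a == v then c^-1 else 1)) x) = f x.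

Lemma hom_mscm f (kap : arr Q -> K) (del : arr Q -> nat) : pol f ->
  (forall a, hom_deg (scm a) (del a) f) -> (forall a, kap a != 0) ->
  forall x, f (mscm kap x) = \prod_a kap a ^+ del a * f x.
Proof.
move=> pf fh nz x.
suff E s : uniq s -> f (mscm (fun a => if a \in s then kap a else 1) x) =
    \prod_(a <- s) kap a ^+ del a * f x.
  rewrite -(E _ (index_enum_uniq _)); apply: pol_ext_arg => // -[[a ij]|//] /=.
  by rewrite mem_index_enum.
elim: s => [_|a s IHs /= /andP[as_ us]].
  rewrite big_nil mul1r; apply: pol_ext_arg => // -[[a ij]|//] /=.
  by rewrite mul1r.
rewrite big_cons -mulrA -IHs // -fh //; apply: pol_ext_arg => // -[[b ij]|//] /=.
by rewrite inE; case: eqP => [->|//] /=; rewrite (negPf as_) mul1r.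
Qed.

Lemma evs_degree (r : seq (K * data)) f (del : arr Q -> nat) :
  (forall a, hom_deg (scm a) (del a) f) -> (forall x, f x = evs r x) ->
  exists r', [/\ {subset r' <= r}, forall x, f x = evs r' x
    & forall p, p \in r' -> forall a, arrow_degree p.2 a = del a].
Proof.
move=> fh fr; suff [r' [sub fr' deg]] : exists r', [/\ {subset r' <= r}, forall x, f x = evs r' x
    & forall p, p \in r' -> forall a, a \in enum (arr Q) -> arrow_degree p.2 a = del a].
  by exists r'; split=> // p pr a; apply: deg => //; rewrite mem_enum.
elim: (enum (arr Q)) => [|a s [r' [sub fr' deg]]]; first by exists r; split=> // p _ a; rewrite in_nil.
exists [seq p <- r' | arrow_degree p.2 a == del a]; split.
- by move=> p; rewrite mem_filter => /andP[_ /sub].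
- move=> x; have degE (p : K * data) : p \in r' -> forall c y, c != 0 ->
      ev p.2 (scm a c y) = c ^+ arrow_degree p.2 a * ev p.2 y by move=> _ c y _; apply: ev_scm.
  exact: (evs_filter K_infinite (k := fun e => arrow_degree e a) x degE fr' (fh a)).
- move=> p; rewrite mem_filter => /andP[/eqP pa pr] b; rewrite inE => /predU1P[->//|bs].
  exact: deg.
Qed.

Lemma sum_count_mem (T : finType) (p : pred T) (s : seq T) :
  (\sum_(a | p a) count_mem a s = count p s)%N.
Proof.
elim: s => [|b s IHs] /=; first by rewrite big1.
rewrite big_split /= IHs; congr addn; case: (boolP (p b)) => pb.
  by rewrite (bigD1 b) //= eqxx big1 ?addn0 // => a /andP[_]; rewrite eq_sym => /negPf ->.
by rewrite big1 // => a pa; case: eqP => // E; rewrite E pa in pb.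
Qed.

Lemma sum_arrow_degree (e : data) (p : pred (arr Q)) :
  (\sum_(a | p a) arrow_degree e a = 2 * count p e.1.1 + count p [seq c.2 | c <- e.1.2])%N.
Proof. by rewrite big_split /= -big_distrr /= !sum_count_mem. Qed.

(** A scalar c at v multiplies f by c to the power of incoming minus outgoing degree, so over an
    infinite field an unbalanced f is 0. *)
Lemma palg_homog f (del : arr Q -> nat) : pol f -> SLinv f -> scinv f ->
  dep (enum (arr Q)) [::] f ->
  (forall a, hom_deg (scm a) (del a) f) -> palg f.
Proof.
move=> pf fSL fsc fdep fh.
have [bal|nbal] := boolP [forall v, \sum_(a | ahead a == v) del a == \sum_(a | atail a == v) del a].
  have [r [wfr fr]] := span_mat K_infinite (enum_uniq _) (isT : uniq ([::] : seq label)) pf fSL fdep.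
  have [r' [sub fr' deg]] := evs_degree fh fr.
  apply: (alg_ext (fun x => esym (fr' x))); rewrite /evs.
  elim: r' sub deg {fr'} => [|p r' IH] sub deg.
    by apply: (alg_ext _ (alg_const _ 0)) => x; rewrite big_nil.
  apply: (alg_ext (f := fun x => p.1 * ev p.2 x + \sum_(q <- r') q.1 * ev q.2 x)).
    by move=> x; rewrite big_cons.
  apply: alg_add; last by apply: IH => q qr; [apply: sub | apply: deg]; rewrite inE qr orbT.
  apply: alg_scale; apply: ev_palg (wfr p (sub p (mem_head _ _))) _ => v.
  have := forallP bal v; rewrite !(eq_bigr _ (fun a _ => esym (deg p (mem_head _ _) a))).
  by rewrite !sum_arrow_degree => /eqP.
have [v vbal] := forallPn nbal.
have pw (P : pred (arr Q)) (y : K) :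
    \prod_a (if P a then y else 1) ^+ del a = y ^+ \sum_(a | P a) del a.
  rewrite expr_sum [RHS]big_mkcond; apply: eq_bigr => a _.
  by case: ifP; rewrite ?expr1n.
have f0 x : f x = 0.
  set h := \sum_(a | ahead a == v) del a in vbal; set t := \sum_(a | _) _ in vbal.
  have eqc c : c != 0 -> c ^+ h * f x = c ^+ t * f x.
    move=> nz_c; have := fsc v c x nz_c; rewrite (hom_mscm (del := del)) // => [E|a]; last first.
      by rewrite mulf_neq0 //; case: ifP; rewrite ?oner_eq0 ?invr_eq0.
    rewrite -[in RHS]E; under eq_bigr => a _ do rewrite exprMn.
    rewrite big_split /= !pw -/h -/t exprVn.
    by rewrite mulrA mulrCA mulfV ?mulr1 // expf_neq0.
  have neq0 p q : (p < q)%N -> (forall c, c != 0 -> c ^+ p * f x = c ^+ q * f x) -> f x = 0.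
    move=> pq Ec; have [|c [nz_c c1]] := exists_nonroot K_infinite (n := (q - p)%N).
      by rewrite subn_gt0.
    have /eqP := Ec c nz_c; rewrite -(subnKC (ltnW pq)) exprD -mulrA -subr_eq0 -mulrBr mulf_eq0.
    rewrite expf_eq0 (negPf nz_c) andbF /= -{1}[f x]mul1r -mulrBl mulf_eq0 subr_eq0 eq_sym.
    by rewrite (negPf c1) /= => /eqP.
  have [ht|th|ht] := ltngtP h t; last by rewrite ht eqxx in vbal.
    exact: neq0 ht eqc.
  by apply: neq0 th _ => c /eqc.
by apply: (alg_ext _ (alg_const _ 0)) => x; rewrite f0.
Qed.

End FFT.

(** * The generation theorem for functions of matrices *)

Section RepInvariants.

Variables (K : fieldType) (Q : quiver).
Hypothesis K_infinite : infinite_type K.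

Local Notation Rp := (arr Q -> 'M[K]_2).
Implicit Types (f : Rp -> K) (h : Rp).

Definition falg : (Rp -> K) -> Prop := alg (fun F => exists a i j, F = (fun h => h a i j)).

Definition gl_act (g : ver Q -> 'M[K]_2) h : Rp :=
  fun a => g (ahead a) *m h a *m invmx (g (atail a)).
Definition ginv f := forall g h, (forall v, g v \in unitmx) -> f (gl_act g h) = f h.

Definition rscm a (c : K) h : Rp := fun b => if b == a then c *: h b else h b.
Definition rhom a k f := forall c h, c != 0 -> f (rscm a c h) = c ^+ k * f h.

Fixpoint pmat h (P : seq (arr Q)) : 'M[K]_2 :=
  if P is a :: P' then pmat h P' *m h a else 1%:M.

Definition rgen f := exists u (P : seq (arr Q)), [/\ P != [::], ptv u P u
  & f = (fun h => \tr (pmat h P)) \/ f = (fun h => \det (pmat h P))].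

Lemma falg_ext_arg f h h' : falg f -> h =1 h' -> f h = f h'.
Proof.
move=> + hh'; elim=> [_ [a [i [j ->]]]|//|k k' _ IHk _ IHk'|k k' _ IHk _ IHk'|k k' kk' _ IHk].
- by rewrite hh'.
- by rewrite IHk IHk'.
- by rewrite IHk IHk'.
- by rewrite -!kk'.
Qed.

Lemma falg_entry a i j : falg (fun h => h a i j).
Proof. by apply: alg_gen; exists a, i, j. Qed.

Lemma gl_act_rscm g a c h : gl_act g (rscm a c h) =1 rscm a c (gl_act g h).
Proof.
by move=> b; rewrite /gl_act /rscm; case: eqP => // _; rewrite -scalemxAr -scalemxAl.
Qed.

Lemma rscm_comm a b c d h : rscm a c (rscm b d h) =1 rscm b d (rscm a c h).
Proof.
by move=> e; rewrite /rscm; case: (e == a); case: (e == b) => //; rewrite !scalerA mulrC.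
Qed.

Lemma multigraded_ind (P : (Rp -> K) -> Prop) :
  (forall f f', f =1 f' -> P f -> P f') -> P (fun=> 0) ->
  (forall f f', P f -> P f' -> P (fun h => f h + f' h)) ->
  (forall f (del : arr Q -> nat), falg f -> ginv f -> (forall a, rhom a (del a) f) -> P f) ->
  forall f, falg f -> ginv f -> P f.
Proof.
move=> Pext P0 Padd Phom.
(* s lists the arrows in which f need not be homogeneous yet; the scalings commute, so splitting
   along one arrow keeps homogeneity in the others. *)
suff E (s : seq (arr Q)) f : falg f -> ginv f ->
    (forall a, a \notin s -> exists k, rhom a k f) -> P f.
  by move=> f pf fi; apply: (E (enum (arr Q))) => // a; rewrite mem_enum.
elim: s f => [|a s IHs] f pf fi fh.
  by have [del fdel] := fin_all_exists (fun a => fh a isT); apply: Phom fdel.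
have [|||N [F [pF Fs fF Fphi]]] := graded_pieces K_infinite (s := rscm a) _ _ _ pf.
- by move=> h; apply: falg_ext_arg => // b; rewrite /rscm; case: eqP => // _; rewrite scale1r.
- move=> c c' h; apply: falg_ext_arg => // b; rewrite /rscm; case: eqP => // _.
  by rewrite scalerA.
- move=> _ [b [i [j ->]]]; exists (b == a); move=> c h; rewrite /rscm.
  by case: eqP => _; rewrite ?mxE ?expr1 ?expr0 ?mul1r.
apply: (Pext _ _ (fun h => esym (fF h))).
have PF k : P (F k).
  apply: IHs => //.
    move=> g h gu; rewrite (Fphi (gl_act g) 1) ?mul1r // => [c h'|h'].
      by apply: falg_ext_arg => //; apply: gl_act_rscm.
    by rewrite mul1r fi.
  move=> b bs; have [->|ba] := eqVneq b a; first by exists k => c h _; apply: Fs.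
  have [|k' fk'] := fh b; first by rewrite inE negb_or ba.
  exists k' => c h nz_c; apply: (Fphi (rscm b c)) => [c' h'|h']; last exact: fk'.
  by apply: falg_ext_arg => //; apply: rscm_comm.
elim: N {fF} => [|N IHN]; first by apply: Pext P0 => h; rewrite big_ord0.
by apply: Pext (Padd _ _ IHN (PF N)) => h; rewrite big_ord_recr.
Qed.

Definition b2i (b : bool) : 'I_2 := if b then 1 else 0.
Definition i2b (i : 'I_2) : bool := i != 0.

Lemma b2iK : cancel b2i i2b. Proof. by case. Qed.
Lemma i2bK : cancel i2b b2i.
Proof. by move=> i; apply: val_inj; case: i => [[|[|i]]]. Qed.

Lemma sum_I2 (F : 'I_2 -> K) : \sum_i F i = F (b2i false) + F (b2i true).
Proof.
by rewrite !big_ord_recl big_ord0 addr0; congr (F _ + F _); apply: val_inj.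
Qed.

Definition rp (x : idx Q -> K) : Rp := fun a => \matrix_(i, j) ent x a (i2b i) (i2b j).
Definition pr h : idx Q -> K := fun k =>
  match k with inl (a, (i, j)) => h a (b2i i) (b2i j) | inr _ => 0 end.

Lemma prK h : rp (pr h) =1 h.
Proof. by move=> a; apply/matrixP => i j; rewrite mxE /ent /= !i2bK. Qed.

Definition gmx (g : bool -> bool -> K) : 'M[K]_2 := \matrix_(i, j) g (i2b i) (i2b j).

Lemma eq_mx2 (A B : 'M[K]_2) : (forall i j, A (b2i i) (b2i j) = B (b2i i) (b2i j)) -> A = B.
Proof. by move=> AB; apply/matrixP => i j; rewrite -(i2bK i) -(i2bK j). Qed.

Lemma tr_mx2 (A : 'M[K]_2) : \tr A = A (b2i false) (b2i false) + A (b2i true) (b2i true).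
Proof. by rewrite /mxtrace sum_I2. Qed.

Lemma det_mx2 (A : 'M[K]_2) : \det A = A (b2i false) (b2i false) * A (b2i true) (b2i true)
  - A (b2i false) (b2i true) * A (b2i true) (b2i false).
Proof.
rewrite (expand_det_row _ (b2i false)) sum_I2 /cofactor !det_mx11 !mxE /=.
have -> : lift (b2i false) 0 = b2i true by apply: val_inj.
have -> : lift (b2i true) 0 = b2i false by apply: val_inj.
by rewrite /= expr0 expr1; ring.
Qed.

Lemma gmx_unit g : det2 g = 1 -> gmx g \in unitmx.
Proof. by move=> g1; rewrite unitmxE det_mx2 !mxE !b2iK -/(det2 g) g1 unitr1. Qed.

Lemma gmx_inv g : det2 g = 1 -> invmx (gmx g) = gmx (adj2 g).
Proof.
move=> g1; suff E : gmx g *m gmx (adj2 g) = 1%:M.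
  by rewrite -[RHS](mulKmx (gmx_unit g1)) E mulmx1.
apply: eq_mx2 => i j; rewrite mxE sum_I2 !mxE !b2iK.
move: g1; rewrite /det2 /adj2; case: i; case: j => /= <-; rewrite ?mulr1n ?mulr0n; ring.
Qed.

Lemma pmb_pmat h P i j : pmat h P (b2i i) (b2i j) = pmb (pr h) P i j.
Proof.
elim: P i j => [|a P IHP] i j /=; first by rewrite mxE; case: i; case: j.
by rewrite mxE sum_I2 !IHP.
Qed.

(** A multihomogeneous function is pulled back to [idx], where it ignores the labels. Of GL_2 only
    matrices of determinant one and scalars are used. *)
Theorem first_fundamental_theorem f : falg f -> ginv f -> alg rgen f.
Proof.
apply: multigraded_ind => [k k' kk'||k k'|k del pk ki kh].
- exact: alg_ext.
- exact: alg_const.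
- exact: alg_add.
pose F x := k (rp x).
have pF : pol F.
  apply: (alg_comp (phi := rp)) pk => _ [a [i [j ->]]].
  by apply: (alg_ext _ (pol_ent K a (i2b i) (i2b j))) => x; rewrite mxE.
have Finv : SLinv F.
  move=> g x SLg; rewrite /F -(ki (fun v => gmx (g v)) (rp x)) => [|v]; last exact: gmx_unit.
  apply: falg_ext_arg => // a; rewrite /gl_act gmx_inv //.
  apply: eq_mx2 => i j; rewrite !mxE sum_I2 !mxE !sum_I2 !mxE !b2iK /ent /= /ent; ring.
have Fsc : scinv F.
  move=> v c x nz_c; rewrite /F.
  rewrite -(ki (fun w => (if w == v then c else 1)%:M) (rp x)) => [|w]; last first.
    by rewrite unitmxE det_scalar unitfE expf_neq0 //; case: ifP; rewrite ?oner_eq0.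
  apply: falg_ext_arg => // a; rewrite /gl_act invmx_scalar mul_scalar_mx mul_mx_scalar scalerA.
  apply/matrixP => i j; rewrite !mxE /ent /= mulrC [RHS]mulrC; congr (_ * _).
  by rewrite mulrC; congr (_ * _); case: eqP; rewrite ?invr1.
have Fdep : dep (enum (arr Q)) [::] F.
  move=> x; apply: falg_ext_arg => // a; apply/matrixP => i j.
  by rewrite !mxE /ent /= mem_enum.
have Fh a : hom_deg (scm a) (del a) F.
  move=> c x nz_c; rewrite /F -kh //; apply: falg_ext_arg => // b.
  by apply/matrixP => i j; rewrite /rscm mxE /ent /=; case: eqP; rewrite !mxE.
have := palg_homog K_infinite pF Finv Fsc Fdep Fh.
move/(alg_comp (phi := pr) (Y := rgen)) => E.
apply: (alg_ext _ (E _)) => [h|_ [u [P [P0 uP [->|->]]]]].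
- by apply: falg_ext_arg => //; apply: prK.
- apply: (alg_ext (f := fun h => \tr (pmat h P))); first by move=> h; rewrite tr_mx2 !pmb_pmat.
  by apply: alg_gen; exists u, P; split=> //; left.
- apply: (alg_ext (f := fun h => \det (pmat h P))); first by move=> h; rewrite det_mx2 !pmb_pmat.
  by apply: alg_gen; exists u, P; split=> //; right.
Qed.

End RepInvariants.

(** * Trace identities and decomposable traces *)

Section TraceIdentities.

Variables (K : fieldType) (Q : quiver).

Local Notation Rp := (arr Q -> 'M[K]_2).
Local Notation path := (seq (arr Q)).
Implicit Types (p q A B C D : path) (h : Rp).

Definition tp p h : K := \tr (pmat h p).
Definition dp p h : K := \det (pmat h p).

Lemma pmat_cat h p q : pmat h (p ++ q) = pmat h q *m pmat h p.
Proof. by elim: p => [|a p IHp] /=; rewrite ?mulmx1 // IHp mulmxA. Qed.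

Lemma tp_rot p q h : tp (p ++ q) h = tp (q ++ p) h.
Proof. by rewrite /tp !pmat_cat mxtrace_mulC. Qed.

Lemma dp_cat p q h : dp (p ++ q) h = dp p h * dp q h.
Proof. by rewrite /dp pmat_cat det_mulmx mulrC. Qed.

(** The fundamental trace identity of 2 x 2 matrices, which is the polarized Cayley-Hamilton theorem
    multiplied by a third matrix under the trace. *)
Lemma tr_swap_mx (a b c : 'M[K]_2) : \tr (a *m b *m c) + \tr (b *m a *m c) =
  \tr a * \tr (b *m c) + \tr b * \tr (a *m c) + \tr c * \tr (a *m b) - \tr a * \tr b * \tr c.
Proof. by rewrite !tr_mx2 !mxE !sum_I2 !mxE !sum_I2; ring. Qed.

(** The Cayley-Hamilton theorem for a, multiplied by b under the trace. *)
Lemma tr_sqr_mx (a b : 'M[K]_2) :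
  \tr (a *m a *m b) = \tr a * \tr (a *m b) - \det a * \tr b.
Proof. by rewrite !tr_mx2 det_mx2 !mxE !sum_I2 !mxE !sum_I2; ring. Qed.

(* [dgen k] generates the invariants expressible through traces of closed paths
   shorter than k and determinants of closed paths. *)
Definition dgen k (f : Rp -> K) := exists u p, [/\ p != [::], ptv u p u
  & (f = tp p /\ (size p < k)%N) \/ f = dp p].
Definition dec k : (Rp -> K) -> Prop := alg (dgen k).

Lemma dec_tp k u p : ptv u p u -> (size p < k)%N -> dec k (tp p).
Proof.
case: p => [|a p] up pk; first by apply: (alg_ext _ (alg_const _ (\tr (1%:M : 'M[K]_2)))).
by apply: alg_gen; exists u, (a :: p); split=> //; left.
Qed.

Lemma dec_dp k u p : ptv u p u -> dec k (dp p).
Proof.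
case: p => [|a p] up; first by apply: (alg_ext _ (alg_const _ (\det (1%:M : 'M[K]_2)))).
by apply: alg_gen; exists u, (a :: p); split=> //; right.
Qed.

Lemma dec_swap u A B C : ptv u A u -> ptv u B u -> ptv u C u ->
  A != [::] -> B != [::] -> C != [::] ->
  dec (size (A ++ B ++ C)) (fun h => tp (A ++ B ++ C) h + tp (A ++ C ++ B) h).
Proof.
move=> uA uB uC A0 B0 C0.
have [sA sB sC] : [/\ (0 < size A)%N, (0 < size B)%N & (0 < size C)%N].
  by rewrite !lt0n !size_eq0.
have d X : ptv u X u -> (size X < size (A ++ B ++ C))%N -> dec (size (A ++ B ++ C)) (tp X).
  exact: dec_tp.
apply: (alg_ext (f := fun h => tp C h * tp (A ++ B) h + tp B h * tp (A ++ C) h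
   + tp A h * tp (B ++ C) h - tp C h * tp B h * tp A h)).
  move=> h; rewrite /tp !pmat_cat tr_swap_mx.
  by rewrite [\tr (pmat h C *m pmat h B)]mxtrace_mulC.
have dA : dec (size (A ++ B ++ C)) (tp A) by apply: d => //; rewrite !size_cat; lia.
have dB : dec (size (A ++ B ++ C)) (tp B) by apply: d => //; rewrite !size_cat; lia.
have dC : dec (size (A ++ B ++ C)) (tp C) by apply: d => //; rewrite !size_cat; lia.
apply: alg_sub; last by apply: alg_mul => //; apply: alg_mul.
apply: alg_add; last first.
  by apply: alg_mul => //; apply: d; [apply: ptv_cat uB uC | rewrite !size_cat; lia].
apply: alg_add; apply: alg_mul => //; apply: d; rewrite ?size_cat; try lia.
  exact: ptv_cat uA uB.
exact: ptv_cat uA uC.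
Qed.

Lemma dec_sqr u A B : ptv u A u -> ptv u B u -> A != [::] ->
  dec (size (A ++ A ++ B)) (tp (A ++ A ++ B)).
Proof.
move=> uA uB A0; have sA : (0 < size A)%N by rewrite lt0n size_eq0.
apply: (alg_ext (f := fun h => tp A h * tp (A ++ B) h - dp A h * tp B h)).
  move=> h; rewrite /tp /dp !pmat_cat -mulmxA [in RHS]mxtrace_mulC.
  by rewrite tr_sqr_mx [\tr (pmat h B *m _)]mxtrace_mulC.
apply: alg_sub; apply: alg_mul; last 1 first.
- by apply: (dec_tp uB); rewrite !size_cat; lia.
- by apply: (dec_tp uA); rewrite !size_cat; lia.
- by apply: (dec_tp (ptv_cat uA uB)); rewrite !size_cat; lia.
- exact: dec_dp uA.
Qed.

(** Three exchanges lead from ABCD through ACDB and ACBD back to ABCD, each with a change of sign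
    modulo [dec]. An odd number of sign changes makes twice the trace decomposable, and 2 is
    invertible. *)
Lemma dec_four u A B C D : 2%N \notin [pchar K] ->
  ptv u A u -> ptv u B u -> ptv u C u -> ptv u D u ->
  A != [::] -> B != [::] -> C != [::] -> D != [::] ->
  dec (size (A ++ B ++ C ++ D)) (tp (A ++ B ++ C ++ D)).
Proof.
move=> ch2 uA uB uC uD A0 B0 C0 D0; set k := size _.
have ne (X Y : path) : X != [::] -> X ++ Y != [::] by case: X.
have s1 : dec k (fun h => tp (A ++ B ++ C ++ D) h + tp (A ++ C ++ D ++ B) h).
  have := dec_swap uA uB (ptv_cat uC uD) A0 B0 (ne _ D C0).
  by apply: alg_ext => h; rewrite -!catA.
have s2 : dec k (fun h => tp (A ++ C ++ D ++ B) h + tp (A ++ C ++ B ++ D) h).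
  have := dec_swap (ptv_cat uA uC) uD uB (ne _ C A0) D0 B0.
  have -> : size ((A ++ C) ++ D ++ B) = k by rewrite /k !size_cat; clear; lia.
  by apply: alg_ext => h; rewrite -!catA.
have s3 : dec k (fun h => tp (A ++ C ++ B ++ D) h + tp (A ++ B ++ C ++ D) h).
  have := dec_swap (ptv_cat uD uA) uC uB (ne _ A D0) C0 B0.
  have -> : size ((D ++ A) ++ C ++ B) = k by rewrite /k !size_cat; clear; lia.
  apply: alg_ext => h; rewrite -!catA.
  by rewrite [tp (D ++ _) h]tp_rot [tp (D ++ A ++ B ++ C) h]tp_rot -!catA.
have nz2 : (2%:R : K) != 0 by move: ch2; rewrite inE.
apply: (alg_ext (f := fun h => 2%:R^-1 * ((tp (A ++ B ++ C ++ D) h + tp (A ++ C ++ D ++ B) h)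
   - (tp (A ++ C ++ D ++ B) h + tp (A ++ C ++ B ++ D) h)
   + (tp (A ++ C ++ B ++ D) h + tp (A ++ B ++ C ++ D) h)))).
  by move=> h; field.
by apply: alg_scale; apply: alg_add => //; apply: alg_sub.
Qed.

Lemma dec_ext k f f' : f =1 f' -> dec k f -> dec k f'. Proof. exact: alg_ext. Qed.

Lemma ptv_end u p v w : ptv u p v -> ptv u p w -> v = w.
Proof.
by elim: p u => [|a p IHp] u /=; [move=> /eqP <- /eqP | case/andP=> _ /IHp ? /andP[_]].
Qed.

Lemma ptv_catP u p q w : ptv u (p ++ q) w -> exists2 v, ptv u p v & ptv v q w.
Proof.
elim: p u => [|a p IHp] u /=; first by exists u.
by case/andP=> au /IHp[v pv qv]; exists v => //; rewrite au.
Qed.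

(** The moves that preserve the trace modulo [dec] once signs do not matter. Empty pieces are
    allowed in a swap, which saves case distinctions later. *)
Inductive meq : path -> path -> Prop :=
  | meq_refl p : meq p p
  | meq_sym p q : meq p q -> meq q p
  | meq_trans p q r : meq p q -> meq q r -> meq p r
  | meq_rot p q : meq (p ++ q) (q ++ p)
  | meq_swap u A B C : ptv u A u -> ptv u B u -> ptv u C u ->
      meq (A ++ B ++ C) (A ++ C ++ B).

Lemma meq_perm p q : meq p q -> perm_eq p q.
Proof.
elim=> [p'|p' q' _|p' q' r _ pq _ qr|p' q'|u A B C _ _ _] //.
- by rewrite perm_sym.
- exact: perm_trans pq qr.
- by rewrite perm_catC.
- by rewrite perm_cat2l perm_catC.
Qed.

Lemma meq_closed p q : meq p q -> (exists u, ptv u p u) <-> (exists u, ptv u q u).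
Proof.
elim=> [p'|p' q' _ pq|p' q' r _ pq _ qr|p' q'|u A B C uA uB uC].
- by [].
- exact: iff_sym.
- exact: iff_trans qr.
- split=> -[u /ptv_catP[v p1 p2]]; exists v; exact: ptv_cat p2 p1.
- by split=> _; exists u; apply: ptv_cat uA (ptv_cat _ _); eassumption.
Qed.

Lemma meq_dec p q : 2%N \in [pchar K] -> meq p q -> dec (size p) (fun h => tp p h - tp q h).
Proof.
move=> ch2; elim=> [p'|p' q' pq|p' q' r pq IHp _ IHq|p' q'|u A B C uA uB uC].
- by apply: (alg_ext _ (alg_const _ 0)) => h; rewrite subrr.
- rewrite (perm_size (meq_perm pq)) => /alg_opp.
  by apply: alg_ext => h; rewrite opprB.
- rewrite -(perm_size (meq_perm pq)) in IHq.
  by apply: (alg_ext _ (alg_add IHp IHq)) => h; ring.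
- by apply: (alg_ext _ (alg_const _ 0)) => h; rewrite tp_rot subrr.
have triv X Y : (forall h, tp X h = tp Y h) -> dec (size (A ++ B ++ C)) (fun h => tp X h - tp Y h).
  by move=> XY; apply: (alg_ext _ (alg_const _ 0)) => h; rewrite XY subrr.
have [E|A0] := eqVneq A [::]; first by apply: triv => h; rewrite E /= tp_rot.
have [E|B0] := eqVneq B [::]; first by apply: triv => h; rewrite E cats0.
have [E|C0] := eqVneq C [::]; first by apply: triv => h; rewrite E cats0.
have := dec_swap uA uB uC A0 B0 C0; apply: alg_ext => h; congr (_ + _).
by rewrite oppr_pchar2.
Qed.

Lemma visit_cut v u p w : v \in [seq atail a | a <- p] -> ptv u p w ->
  exists p1 p2, [/\ p = p1 ++ p2, ptv u p1 v, ptv v p2 w, p2 != [::] & tails v p1 = 0%N].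
Proof.
elim: p u => [//|a p IHp] u; rewrite inE eq_sym; have [av _|nav /= vp] := eqVneq (atail a) v.
  move=> ap; exists [::], (a :: p); split=> //=.
    by move: ap => /= /andP[]; rewrite av eq_sym.
  by move: ap => /= /andP[_ ->]; rewrite av eqxx.
move=> /andP[au /(IHp _ vp)[p1 [p2 [-> up1 vp2 p20 t0]]]].
by exists (a :: p1), p2; split=> //=; [rewrite au | rewrite (negPf nav)].
Qed.

Lemma tails_cat v p q : tails v (p ++ q) = (tails v p + tails v q)%N.
Proof. exact: count_cat. Qed.

Lemma tails_gt0 v p : (0 < tails v p)%N = (v \in [seq atail a | a <- p]).
Proof.
rewrite -has_count; apply/hasP/mapP => [[a ap /eqP <-]|[a ap ->]]; first by exists a.
by exists a.
Qed.

Lemma loop_cut v p w : (2 <= tails v p)%N -> ptv v p w ->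
  exists A q, [/\ p = A ++ q, ptv v A v, ptv v q w, A != [::] & (tails v p <= (tails v q).+1)%N].
Proof.
case: p => [//|a p] t2 /andP[/eqP av ap].
have vp : v \in [seq atail a | a <- p].
  by rewrite -tails_gt0; move: t2; rewrite /tails /= av eqxx.
have [p1 [p2 [pE ap1 vp2 _ t0]]] := visit_cut vp ap.
exists (a :: p1), p2; split=> //=; first by rewrite pE.
  by rewrite av eqxx.
by rewrite pE /tails /= av eqxx count_cat -/(tails _ _) t0.
Qed.

Lemma sum_tails p : (\sum_v tails v p = size p)%N.
Proof.
elim: p => [|a p IHp]; first by rewrite big1.
rewrite /tails /= big_split /= -/(tails _ _) IHp (bigD1 (atail a)) //= eqxx big1 ?addn0 //.
by move=> w; rewrite eq_sym => /negPf ->.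
Qed.

Lemma dec_long u p : 2%N \notin [pchar K] -> ptv u p u -> (3 * #|ver Q| < size p)%N ->
  dec (size p) (tp p).
Proof.
move=> ch2 up p_long.
have [v tv] : exists v, (4 <= tails v p)%N.
  apply/existsP; apply: contraLR p_long; rewrite negb_exists => /forallP small.
  rewrite -leqNgt -(sum_tails p) (@leq_trans (\sum_(v : ver Q) 3)) //.
    by apply: leq_sum => v _; have := small v; rewrite -ltnNge ltnS.
  by rewrite sum_nat_const mulnC.
have vp : v \in [seq atail a | a <- p] by rewrite -tails_gt0 (leq_trans _ tv).
have [p1 [p2 [pE up1 vp2 p20 t0]]] := visit_cut vp up.
have -> : size p = size (p2 ++ p1) by rewrite pE !size_cat addnC.
apply: (dec_ext (f := tp (p2 ++ p1))); first by move=> h; rewrite pE tp_rot.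
have : (4 <= tails v (p2 ++ p1))%N by rewrite tails_cat addnC -tails_cat -pE.
have := ptv_cat vp2 up1; move: (p2 ++ p1) => q vq tq.
have [|A [q1 [qE vA vq1 A0 t1]]] := loop_cut _ vq; first exact: (leq_trans _ tq).
have {}t1 : (3 <= tails v q1)%N := leq_trans tq t1.
have [|B [q2 [q1E vB vq2 B0 t2]]] := loop_cut _ vq1; first exact: ltnW t1.
have {}t2 : (2 <= tails v q2)%N := leq_trans t1 t2.
have [|C [q3 [q2E vC vq3 C0 t3]]] := loop_cut _ vq2; first exact: t2.
have {}t3 : (1 <= tails v q3)%N := leq_trans t2 t3.
rewrite qE q1E q2E; apply: (dec_four ch2 vA vB vC vq3) => //.
by apply: contraTneq t3 => ->.
Qed.

End TraceIdentities.

(** * Insertion of closed paths in characteristic two *)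

Section Insertion.

Variable Q : quiver.

Local Notation path := (seq (arr Q)).
Local Notation loop := (ver Q * path)%type.
Implicit Types (p q A B C X : path) (u v w : ver Q) (K : path) (L : seq loop).

Definition vis p : seq (ver Q) := [seq atail a | a <- p].
Definition rot_to u p : path := rot (find (fun a => atail a == u) p) p.
Definition ins (c : loop) p : path := c.2 ++ rot_to c.1 p.

Lemma vis_cat p q : vis (p ++ q) = vis p ++ vis q.
Proof. exact: map_cat. Qed.

Lemma rot_toP w p u : ptv w p w -> u \in vis p ->
  exists p1 p2, [/\ p = p1 ++ p2, rot_to u p = p2 ++ p1, ptv w p1 u, ptv u p2 w
    & tails u p1 = 0%N].
Proof.
move=> wp up; have [p1 [p2 [-> wp1 up2 p20 t0]]] := visit_cut up wp.
exists p1, p2; split=> //; rewrite /rot_to.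
have -> : find (fun a => atail a == u) (p1 ++ p2) = size p1.
  rewrite find_cat; have -> : has (fun a => atail a == u) p1 = false.
    by rewrite has_count -/(tails u p1) t0.
  by case: p2 up2 p20 => //= a p2 /andP[-> _] _; rewrite addn0.
exact: rot_size_cat.
Qed.

Lemma insP w p1 p2 u c : ptv w p1 u -> ptv u p2 w -> ptv u c u -> u \in vis (p1 ++ p2) ->
  meq (p1 ++ c ++ p2) (ins (u, c) (p1 ++ p2)).
Proof.
move=> wp1 up2 uc up.
have [q1 [q2 [E rE wq1 uq2 t0]]] := rot_toP (ptv_cat wp1 up2) up; rewrite /ins rE /=.
have szq : (size q1 <= size p1)%N.
  rewrite leqNgt; apply/negP => lt1; case: p2 up2 E {up rE} => [_ E|b p2 /andP[/eqP bu _] E].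
    by move: lt1; rewrite ltnNge -(cats0 p1) E size_cat leq_addr.
  have bq1 : b \in q1.
    have := congr1 (fun s => nth b s (size p1)) E; rewrite !nth_cat ltnn subnn lt1 /= => ->.
    exact: mem_nth.
  have : (0 < tails u q1)%N by rewrite tails_gt0 -bu map_f.
  by rewrite t0.
pose r := drop (size q1) p1.
have p1E : p1 = q1 ++ r.
  have := congr1 (take (size q1)) E; rewrite [RHS]take_size_cat // takel_cat // => E1.
  by rewrite -[LHS](cat_take_drop (size q1)) E1.
have q2E : q2 = r ++ p2.
  by have := congr1 (drop (size q1)) E; rewrite p1E -!catA !drop_size_cat.
have ur : ptv u r u.
  by move: wp1; rewrite p1E => /ptv_catP[v q1v rv]; rewrite (ptv_end wq1 q1v) in rv *.
rewrite q2E p1E -!catA; apply: meq_trans (meq_rot _ _) _; rewrite -!catA.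
apply: meq_trans (meq_swap ur uc (ptv_cat up2 wq1)) _.
by have := meq_rot (r ++ p2 ++ q1) c; rewrite -!catA.
Qed.

Lemma meq_vis p q : meq p q -> vis p =i vis q.
Proof. by move/meq_perm => pq; apply: perm_mem; apply: perm_map. Qed.

Lemma perm_rot_to u p : perm_eq (rot_to u p) p.
Proof. by rewrite /rot_to perm_rot. Qed.

Lemma vis_rot_to u p : vis (rot_to u p) =i vis p.
Proof. by apply: perm_mem; apply: perm_map; apply: perm_rot_to. Qed.

Lemma ins_perm c p : perm_eq (ins c p) (c.2 ++ p).
Proof. by rewrite /ins perm_cat2l perm_rot_to. Qed.

Lemma ins_vis c p v : v \in vis p -> v \in vis (ins c p).
Proof.
move=> vp; rewrite (perm_mem (perm_map (@atail Q) (ins_perm c p))) map_cat mem_cat.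
by apply/orP; right.
Qed.

Lemma ins_closed w u c p : ptv w p w -> u \in vis p -> ptv u c u -> ptv u (ins (u, c) p) u.
Proof.
move=> wp up uc; have [p1 [p2 [_ rE wp1 up2 _]]] := rot_toP wp up.
by rewrite /ins rE /=; apply: ptv_cat uc (ptv_cat up2 wp1).
Qed.

(** Insertion is well defined on classes: u is visited within one of the pieces that an elementary
    move permutes, and the inserted path travels with this piece. *)
Lemma ins_meq p p' u c : meq p p' -> (exists w, ptv w p w) -> u \in vis p -> ptv u c u ->
  meq (ins (u, c) p) (ins (u, c) p').
Proof.
move=> pp' + + uc.
elim: pp' => [q|q q' qq' IH|q q' r qq' IH q'r IH'|A B|z A B C zA zB zC].
- by move=> _ _; apply: meq_refl.
- move=> cl uq; apply: meq_sym; apply: IH; first by apply/(meq_closed qq').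
  by rewrite (meq_vis qq').
- move=> cl uq; apply: meq_trans (IH cl uq) (IH' _ _); first by apply/(meq_closed qq').
  by rewrite -(meq_vis qq').
- move=> [w /ptv_catP[x wA xB]] uAB; move: (uAB); rewrite vis_cat mem_cat => /orP[uA|uB].
    have [A1 [A2 [AE wA1 uA2 _ _]]] := visit_cut uA wA; subst A.
    have i1 := insP (p2 := A2 ++ B) wA1 (ptv_cat uA2 xB) uc.
    have i2 := insP (p2 := A2) (ptv_cat xB wA1) uA2 uc.
    rewrite -!catA in uAB i1 i2 *.
    apply: meq_trans (meq_sym (i1 uAB)) (meq_trans _ (i2 _)); last first.
      by move: uAB; rewrite !vis_cat !mem_cat => /or3P[]->; rewrite ?orbT.
    by have := meq_rot (A1 ++ c ++ A2) B; rewrite -!catA.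
  have [B1 [B2 [BE xB1 uB2 _ _]]] := visit_cut uB xB; subst B.
  have i1 := insP (p2 := B2) (ptv_cat wA xB1) uB2 uc.
  have i2 := insP (p2 := B2 ++ A) xB1 (ptv_cat uB2 wA) uc.
  rewrite -!catA in uAB i1 i2 *.
  apply: meq_trans (meq_sym (i1 uAB)) (meq_trans _ (i2 _)); last first.
    by move: uAB; rewrite !vis_cat !mem_cat => /or3P[]->; rewrite ?orbT.
  by have := meq_rot A (B1 ++ c ++ B2); rewrite -!catA.
- move=> _ uABC; have uACB : u \in vis (A ++ C ++ B).
    by move: uABC; rewrite !vis_cat !mem_cat => /or3P[]->; rewrite ?orbT.
  move: (uABC); rewrite !vis_cat !mem_cat => /or3P[uA|uB|uC].
  + have [A1 [A2 [AE zA1 uA2 _ _]]] := visit_cut uA zA; subst A.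
    have zA' := ptv_cat zA1 (ptv_cat uc uA2).
    have i1 := insP (p2 := A2 ++ B ++ C) zA1 (ptv_cat uA2 (ptv_cat zB zC)) uc.
    have i2 := insP (p2 := A2 ++ C ++ B) zA1 (ptv_cat uA2 (ptv_cat zC zB)) uc.
    rewrite -!catA in uABC uACB i1 i2 *.
    apply: meq_trans (meq_sym (i1 uABC)) (meq_trans _ (i2 uACB)).
    by have := meq_swap zA' zB zC; rewrite -!catA.
  + have [B1 [B2 [BE zB1 uB2 _ _]]] := visit_cut uB zB; subst B.
    have zB' := ptv_cat zB1 (ptv_cat uc uB2).
    have i1 := insP (p2 := B2 ++ C) (ptv_cat zA zB1) (ptv_cat uB2 zC) uc.
    have i2 := insP (p2 := B2) (ptv_cat zA (ptv_cat zC zB1)) uB2 uc.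
    rewrite -!catA in uABC uACB i1 i2 *.
    apply: meq_trans (meq_sym (i1 uABC)) (meq_trans _ (i2 uACB)).
    by have := meq_swap zA zB' zC; rewrite -!catA.
  + have [C1 [C2 [CE zC1 uC2 _ _]]] := visit_cut uC zC; subst C.
    have zC' := ptv_cat zC1 (ptv_cat uc uC2).
    have i1 := insP (p2 := C2) (ptv_cat zA (ptv_cat zB zC1)) uC2 uc.
    have i2 := insP (p2 := C2 ++ B) (ptv_cat zA zC1) (ptv_cat uC2 zB) uc.
    rewrite -!catA in uABC uACB i1 i2 *.
    apply: meq_trans (meq_sym (i1 uABC)) (meq_trans _ (i2 uACB)).
    by have := meq_swap zA zB zC'; rewrite -!catA.
Qed.

Lemma ins_two w p1 p2 p3 u v c d : ptv w p1 u -> ptv u p2 v -> ptv v p3 w ->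
  ptv u c u -> ptv v d v -> u \in vis (p1 ++ p2 ++ p3) -> v \in vis (p1 ++ p2 ++ p3) ->
  meq (ins (u, c) (ins (v, d) (p1 ++ p2 ++ p3))) (p1 ++ c ++ p2 ++ d ++ p3) /\
  meq (ins (v, d) (ins (u, c) (p1 ++ p2 ++ p3))) (p1 ++ c ++ p2 ++ d ++ p3).
Proof.
move=> wp1 up2 vp3 uc vd up vp; split.
  have i1 := insP (p2 := p3) (ptv_cat wp1 up2) vp3 vd.
  rewrite -!catA in i1; have {}i1 := i1 vp.
  have wq := ptv_cat wp1 (ptv_cat up2 (ptv_cat vd vp3)).
  have uq : u \in vis (p1 ++ p2 ++ d ++ p3).
    by rewrite (meq_vis i1); apply: ins_vis.
  apply: meq_trans (meq_sym (ins_meq i1 (ex_intro _ w wq) uq uc)) _.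
  by apply: meq_sym; apply: insP wp1 (ptv_cat up2 (ptv_cat vd vp3)) uc uq.
have i1 := insP (p2 := p2 ++ p3) wp1 (ptv_cat up2 vp3) uc up.
have wq := ptv_cat wp1 (ptv_cat uc (ptv_cat up2 vp3)).
have vq : v \in vis (p1 ++ c ++ p2 ++ p3).
  by rewrite (meq_vis i1); apply: ins_vis.
apply: meq_trans (meq_sym (ins_meq i1 (ex_intro _ w wq) vq vd)) _.
have := insP (p2 := p3) (ptv_cat wp1 (ptv_cat uc up2)) vp3 vd; rewrite -!catA => i2.
exact/meq_sym/i2.
Qed.

Lemma ins_comm w p u v c d : ptv w p w -> u \in vis p -> v \in vis p ->
  ptv u c u -> ptv v d v ->
  meq (ins (u, c) (ins (v, d) p)) (ins (v, d) (ins (u, c) p)).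
Proof.
move=> wp up vp uc vd; have [p1 [p2 [pE wp1 up2 _ _]]] := visit_cut up wp.
have /orP[v1|v2] : (v \in vis p1) || (v \in vis p2) by move: vp; rewrite pE vis_cat mem_cat.
  have [q1 [q2 [qE wq1 vq2 _ _]]] := visit_cut v1 wp1.
  rewrite {}qE -catA in pE; rewrite pE in up vp.
  have [i1 i2] := ins_two wq1 vq2 up2 vd uc vp up.
  by rewrite pE; apply: meq_trans i2 (meq_sym i1).
have [q1 [q2 [qE uq1 vq2 _ _]]] := visit_cut v2 up2.
rewrite {}qE in pE; rewrite pE in up vp.
have [i1 i2] := ins_two wp1 uq1 vq2 uc vd up vp.
by rewrite pE; apply: meq_trans i1 (meq_sym i2).
Qed.

(** Base points lie on K itself and not merely on the path grown so far; this makes the order of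
    insertions free. *)
Definition okl K (c : loop) : bool := ptv c.1 c.2 c.1 && (c.1 \in vis K).

Definition insl K L : path := foldr ins K L.
Definition closed K := exists w, ptv w K w.

Lemma insl_closed K L : closed K -> all (okl K) L ->
  closed (insl K L) /\ {subset vis K <= vis (insl K L)}.
Proof.
move=> clK; elim: L => [|[u c] L IHL] /=; first by move=> _; split.
case/andP=> /andP[/= uc uK] /IHL[[w wL] sub].
split; last by move=> v /sub; apply: ins_vis.
by exists u; apply: ins_closed wL (sub _ uK) uc.
Qed.

Lemma insl_perm K L : perm_eq (insl K L) (flatten [seq c.2 | c <- L] ++ K).
Proof.
elim: L => [|c L IHL] /=; first by [].
apply: perm_trans (ins_perm _ _) _.
by rewrite -catA perm_cat2l.
Qed.

Section State.

Variable K : path.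
Hypothesis K_closed : closed K.

Definition sq L L' := meq (insl K L) (insl K L').

Lemma sq_trans L1 L2 L3 : sq L1 L2 -> sq L2 L3 -> sq L1 L3.
Proof. exact: meq_trans. Qed.

Lemma sq_cons c L L' : okl K c -> all (okl K) L -> sq L L' -> sq (c :: L) (c :: L').
Proof.
case: c => u c /andP[/= uc uK] okL LL'.
have [cl sub] := insl_closed K_closed okL.
by apply: ins_meq LL' cl (sub _ uK) uc.
Qed.

Lemma sq_cat R L L' : all (okl K) (R ++ L) -> sq L L' -> sq (R ++ L) (R ++ L').
Proof.
elim: R => [|c R IHR] //= /andP[okc okL] LL'.
by apply: sq_cons => //; apply: IHR.
Qed.

Lemma sq_swap c d L : all (okl K) [:: c, d & L] -> sq [:: c, d & L] [:: d, c & L].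
Proof.
case: c d => [u c] [v d] /= /and3P[/andP[/= uc uK] /andP[/= vd vK] okL].
have [[w wL] sub] := insl_closed K_closed okL.
exact: ins_comm wL (sub _ uK) (sub _ vK) uc vd.
Qed.

Lemma sq_front c L1 L2 : all (okl K) (L1 ++ c :: L2) -> sq (L1 ++ c :: L2) (c :: L1 ++ L2).
Proof.
elim: L1 => [_|d L1 IHL] /=; first exact: meq_refl.
case/andP=> okd okL; apply: sq_trans (sq_cons okd okL (IHL okL)) _.
apply: sq_swap; rewrite /= okd /=.
by move: okL; rewrite !all_cat /= => /and3P[-> -> ->].
Qed.

Lemma sq_perm L L' : perm_eq L L' -> all (okl K) L -> sq L L'.
Proof.
elim: L L' => [|c L IHL] L' LL'.
  by rewrite perm_sym in LL'; rewrite (perm_nilP LL') => _; apply: meq_refl.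
move=> okL; have okL' : all (okl K) L' by rewrite -(perm_all _ LL').
have cL' : c \in L' by rewrite -(perm_mem LL') mem_head.
case/splitPr: cL' LL' okL' => L1 L2 LL' okL'.
apply: meq_trans (meq_sym (sq_front okL')).
have LL2 : perm_eq L (L1 ++ L2).
  by rewrite -(perm_cons c) (permPl LL') -cat1s perm_catCA.
by move: okL => /= /andP[okc okL]; apply: sq_cons => //; apply: IHL.
Qed.

(** The closed middle part X may be regarded as inserted at w after the rest, or as part of the path
    at u. Read backwards the lemma merges, read forwards it splits. *)
Lemma sq_merge u w A X B L : ptv u A w -> ptv w X w -> ptv w B u ->
  u \in vis K -> w \in vis K -> all (okl K) L ->
  sq ((u, A ++ X ++ B) :: L) [:: (w, X), (u, A ++ B) & L].
Proof.
move=> uA wX wB uK wK okL; have [[z zL] sub] := insl_closed K_closed okL.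
rewrite /sq /= {1 3}/ins /=; set r := rot_to u _.
have ur : ptv u r u.
  by have := ins_closed (c := [::]) zL (sub _ uK) (eqxx _); rewrite /ins.
have wr : w \in vis r by rewrite vis_rot_to sub.
clearbody r; have := insP (p2 := B ++ r) uA (ptv_cat wB ur) wX; rewrite -!catA; apply.
by rewrite !vis_cat !mem_cat wr !orbT.
Qed.

(** The words Q1 (aP) a Q2 and Q1 a (Pa) Q2 coincide: inserting aP before another occurrence of a is
    the same as inserting Pa after it. *)
Lemma sq_rebase1 v a P Q1 Q2 L : okl K (atail a, a :: P) -> okl K (v, Q1 ++ a :: Q2) ->
  ahead a \in vis K -> all (okl K) L ->
  sq [:: (atail a, a :: P), (v, Q1 ++ a :: Q2) & L]
     [:: (ahead a, rcons P a), (v, Q1 ++ a :: Q2) & L].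
Proof.
case/andP=> /= /andP[_ aP] aK /andP[/= vQ vK] hK okL.
have [[z zL] sub] := insl_closed K_closed okL.
have [x vQ1 xQ2] := ptv_catP vQ; move: xQ2 => /= /andP[/eqP ax hQ2]; subst x.
rewrite /sq /=; set p := ins (v, _) _.
have [r pE vr] : exists2 r, p = Q1 ++ a :: Q2 ++ r & ptv v r v.
  exists (rot_to v (insl K L)); first by rewrite /p /ins /= -catA.
  by have := ins_closed (c := [::]) zL (sub _ vK) (eqxx _); rewrite /ins.
have pv' u : u \in vis K -> u \in vis p by move=> /sub; apply: ins_vis.
have i1 := insP (p2 := a :: Q2 ++ r) (c := a :: P) vQ1.
have i2 := insP (p2 := Q2 ++ r) (u := ahead a) (c := rcons P a) (p1 := Q1 ++ [:: a]) (w := v).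
rewrite -!catA /= -!pE in i1 i2.
apply: meq_trans (meq_sym (i1 _ _ _)) _.
- by rewrite /= eqxx; apply: ptv_cat hQ2 vr.
- by rewrite /= eqxx.
- exact: pv'.
have -> : Q1 ++ a :: P ++ a :: Q2 ++ r = Q1 ++ a :: rcons P a ++ Q2 ++ r by rewrite cat_rcons.
apply: i2.
- by apply: ptv_cat vQ1 _; rewrite /= !eqxx.
- exact: ptv_cat hQ2 vr.
- by rewrite -cats1; apply: ptv_cat aP _; rewrite /= !eqxx.
- exact: pv'.
Qed.

End State.

End Insertion.

(** * Rebasing in even families of closed paths *)

Section SecondCopy.

Variables (Q : quiver) (K : seq (arr Q)).
Hypothesis K_closed : closed K.

Local Notation path := (seq (arr Q)).
Local Notation loop := (ver Q * path)%type.
Implicit Types (P A : path) (u v w z : ver Q) (L R : seq loop).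

Definition flat L : path := flatten [seq c.2 | c <- L].
Definition evenL L := forall a, ~~ odd (count_mem a (flat L)).
(** Rebasing moves a base point along arrows, and the new base point must again be a vertex of K. *)
Definition inK L := forall a, a \in flat L -> ahead a \in vis K.

Lemma flat_perm L L' : perm_eq L L' -> perm_eq (flat L) (flat L').
Proof. by move=> LL'; apply: perm_flatten; apply: perm_map. Qed.

Lemma flat_cat L L' : flat (L ++ L') = flat L ++ flat L'.
Proof. by rewrite /flat map_cat flatten_cat. Qed.

Lemma evenL_perm L L' : perm_eq (flat L) (flat L') -> evenL L -> evenL L'.
Proof. by move=> LL' ev a; rewrite -(permP LL'). Qed.

Lemma inK_perm L L' : perm_eq (flat L) (flat L') -> inK L -> inK L'.
Proof. by move=> LL' ik a; rewrite -(perm_mem LL'); apply: ik. Qed.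

Lemma flat_mem a L : a \in flat L -> exists L1 v Q1 Q2 L2,
  L = L1 ++ (v, Q1 ++ a :: Q2) :: L2.
Proof.
case/flattenP=> _ /mapP[[v q] qL ->] /= aq.
case/splitPr: qL => L1 L2; case/splitPr: aq => Q1 Q2.
by exists L1, v, Q1, Q2, L2.
Qed.

Lemma perm_front (T : eqType) (c d : T) (L1 L2 : seq T) :
  perm_eq (c :: L1 ++ d :: L2) [:: c, d & L1 ++ L2].
Proof. by rewrite perm_cons -cat1s perm_catCA. Qed.

(* A closed path through the arrow a may be rebased from the tail to the head of a
   as soon as a occurs once more in the state; evenness guarantees this. *)
Lemma rebase a P L : okl K (atail a, a :: P) -> all (okl K) L ->
  evenL ((atail a, a :: P) :: L) -> inK ((atail a, a :: P) :: L) ->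
  sq K ((atail a, a :: P) :: L) ((ahead a, rcons P a) :: L).
Proof.
move=> okP okL ev ik; have hK : ahead a \in vis K by apply: ik; rewrite /flat /= mem_head.
move: (okP) => /andP[/= /andP[_ aP] aK].
have okPr : okl K (ahead a, rcons P a).
  by rewrite /okl /= hK andbT -cats1; apply: ptv_cat aP _; rewrite /= !eqxx.
have [aL|aL] := boolP (a \in flat L).
  have [L1 [v [Q1 [Q2 [L2 LE]]]]] := flat_mem aL; subst L.
  have okQ : okl K (v, Q1 ++ a :: Q2) by move: okL; rewrite all_cat /= => /and3P[].
  have okL' : all (okl K) (L1 ++ L2) by move: okL; rewrite !all_cat /= => /and3P[-> _ ->].
  apply: sq_trans (sq_perm K_closed (perm_front _ _ _ _) _) _; first by rewrite /= okP.
  apply: sq_trans (sq_rebase1 K_closed okP okQ hK okL') _.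
  apply: sq_perm => //; last by rewrite /= okPr okQ.
  by rewrite perm_sym perm_front.
(* If no other path contains a, evenness forces a second a inside P. *)
have aP' : a \in P.
  have := ev a; rewrite /flat /= eqxx count_cat -/(flat L) (count_memPn aL) addn0 oddS negbK.
  by move=> od; rewrite -has_pred1 has_count; case: count od.
case/splitPr: aP' okP okPr ev ik aP => P1 P2 okP okPr ev ik aP.
have [x hP1 xP2] := ptv_catP aP; move: xP2 => /= /andP[/eqP E hP2]; subst x.
have ok1 : okl K (atail a, a :: P1) by rewrite /okl /= eqxx hP1.
have ok2 : okl K (atail a, a :: P2) by rewrite /okl /= eqxx hP2.
have ok1' : okl K (ahead a, rcons P1 a).
  by rewrite /okl /= hK andbT -cats1; apply: ptv_cat hP1 _; rewrite /= !eqxx.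
have ok2' : okl K (ahead a, rcons P2 a).
  by rewrite /okl /= hK andbT -cats1; apply: ptv_cat hP2 _; rewrite /= !eqxx.
have aP1 : ptv (atail a) (a :: P1) (atail a) by rewrite /= eqxx.
have aP2 : ptv (atail a) (a :: P2) (atail a) by rewrite /= eqxx.
(* The path is split before its second a; the pieces aP1 and aP2 serve as each other's further
   occurrence, are rebased in turn and merged again. *)
apply: sq_trans (sq_merge K_closed (A := [::]) (eqxx _) aP1 aP2 aK aK okL) _.
apply: sq_trans (sq_rebase1 K_closed (Q1 := [::]) ok1 ok2 hK okL) _.
apply: sq_trans (sq_swap K_closed _) _; first by rewrite /= ok1' ok2.
rewrite -{1}cats1; apply: sq_trans (sq_rebase1 K_closed ok2 _ hK okL) _.
  by rewrite cats1.
rewrite cats1; apply: sq_trans (sq_swap K_closed _) _; first by rewrite /= ok1' ok2'.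
have hP1' : ptv (ahead a) (rcons P1 a) (ahead a) by case/andP: ok1'.
have hP2' : ptv (ahead a) (rcons P2 a) (ahead a) by case/andP: ok2'.
have := sq_merge K_closed (A := [::]) (eqxx _) hP1' hP2' hK hK okL.
rewrite /= (_ : rcons P1 a ++ rcons P2 a = rcons (P1 ++ a :: P2) a); last first.
  by rewrite cat_rcons -rcons_cons rcons_cat.
exact: meq_sym.
Qed.

Lemma rebase_many Q1 Q2 z v L : ptv z Q1 v -> ptv v Q2 z -> z \in vis K -> all (okl K) L ->
  evenL ((z, Q1 ++ Q2) :: L) -> inK ((z, Q1 ++ Q2) :: L) ->
  sq K ((z, Q1 ++ Q2) :: L) ((v, Q2 ++ Q1) :: L).
Proof.
elim: Q1 z Q2 => [|a Q1 IH] z Q2 zQ1 vQ2 zK okL ev ik.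
  by move: zQ1 => /= /eqP <-; rewrite cats0; apply: meq_refl.
move: zQ1 => /= /andP[/eqP za aQ1]; subst z.
have okQ : okl K (atail a, a :: Q1 ++ Q2) by rewrite /okl /= eqxx zK andbT; apply: ptv_cat vQ2.
apply: sq_trans (rebase okQ okL ev ik) _; rewrite rcons_cat -cats1.
have pe : perm_eq (flat ((atail a, a :: Q1 ++ Q2) :: L)) (flat ((ahead a, Q1 ++ Q2 ++ [:: a]) :: L)).
  by rewrite /flat /= -cat_cons perm_cat2r catA -(cat1s a) perm_catC.
have := IH (ahead a) (Q2 ++ [:: a]) aQ1 _ _ okL (evenL_perm pe ev) (inK_perm pe ik).
rewrite -catA; apply; first by apply: ptv_cat vQ2 _; rewrite /= !eqxx.
by apply: ik; rewrite /flat /= mem_head.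
Qed.

Lemma sq_nil u L : u \in vis K -> all (okl K) L -> sq K L ((u, [::]) :: L).
Proof.
move=> uK okL; have [[z zL] sub] := insl_closed K_closed okL.
have [p1 [p2 [pE rE _ _ _]]] := rot_toP zL (sub _ uK).
by rewrite /sq /= /ins /= rE {1}pE; apply: meq_rot.
Qed.

(** A is assembled arrow by arrow as the initial part of one inserted path, while R is kept and
    contributes to the parity. As A repeats no arrow, the next one is not in the prefix built so
    far, hence it lies in the rest of this path or in another one. *)
Lemma second_copy A u R L : uniq A -> ptv u A u -> u \in vis K -> all (okl K) (R ++ L) ->
  evenL (R ++ L) -> inK (R ++ L) -> {subset A <= flat L} ->
  exists L1, [/\ all (okl K) L1, perm_eq (flat L) (A ++ flat L1)
    & sq K (R ++ L) (R ++ (u, A) :: L1)].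
Proof.
move=> uniqA uA uK okRL ev ik subA; move: (okRL); rewrite all_cat => /andP[okR okL].
suff pre (w w' : path) : A = w ++ w' -> exists v P L1, [/\ ptv u w v, ptv v P u, all (okl K) L1,
    perm_eq (flat L) (w ++ P ++ flat L1) & sq K (R ++ L) (R ++ (u, w ++ P) :: L1)].
  have [v [P [L1 [uAv vP okL1 pe sqA]]]] := pre A [::] (esym (cats0 A)).
  rewrite (ptv_end uAv uA) in vP; exists ((u, P) :: L1); split=> //.
    by rewrite /= /okl /= vP uK.
  apply: sq_trans sqA _; apply: sq_cat => //.
    by rewrite all_cat okR /= /okl /= uK andbT okL1 andbT; apply: ptv_cat vP.
  exact: (sq_merge K_closed (A := [::]) (eqxx _) uA vP uK uK okL1).
elim/last_ind: w w' => [|w a IHw] w' AE.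
  exists u, [::], L; split=> //=.
  by apply: sq_cat => //; apply: sq_nil.
have [|v [P [L1 [uw vP okL1 pe sqw]]]] := IHw (a :: w'); first by rewrite AE cat_rcons.
have av : atail a = v.
  move: uA; rewrite AE cat_rcons => /ptv_catP[v' uv'].
  by rewrite (ptv_end uv' uw) /= => /andP[/eqP].
have aK : v \in vis K.
  have [E|w0] := eqVneq w [::]; first by move: uw; rewrite E /= => /eqP <-.
  case/lastP: w w0 uw pe {sqw IHw AE} => [//|w b] _ uw pe.
  move: uw; rewrite -cats1 => /ptv_catP[x _ /= /andP[_ /eqP <-]].
  apply: ik; rewrite flat_cat mem_cat (perm_mem pe) mem_cat mem_rcons mem_head.
  by rewrite orbT.
have aw : a \notin w.
  by move: uniqA; rewrite AE cat_uniq rcons_uniq => /and3P[/andP[]].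
have := subA a; rewrite AE mem_cat mem_rcons mem_head => /(_ isT).
rewrite (perm_mem pe) mem_cat (negPf aw) mem_cat /= => /orP[aP|aL1].
  (* The next arrow comes later in the same path: the closed piece P1 in front of it is split
     off. *)
  case/splitPr: aP vP pe sqw => P1 P2 vP pe sqw.
  have [x vP1 xP2] := ptv_catP vP; move: xP2 => /= /andP[/eqP E aP2].
  rewrite -E av in vP1.
  exists (ahead a), P2, ((v, P1) :: L1); split=> //=.
  - by rewrite -cats1; apply: ptv_cat uw _; rewrite /= av !eqxx.
  - by rewrite /okl /= vP1 aK.
  - apply: perm_trans pe _; rewrite cat_rcons -!catA perm_cat2l -[flat (_ :: _)]/(P1 ++ flat L1).
    by rewrite /= perm_catC /= perm_cons -catA perm_cat2l perm_catC.
  apply: sq_trans sqw _; rewrite cat_rcons; apply: sq_cat => //.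
    rewrite all_cat okR /= /okl /= uK andbT okL1 andbT.
    by apply: ptv_cat uw vP.
  have aP2' : ptv v (a :: P2) u by rewrite /= av eqxx.
  apply: sq_trans (sq_merge K_closed uw vP1 aP2' uK aK okL1) _.
  apply: sq_swap => //; rewrite /= /okl /= vP1 aK uK okL1 !andbT /=.
  exact: ptv_cat uw aP2'.
(* The next arrow lies in another path, which is rebased so as to start with it and is then merged
   in right after the prefix w. *)
have [M1 [z [Q1 [Q2 [M2 LE]]]]] := flat_mem aL1; subst L1.
have okz : okl K (z, Q1 ++ a :: Q2) by move: okL1; rewrite all_cat /= => /and3P[].
have okM : all (okl K) (M1 ++ M2) by move: okL1; rewrite !all_cat /= => /and3P[-> _ ->].
have [/= zQ zK] := andP okz; have [x zQ1 xQ2] := ptv_catP zQ.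
move: (xQ2) => /= /andP[/eqP E aQ2]; subst x; rewrite av in zQ1 xQ2.
have okuw : okl K (u, w ++ P) by rewrite /okl /= uK andbT; apply: ptv_cat vP.
have peM : perm_eq (flat (M1 ++ (z, Q1 ++ a :: Q2) :: M2)) ((Q1 ++ a :: Q2) ++ flat (M1 ++ M2)).
  have -> : (Q1 ++ a :: Q2) ++ flat (M1 ++ M2) = flat ((z, Q1 ++ a :: Q2) :: M1 ++ M2) by [].
  by apply: flat_perm; rewrite -cat1s perm_catCA.
exists (ahead a), (Q2 ++ Q1 ++ P), (M1 ++ M2); split=> //.
- by rewrite -cats1; apply: ptv_cat uw _; rewrite /= av !eqxx.
- exact: ptv_cat aQ2 (ptv_cat zQ1 vP).
- apply: perm_trans pe _; rewrite cat_rcons perm_cat2l.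
  apply: perm_trans (perm_cat (perm_refl P) peM) _.
  apply/permP => t; rewrite !count_cat /= !count_cat.
  by move: (count t _) (count t _) (count t _) (count t _) (nat_of_bool _); clear; lia.
set c := (z, _) in okz sqw okL1 peM pe *.
have okall : all (okl K) (R ++ (u, w ++ P) :: M1 ++ c :: M2).
  by rewrite all_cat okR /= okuw.
apply: sq_trans sqw _.
have pe1 : perm_eq (R ++ (u, w ++ P) :: M1 ++ c :: M2) (c :: R ++ (u, w ++ P) :: M1 ++ M2).
  apply/permP => t; rewrite /= !count_cat /= !count_cat /=.
  by move: (count t _) (count t _) (count t _) (nat_of_bool _) (nat_of_bool _); clear; lia.
apply: sq_trans (sq_perm K_closed pe1 okall) _.
have okR' : all (okl K) (R ++ (u, w ++ P) :: M1 ++ M2) by rewrite all_cat okR /= okuw.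
have pe2 : perm_eq (flat (R ++ L)) (flat (c :: R ++ (u, w ++ P) :: M1 ++ M2)).
  apply: perm_trans (flat_perm pe1).
  by rewrite !flat_cat perm_cat2l (perm_trans pe) // /flat /= -catA perm_cat2l perm_cat2l.
have rb := rebase_many zQ1 xQ2 zK okR' (evenL_perm pe2 ev) (inK_perm pe2 ik).
apply: sq_trans rb _.
have okv : okl K (v, (a :: Q2) ++ Q1) by rewrite /okl /= aK av eqxx andbT; apply: ptv_cat aQ2 zQ1.
have pe3 : perm_eq ((v, (a :: Q2) ++ Q1) :: R ++ (u, w ++ P) :: M1 ++ M2)
    (R ++ [:: (v, (a :: Q2) ++ Q1), (u, w ++ P) & M1 ++ M2]).
  by rewrite -cat1s perm_catCA.
have okall3 : all (okl K) ((v, (a :: Q2) ++ Q1) :: R ++ (u, w ++ P) :: M1 ++ M2).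
  by rewrite /= okv.
apply: sq_trans (sq_perm K_closed pe3 okall3) _.
apply: sq_cat => //; first by rewrite -(perm_all _ pe3).
have vX : ptv v ((a :: Q2) ++ Q1) v by case/andP: okv.
have := sq_merge K_closed uw vX vP uK aK okM.
rewrite (_ : w ++ ((a :: Q2) ++ Q1) ++ P = rcons w a ++ Q2 ++ Q1 ++ P).
  exact: meq_sym.
by rewrite cat_rcons /= -!catA.
Qed.

End SecondCopy.

(** * Primitive closed subpaths and the cycle space over F_2 *)

Section CharTwoBound.

Variable Q : quiver.

Local Notation path := (seq (arr Q)).
Local Notation loop := (ver Q * path)%type.
Implicit Types (p c : path) (u v w : ver Q) (L : seq loop).

Definition heads_uniq p : bool := uniq [seq ahead a | a <- p].

Lemma nonprimitive_cut u p w : ptv u p w -> ~~ heads_uniq p ->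
  exists p1 c p2 v, [/\ p = p1 ++ c ++ p2, p1 != [::], c != [::]
    & [/\ ptv u p1 v, ptv v c v & ptv v p2 w]].
Proof.
elim: p u => [//|a p IHp] u /= /andP[au ap].
rewrite /heads_uniq /= negb_and negbK => /orP[/mapP[b bp ab]|nu].
  case/splitPr: bp ap => q1 q2 /ptv_catP[x aq1 /= /andP[bx bq2]].
  exists [:: a], (rcons q1 b), q2, (ahead a); split=> //.
  - by rewrite cat_rcons.
  - by case: q1 {aq1}.
  - split; rewrite /= ?au ?eqxx ?ab // -?cats1 -?ab.
    by apply: ptv_cat aq1 _; rewrite /= bx ab eqxx.
have [p1 [c [p2 [v [-> _ c0 [ap1 vc vp2]]]]]] := IHp _ ap nu.
by exists (a :: p1), c, p2, v; split=> //; split=> //=; rewrite au.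
Qed.

(** The cut is repeated inside the closed piece until no head is repeated. Nonemptiness of [p1]
    makes the piece proper and keeps the remaining path nonempty. *)
Lemma primitive_cut u p w : ptv u p w -> ~~ heads_uniq p ->
  exists p1 c p2 v, [/\ p = p1 ++ c ++ p2, p1 != [::], c != [::], heads_uniq c
    & [/\ ptv u p1 v, ptv v c v & ptv v p2 w]].
Proof.
have [n] := ubnP (size p); elim: n u p w => // n IHn u p w pn up nu.
have [p1 [c [p2 [v [pE p10 c0 [up1 vc vp2]]]]]] := nonprimitive_cut up nu.
have [cu|ncu] := boolP (heads_uniq c); first by exists p1, c, p2, v.
have cn : (size c < n)%N.
  rewrite -ltnS; apply: leq_trans pn; rewrite ltnS pE !size_cat.
  by case: p1 p10 {pE up1} => //= a p1 _; rewrite addSn ltnS addnCA leq_addr.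
have [c1 [c' [c2 [x [cE c10 c'0 c'u [vc1 xc' xc2]]]]]] := IHn _ _ _ cn vc ncu.
exists (p1 ++ c1), c', (c2 ++ p2), x; split=> //.
- by rewrite pE cE -!catA.
- by case: p1 p10 {pE up1}.
- by split=> //; [apply: ptv_cat up1 vc1 | apply: ptv_cat xc2 vp2].
Qed.

Lemma vis_end u p v : p != [::] -> ptv u p v -> u \in vis p.
Proof. by case: p => //= a p _ /andP[/eqP <- _]; rewrite mem_head. Qed.

Lemma closed_head u p a : ptv u p u -> a \in p -> ahead a \in vis p.
Proof.
move=> up ap; case/splitPr: ap up => p1 p2 up.
have := vis_end _ up; rewrite -cat_rcons in up *.
have [x ux xp2] := ptv_catP up.
have xa : x = ahead a by move: ux; rewrite -cats1 => /ptv_catP[y _ /= /andP[_ /eqP]].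
case: p2 up xp2 => [up /= /eqP <-|b p2 up /= /andP[/eqP bx _] _].
  by rewrite -xa; apply; case: (p1).
by rewrite -xa -bx vis_cat mem_cat /= mem_head orbT.
Qed.

Lemma ptv_balanced u c w v : ptv u c w -> (heads v c + (u == v) = tails v c + (w == v))%N.
Proof.
elim: c u => [|a c IHc] u /=; first by move=> /eqP ->.
case/andP=> /eqP au /IHc; rewrite /heads /tails /= au -!/(heads _ _) -!/(tails _ _).
by move: (heads _ _) (tails _ _); case: (u == v); case: (ahead a == v); case: (w == v); clear; lia.
Qed.

Section EvenSubfamily.

Variables (r : ver Q) (P : path) (a0 : arr Q).
Hypotheses (rP : ptv r P r) (Pall : forall v, v \in [seq ahead a | a <- P]).

Let hs := [seq ahead a | a <- P].
(** The arrow through which P first enters v. For v other than r these arrows form a spanning tree,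
    along which [rank] increases. *)
Let f v := nth a0 P (index v hs).
Let rank v := if v == r then 0%N else (index v hs).+1.

Lemma index_hs v : (index v hs < size P)%N.
Proof. by rewrite -(size_map (@ahead Q)) index_mem Pall. Qed.

Lemma ahead_f v : ahead (f v) = v.
Proof. by rewrite /f -(nth_map _ v) ?index_hs // nth_index. Qed.

Lemma ptv_nth u p w i : ptv u p w -> (i.+1 < size p)%N ->
  atail (nth a0 p i.+1) = ahead (nth a0 p i).
Proof.
elim: p u i => [//|a p IHp] u [|i] /= /andP[_ ap]; last by move=> isz; apply: IHp ap _.
by case: p ap {IHp} => //= b p /andP[/eqP].
Qed.

Lemma rank_tail v : v != r -> (rank (atail (f v)) < rank v)%N.
Proof.
move=> vr; rewrite /rank (negPf vr) ltnS; case: eqP => // /eqP tr.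
have := index_hs v; case E: (index v hs) => [|i] isz.
  have t0 : atail (nth a0 P 0) = r by case: (P) rP isz => //= a p /andP[/eqP].
  by rewrite /f E t0 eqxx in tr.
have isz' : (i < size hs)%N by rewrite size_map; apply: ltnW.
rewrite /f E (ptv_nth rP isz) -(nth_map _ v) ?(ltnW isz) // ltnS.
rewrite -/hs leqNgt; apply/negP => lt_i.
by have := before_find v lt_i; rewrite /= eqxx.
Qed.

Lemma f_inj : injective f.
Proof. by move=> v w /(congr1 (@ahead Q)); rewrite !ahead_f. Qed.

Local Notation T := [set f v | v in [set~ r]].

(** By descending rank: the only tree arrow into v is [f v], and the tree arrows out of v end at
    higher rank, where z is known to be 0. So balanced functions are determined by their values on
    the d - n + 1 arrows outside the tree. *)
Lemma balanced_tree_zero (z : arr Q -> 'F_2) :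
  (forall v, \sum_(a | ahead a == v) z a = \sum_(a | atail a == v) z a) ->
  (forall a, a \notin T -> z a = 0) -> forall a, z a = 0.
Proof.
move=> bal zT.
have zf n v : v != r -> (size P < rank v + n)%N -> z (f v) = 0.
  elim: n v => [|n IHn] v vr; first by rewrite addn0 /rank (negPf vr) ltnNge index_hs.
  move=> rv; have := bal v; rewrite (bigD1 (f v)) /= ?ahead_f // big1 ?addr0 => [->|a]; last first.
    case/andP=> /eqP av af; apply: zT; apply/imsetP => -[w _ aw].
    by move: af; rewrite aw -av aw ahead_f eqxx.
  apply: big1 => a /eqP av; have [/imsetP[w]|/zT//] := boolP (a \in T).
  rewrite !inE => wr aw; rewrite aw; apply: (IHn _ wr).
  apply: leq_trans rv _; rewrite addnS -addSn leq_add2r -av aw.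
  exact: rank_tail.
move=> a; have [/imsetP[w]|/zT//] := boolP (a \in T).
by rewrite !inE => wr ->; apply: (zf (size P).+1) => //; rewrite addnS ltnS leq_addl.
Qed.

(** Closed paths have balanced arrow counts. More of them than there are arrows outside the tree
    satisfy a linear relation over F_2 there, hence on all arrows, and the support of this relation
    is the family. *)
Lemma even_subfamily L : all (fun c : loop => ptv c.1 c.2 c.1) L ->
  (#|arr Q| + 1 < size L + #|ver Q|)%N ->
  exists S S', [/\ perm_eq L (S ++ S'), S != [::] & evenL S].
Proof.
move=> clL szL; set N := ~: T.
have cN : (#|N| < size L)%N.
  have cT : #|T| = (#|ver Q| - 1)%N by rewrite (card_imset _ f_inj) cardsC1 subn1.
  have v0 : (0 < #|ver Q|)%N by apply/card_gt0P; exists r.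
  by have := cardsC T; rewrite cT -/N; move: szL v0; lia.
pose d : loop := (r, [::]).
pose cnt i (a : arr Q) : 'F_2 := (count_mem a (nth d L i).2)%:R.
pose M := \matrix_(i < size L, j < #|N|) cnt i (enum_val j).
have kM : kermx M != 0.
  rewrite kermx_eq0 /row_free; apply: contraTneq cN => <-.
  by rewrite -leqNgt rank_leq_col.
pose u := nz_row (kermx M).
have u0 : u != 0 by rewrite nz_row_eq0.
have uM : u *m M = 0 by apply/sub_kermxP; apply: nz_row_sub.
pose z a := \sum_i u 0 i * cnt i a.
have zN a : a \notin T -> z a = 0.
  move=> aT; have aN : a \in N by rewrite inE.
  have := congr1 (fun A : 'rV_(#|N|) => A 0 (enum_rank_in aN a)) uM.
  rewrite !mxE => <-; apply: eq_bigr => i _; rewrite mxE.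
  by rewrite enum_rankK_in.
have clN i : ptv (nth d L i).1 (nth d L i).2 (nth d L i).1.
  have [isz|isz] := ltnP i (size L); first by apply: (allP clL); apply: mem_nth.
  by rewrite nth_default //=.
have zbal v : \sum_(a | ahead a == v) z a = \sum_(a | atail a == v) z a.
  rewrite exchange_big [RHS]exchange_big; apply: eq_bigr => i _ /=.
  rewrite -!mulr_sumr -!natr_sum !sum_count_mem; congr (_ * _%:R).
  by have := ptv_balanced v (clN i) => /addIn.
have z0 := balanced_tree_zero zbal zN.
pose g (i : 'I_(size L)) := nth d L i.
exists [seq g i | i <- enum 'I_(size L) & u 0 i != 0], [seq g i | i <- enum 'I_(size L) & u 0 i == 0].
split.
- have {1}-> : L = [seq g i | i <- enum 'I_(size L)].
    by rewrite -{1}(mkseq_nth d L) /mkseq -val_enum_ord -map_comp.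
  rewrite -map_cat; apply: perm_map; rewrite perm_sym.
  rewrite (_ : [seq i <- _ | u 0 i == 0] =
     filter (predC (fun i => u 0 i != 0)) (enum 'I_(size L))) ?perm_filterC //.
  by apply: eq_filter => i /=; rewrite negbK.
- have /rV0Pn[i ui] := u0; apply/eqP => /(congr1 size); rewrite size_map.
  have : i \in [seq i <- enum 'I_(size L) | u 0 i != 0] by rewrite mem_filter ui mem_enum.
  by case: filter.
move=> a; rewrite -dvdn2 (dvdn_pcharf (pchar_Fp _)) //; apply/eqP.
transitivity (z a); last exact: z0.
rewrite /flat -map_comp count_flatten -map_comp sumnE big_map natr_sum big_filter big_enum_cond /=.
rewrite /z [RHS](bigID (fun i => u 0 i != 0)) /= [X in _ = _ + X]big1 ?addr0; last first.
  by move=> i /negPn/eqP ->; rewrite mul0r.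
apply: eq_bigr => i ui; suff -> : u 0 i = 1 by rewrite mul1r.
by case: (u 0 i) ui => -[|[|k]] // ksz _; apply: val_inj.
Qed.

End EvenSubfamily.
End CharTwoBound.

(** * Skeletons and bounds for the degrees of generators *)

Section DegreeBound.

Variable Q : quiver.

Local Notation path := (seq (arr Q)).
Local Notation loop := (ver Q * path)%type.
Implicit Types (p c : path) (u v w : ver Q) (L : seq loop).

Definition prim_bound m := forall u c, c != [::] -> ptv u c u -> heads_uniq c -> (size c <= m)%N.
Definition nvis p := size (undup (vis p)).

Lemma nvis_sub p q v : {subset vis p <= vis q} -> v \in vis q -> v \notin vis p ->
  (nvis p < nvis q)%N.
Proof.
move=> sub vq vp; have := @uniq_leq_size _ (v :: undup (vis p)) (undup (vis q)).
apply; first by rewrite /= mem_undup vp undup_uniq.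
by move=> w; rewrite inE !mem_undup => /predU1P[->|/sub].
Qed.

(* Loop erasure: p is equivalent to a skeleton K through all its vertices, with
   primitive closed paths inserted. *)
Lemma skeleton m p u : prim_bound m -> ptv u p u -> p != [::] ->
  exists K L, [/\ closed K, K != [::], vis K =i vis p, all (okl K) L & meq p (insl K L)] /\
   [/\ forall c : loop, c \in L -> c.2 != [::] /\ heads_uniq c.2
     & (size K <= m * maxn 1 (nvis p).-1)%N].
Proof.
move=> pm; have [n] := ubnP (size p); elim: n u p => // n IHn u p pn up p0.
have [pu|npu] := boolP (heads_uniq p).
  exists p, [::]; split; split=> //; first by exists u.
    exact: meq_refl.
  by rewrite (leq_trans (pm u p p0 up pu)) // leq_pmulr // leq_max.
have [p1 [c [p2 [v [pE p10 c0 cu [up1 vc vp2]]]]]] := primitive_cut up npu.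
have up' := ptv_cat up1 vp2; set p' := p1 ++ p2 in up'.
have p'0 : p' != [::] by rewrite /p'; case: (p1) p10.
have p'n : (size p' < n)%N.
  rewrite -ltnS; apply: leq_trans pn; rewrite ltnS pE !size_cat.
  by case: (c) c0 => //= a c' _; rewrite addSn addnS ltnS leq_add2l leq_addl.
have vp' : v \in vis p'.
  have vp21 : p2 ++ p1 != [::] by case: (p1) p10 (p2) => // a q _ [].
  by have := vis_end vp21 (ptv_cat vp2 up1); rewrite !vis_cat !mem_cat orbC.
have mins : meq p (ins (v, c) p') by rewrite pE; exact: (insP up1 vp2 vc vp').
have visc x : x \in vis c -> x \in vis p.
  by rewrite pE !vis_cat !mem_cat => ->; rewrite orbT.
have visp' x : x \in vis p' -> x \in vis p.
  by rewrite pE !vis_cat !mem_cat => /orP[]->; rewrite ?orbT.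
have vispP x : x \in vis p -> (x \in vis p') || (x \in vis c).
  by rewrite pE !vis_cat !mem_cat -!orbA => /or3P[]->; rewrite ?orbT.
have [K [L [[clK K0 visK okK mK] [primL szK]]]] := IHn u p' p'n up' p'0.
have okvc : okl K (v, c) by rewrite /okl /= vc visK.
have m1 : meq p (insl K ((v, c) :: L)).
  apply: meq_trans mins _; apply: (ins_meq mK _ vp' vc).
  by exists u.
(* If c visits no new vertex, it joins the inserted paths and the skeleton stays. *)
have [sub|nsub] := boolP (all (fun x => x \in vis p') (vis c)).
  have vE : vis p =i vis p'.
    by move=> x; apply/idP/idP => [/vispP/orP[//|/(allP sub)]|/visp'].
  exists K, ((v, c) :: L); split; split=> //.
  - by move=> x; rewrite visK vE.
  - by rewrite /= okvc.
  - by move=> d; rewrite inE => /predU1P[->|/primL].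
  suff -> : nvis p = nvis p' by [].
  by apply: perm_size; apply: uniq_perm; rewrite ?undup_uniq // => x; rewrite !mem_undup vE.
have /allPn[x xc xp'] := nsub.
have nvis_lt : (nvis p' < nvis p)%N by apply: nvis_sub visp' (visc _ xc) xp'.
have [nv2|nv1] := leqP 2 (nvis p').
  (* Here c visits a new vertex: it is absorbed into the skeleton, and its at most m arrows are paid
     for by the increase of [nvis]. *)
  exists (ins (v, c) K), L; split; split.
  - by case: clK => w wK; exists v; apply: ins_closed wK _ vc; rewrite visK.
  - by case: (c) c0.
  - move=> y; have -> : (y \in vis (ins (v, c) K)) = (y \in vis (c ++ K)).
      by apply: perm_mem; apply: perm_map; apply: ins_perm.
    rewrite vis_cat mem_cat visK; apply/orP/idP => [[/visc|/visp']//|/vispP/orP[]]; [right|left]; done.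
  - apply/allP => -[z d] /(allP okK)/andP[/= zd zK]; rewrite /okl /= zd.
    exact: ins_vis.
  - apply: meq_trans m1 _; have okall : all (okl K) ((v, c) :: L) by rewrite /= okvc.
    have pe : perm_eq ((v, c) :: L) (L ++ [:: (v, c)]) by rewrite perm_sym perm_catC.
    by have := sq_perm clK pe okall; rewrite /sq /insl foldr_cat.
  - exact: primL.
  have -> : size (ins (v, c) K) = (size c + size K)%N.
    by rewrite (perm_size (ins_perm _ _)) size_cat.
  apply: leq_trans (leq_add (pm v c c0 vc cu) szK) _.
  rewrite -mulnS leq_mul2l; apply/orP; right.
  move: nv2 nvis_lt; move: (nvis p) (nvis p'); clear; lia.
(* The rest p' stays at one vertex and consists of loops. Then c alone becomes the skeleton and the
   loops are inserted; absorbing c into the old skeleton would cost one primitive path too many. *)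
have [z zE] : exists z, undup (vis p') = [:: z].
  have : size (undup (vis p')) = 1%N.
    apply/eqP; rewrite eqn_leq -ltnS nv1 lt0n size_eq0.
    by apply: contraTneq vp' => E; rewrite -mem_undup E.
  by case: (undup _) => [//|z [|//]] _; exists z.
have vz y : y \in vis p' -> y = z by rewrite -mem_undup zE inE => /eqP.
have allv y : y \in vis p' -> y = v by move=> /vz ->; rewrite -(vz v vp').
have uv : u = v by apply: allv; apply: vis_end up'.
subst u; pose s := p2 ++ p1.
have sv a : a \in s -> atail a = v /\ ahead a = v.
  move=> sa; have pa : a \in p' by move: sa; rewrite !mem_cat orbC.
  by split; apply: allv; [apply: map_f | apply: closed_head up' pa].
have vc' : v \in vis c by apply: vis_end vc.
have vsx y : y \in vis s -> y = v by case/mapP => a /sv[av _] ->.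
exists c, [seq (v, [:: a]) | a <- s]; split; split=> //.
- by exists v.
- move=> y; apply/idP/idP => [/visc//|/vispP/orP[/allv->//|//]].
- by apply/allP => _ /mapP[a /sv[av ah] ->]; rewrite /okl /= av ah !eqxx.
- have rot_v q : q != [::] -> ptv v q v -> rot_to v q = q.
    by case: q => //= b q _ /andP[bv _]; rewrite /rot_to /= bv rot0.
  have ->: insl c [seq (v, [:: a]) | a <- s] = s ++ c.
    suff [] : insl c [seq (v, [:: a]) | a <- s] = s ++ c /\ ptv v (s ++ c) v by [].
    elim: s sv {vsx} => [//|a s IHs] sv /=.
    have [|-> vsc] := IHs; first by move=> b bs; apply: sv; rewrite inE bs orbT.
    have [av ah] := sv a (mem_head _ _).
    by rewrite /ins /= rot_v ?av ?ah ?eqxx //; case: (s); case: (c) c0.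
  rewrite pE; apply: meq_trans (meq_rot _ _) _; rewrite -catA.
  by have := meq_rot c (p2 ++ p1).
- by move=> _ /mapP[a _ ->].
by rewrite (leq_trans (pm v c c0 vc cu)) // leq_pmulr // leq_max.
Qed.

Variable K : fieldType.

Local Notation Rp := (arr Q -> 'M[K]_2).

Lemma dec_repeat p A q : 2%N \in [pchar K] -> meq p (A ++ A ++ q) ->
  A != [::] -> (exists u, ptv u A u /\ ptv u q u) -> dec (size p) (tp p : Rp -> K).
Proof.
move=> ch2 pA A0 [u [uA uq]].
have d1 := meq_dec ch2 pA; have := dec_sqr K uA uq A0; rewrite -(perm_size (meq_perm pA)) => d2.
by apply: (dec_ext _ (alg_add d1 d2)) => h; rewrite subrK.
Qed.

Lemma dec_char2 m u p : 2%N \in [pchar K] -> prim_bound m -> (1 < #|ver Q|)%N ->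
  (exists r P, [/\ P != [::], ptv r P r & forall v, v \in [seq ahead a | a <- P]]) ->
  ptv u p u -> (m * #|arr Q| < size p)%N -> dec (size p) (tp p : Rp -> K).
Proof.
move=> ch2 pm n2 [r [P [P0 rP Pall]]] up p_long.
have p0 : p != [::] by case: p p_long {up}.
have [S0 [L [[clS S00 visS okS mp] [primL szS]]]] := skeleton pm up p0.
have szp : size p = (size S0 + sumn [seq size d.2 | d <- L])%N.
  rewrite (perm_size (meq_perm mp)) (perm_size (insl_perm _ _)) size_cat addnC.
  by rewrite size_flatten /shape -map_comp.
have szL : (sumn [seq size d.2 | d <- L] <= m * size L)%N.
  elim: (L) okS primL => [//|c L' IH] /= /andP[/andP[cc _] okL'] prim.
  have [c0 cu] := prim c (mem_head _ _).
  rewrite mulnS leq_add ?(pm _ _ c0 cc cu) // IH // => d dL'.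
  by apply: prim; rewrite inE dL' orbT.
have nv : (nvis p <= #|ver Q|)%N.
  by rewrite /nvis -(card_uniqP (undup_uniq _)) max_card.
(* Comparing lengths gives d < max(1, [nvis p] - 1) + |L|, and for n > 1 the maximum is at most n -
   1. *)
have cL : (#|arr Q| + 1 < size L + #|ver Q|)%N.
  have : (m * #|arr Q| < m * (maxn 1 (nvis p).-1 + size L))%N.
    by apply: leq_trans p_long _; rewrite szp mulnDr leq_add.
  rewrite ltn_mul2l => /andP[_]; move: nv n2; clear; lia.
have clL : all (fun c : loop => ptv c.1 c.2 c.1) L.
  by apply/allP => c /(allP okS)/andP[].
have [a0 _] : exists a0, a0 \in P by case: (P) P0 => // a P' _; exists a; apply: mem_head.
have [S [S' [pe S1 evS]]] := even_subfamily a0 rP Pall clL cL.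
case: S S1 pe evS => [//|c1 S] _ pe evS.
have okall : all (okl S0) ((c1 :: S) ++ S') by rewrite -(perm_all _ pe).
have m2 : meq p (insl S0 ((c1 :: S) ++ S')).
  by apply: meq_trans mp _; apply: sq_perm.
(* Paths outside the even subfamily are absorbed into the skeleton, so that the family inserted into
   [S2] is even. *)
pose S2 := insl S0 S'.
have okS' : all (okl S0) S' by move: okall; rewrite all_cat => /andP[].
have [clS2 subS2] : closed S2 /\ {subset vis S0 <= vis S2} by apply: insl_closed.
have okS2 : all (okl S2) (c1 :: S).
  move: okall; rewrite all_cat => /andP[ok1 _]; apply/allP => d /(allP ok1)/andP[dd dS].
  by rewrite /okl dd subS2.
have m3 : meq p (insl S2 (c1 :: S)) by move: m2; rewrite /insl foldr_cat.
have c1L : c1 \in L by rewrite (perm_mem pe) mem_head.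
have [c10 c1u] := primL c1 c1L.
have [/= cc1 c1S] : ptv c1.1 c1.2 c1.1 /\ c1.1 \in vis S2 by case/andP: okS2 => /andP[].
have ik : inK S2 (c1 :: S).
  move=> a ac; apply: subS2; rewrite visS; apply: closed_head up _.
  by rewrite (perm_mem (meq_perm m3)) (perm_mem (insl_perm _ _)) mem_cat ac.
have uA : uniq c1.2 by apply: map_uniq c1u.
have subA : {subset c1.2 <= flat S}.
  move=> a ac; have := evS a; rewrite /flat /= count_cat (count_uniq_mem _ uA) ac oddD /=.
  by rewrite negbK => od; rewrite -has_pred1 has_count; case: count od.
(* [c1] stays as the first copy; by evenness its arrows occur again in the others, which supply the
   second copy. *)
have [L1 [okL1 peL1 sqL1]] := second_copy clS2 (R := [:: c1]) uA cc1 c1S okS2 evS ik subA.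
have m4 := meq_trans m3 sqL1.
have [[z zL1] subL1] := insl_closed clS2 okL1.
pose q := rot_to c1.1 (insl S2 L1).
have qcl : ptv c1.1 q c1.1.
  by have := ins_closed (c := [::]) zL1 (subL1 _ c1S) (eqxx _); rewrite /ins.
apply: (dec_repeat (A := c1.2) (q := q)) => //; last by exists c1.1.
suff <- : insl S2 ([:: c1] ++ (c1.1, c1.2) :: L1) = c1.2 ++ c1.2 ++ q by [].
rewrite /= {1}/ins; congr (_ ++ _); rewrite {1}/ins /= -/q.
by case: (c1.2) c10 cc1 => //= b c _ /andP[bc _]; rewrite /rot_to /= bc rot0.
Qed.

(** At a single vertex the estimate for the skeleton is too weak by one path. But there all arrows
    are loops, a path longer than d repeats one of them, and a swap brings the two copies
    together. *)
Lemma dec_one_vertex u p : 2%N \in [pchar K] -> #|ver Q| = 1%N ->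
  ptv u p u -> (#|arr Q| < size p)%N -> dec (size p) (tp p : Rp -> K).
Proof.
move=> ch2 n1 up p_long; have v1 (v w : ver Q) : v = w.
  by have /fintype_le1P := eq_leq n1; apply.
have loops q v : ptv v q v.
  elim: q v => [|a q IHq] v /=; first exact: eqxx.
  by rewrite (v1 (atail a) v) eqxx (v1 (ahead a) v) IHq.
have [pu|] := boolP (uniq p); first by have := max_card (mem p); rewrite (card_uniqP pu) leqNgt p_long.
have split2 : forall q : path, ~~ uniq q -> exists q1 a q2 q3, q = q1 ++ a :: q2 ++ a :: q3.
  elim=> [//|a q IHq] /=; rewrite negb_and negbK => /orP[aq|/IHq[q1 [b [q2 [q3 ->]]]]].
    by case/splitPr: aq => q2 q3; exists [::], a, q2, q3.
  by exists (a :: q1), b, q2, q3.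
move=> /split2[q1 [a [q2 [q3 pE]]]].
apply: (dec_repeat (A := [:: a]) (q := q3 ++ q1 ++ q2)) => //; last by exists u.
rewrite pE; apply: meq_trans (meq_rot _ _) _.
have := meq_swap (loops [:: a] u) (loops q2 u) (loops (a :: q3 ++ q1) u).
by rewrite /= ?catA /= ?cat_cons -?catA.
Qed.

(** N bounds the polynomial degree, which for a determinant is twice the length of the path. *)
Definition bgen N (f : Rp -> K) := exists u p, [/\ p != [::], ptv u p u
  & (f = tp p /\ (size p <= N)%N) \/ (f = dp p /\ (2 * size p <= N)%N)].

(** Determinants factor along primitive closed paths. Long traces are treated by strong induction on
    the length, since [dec] contains only shorter traces. *)
Lemma bounded_generation N :
  (forall u c, c != [::] -> ptv u c u -> heads_uniq c -> (2 * size c <= N)%N) ->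
  (forall u p, ptv u p u -> (N < size p)%N -> dec (size p) (tp p : Rp -> K)) ->
  forall f : Rp -> K, alg (@rgen K Q) f -> alg (bgen N) f.
Proof.
move=> primN longN.
have bd p u : ptv u p u -> alg (bgen N) (dp p).
  have [n] := ubnP (size p); elim: n u p => // n IHn u p pn up.
  have [->|p0] := eqVneq p [::].
    by apply: (alg_ext _ (alg_const _ (\det (1%:M : 'M[K]_2)))).
  have [pu|npu] := boolP (heads_uniq p).
    by apply: alg_gen; exists u, p; split=> //; right; split=> //; apply: (primN u).
  have [p1 [c [p2 [v [pE p10 c0 cu [up1 vc vp2]]]]]] := primitive_cut up npu.
  apply: (alg_ext (f := fun h => dp (p1 ++ p2) h * dp c h)).
    by move=> h; rewrite pE !dp_cat; ring.
  apply: alg_mul; last by apply: alg_gen; exists v, c; split=> //; right; split=> //; apply: (primN v).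
  apply: (IHn u) (ptv_cat up1 vp2); rewrite -ltnS; apply: leq_trans pn; rewrite ltnS pE !size_cat.
  by case: (c) c0 => //= a c' _; rewrite addSn addnS ltnS leq_add2l leq_addl.
have bt p u : ptv u p u -> alg (bgen N) (tp p).
  have [n] := ubnP (size p); elim: n u p => // n IHn u p pn up.
  have [->|p0] := eqVneq p [::].
    by apply: (alg_ext _ (alg_const _ (\tr (1%:M : 'M[K]_2)))).
  have [pN|Np] := leqP (size p) N; first by apply: alg_gen; exists u, p; split=> //; left.
  apply: alg_mono (longN u p up Np) => _ [v [q [q0 vq [[-> qp]|->]]]]; last exact: bd vq.
  by apply: (IHn v) vq; apply: leq_trans qp _; rewrite -ltnS.
move=> f; apply: alg_mono => _ [u [p [p0 up [->|->]]]]; [exact: bt up | exact: bd up].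
Qed.

End DegreeBound.

(** * Polynomials, functions and generating systems *)

Section MpolyFun.

Variable K : fieldType.
Hypothesis K_infinite : infinite_type K.

Lemma mpoly_fun0 n (p : {mpoly K[n]}) : (forall x, p.@[x] = 0) -> p = 0.
Proof.
move=> p0; apply/mpolyP => m0; rewrite mcoeff0.
(* The exponents are compared in one variable at a time, until only the monomial [m0] is left in the
   sum. *)
have step (s : seq 'I_n) (x : 'I_n -> K) :
    \sum_(m <- msupp p | all (fun i => m i == m0 i) s) p@_m * \prod_i x i ^+ m i = 0.
  elim: s x => [|k s IHs] x; first by rewrite -mevalE p0.
  rewrite (eq_bigl (fun m : 'X_{1..n} => all (fun i => m i == m0 i) s && (m k == m0 k))) /=; last first.
    by move=> m; rewrite andbC.
  rewrite big_mkcondl /=; apply/esym.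
  apply: (@separate_weights _ K_infinite _ _ (fun m : 'X_{1..n} => m k)
    (fun m : 'X_{1..n} => if all (fun i => m i == m0 i) s then p@_m * \prod_i x i ^+ m i else 0)) => c nz_c.
  rewrite mulr0 -[RHS](IHs (fun i => if i == k then c * x i else x i)) [RHS]big_mkcond /=.
  apply: eq_bigr => m _; case: ifP => _; last by rewrite mulr0.
  rewrite (bigD1 k) //= [in RHS](bigD1 k) //= eqxx exprMn mulrCA -!mulrA.
  by do 3!congr (_ * _); apply: eq_bigr => i /negPf ->.
have := step (enum 'I_n) (fun=> 1); rewrite (eq_bigl (pred1 m0)); last first.
  move=> m; apply/allP/eqP => [E|-> //]; apply/mnmP => i.
  by apply/eqP/E; rewrite mem_enum.
rewrite (eq_bigr (fun m => p@_m)) => [|m _]; last first.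
  by rewrite big1 ?mulr1 // => i _; rewrite expr1n.
have [m0p|] := boolP (m0 \in msupp p); last by move/memN_msupp_eq0.
by rewrite big_mkcond (bigD1_seq m0) ?msupp_uniq //= eqxx big1 ?addr0 // => m /negPf ->.
Qed.

Lemma mpoly_fun_inj n (p q : {mpoly K[n]}) : (forall x, p.@[x] = q.@[x]) -> p = q.
Proof.
by move=> pq; apply/eqP; rewrite -subr_eq0; apply/eqP/mpoly_fun0 => x; rewrite mevalB pq subrr.
Qed.

Lemma mpoly_homog n (p : {mpoly K[n]}) k :
  (forall c x, c != 0 -> p.@[fun i => c * x i] = c ^+ k * p.@[x]) -> p \is k.-homog.
Proof.
move=> hp; rewrite homog_piE; apply/eqP/mpoly_fun_inj => x.
rewrite pihomogE rmorph_sum /=; apply/esym.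
under eq_bigr => m _ do rewrite mevalZ mevalX.
apply: (@separate_weights _ K_infinite _ _ (fun m : 'X_{1..n} => mdeg m)) => c nz_c.
rewrite -hp // mevalE; apply: eq_bigr => m _; rewrite mulrCA; congr (_ * _).
by rewrite mdegE -prodrXr -big_split; apply: eq_bigr => i _; rewrite exprMn.
Qed.

Variable Q : quiver.
Local Notation Rp := (arr Q -> 'M[K]_2).
Local Notation cring := (coord_ring K (@dim2 Q)).
Implicit Types (f g : cring) (h : Rp) (F : Rp -> K).

Definition cidx (a : arr Q) (i j : 'I_2) : 'I_#|coord_index (@dim2 Q)| :=
  enum_rank (Tagged (fun a => 'I_(dim2 (ahead a)) * 'I_(dim2 (atail a)))%type
    ((i, j) : 'I_(dim2 (ahead a)) * 'I_(dim2 (atail a)))).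

Definition of_coords (x : 'I_#|coord_index (@dim2 Q)| -> K) : Rp :=
  fun a => \matrix_(i, j) x (cidx a i j).

Lemma of_coordsK x : coords (of_coords x : rep K (@dim2 Q)) =1 x.
Proof.
move=> k; rewrite /coords mxE -[in RHS](enum_valK k); congr (x (enum_rank _)).
by case: (enum_val k) => a [i j].
Qed.

Definition fn f : Rp -> K := fun h => f.@[coords (h : rep K (@dim2 Q))].

Lemma fn_inj f g : fn f =1 fn g -> f = g.
Proof.
move=> fg; apply: mpoly_fun_inj => x.
by rewrite -(meval_eq f (of_coordsK x)) -(meval_eq g (of_coordsK x)); apply: fg.
Qed.

Lemma fn_falg f : falg (fn f).
Proof.
rewrite /fn; apply: alg_ext (fun h => esym (mevalE _ _)) _.
apply: alg_sum => m _; apply: alg_scale; apply: alg_prod => i _; apply: alg_exp.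
exact: falg_entry.
Qed.

Lemma falg_mpoly F : falg F -> exists f, fn f =1 F.
Proof.
elim=> [_ [a [i [j ->]]]|c|G H _ [g gG] _ [k kH]|G H _ [g gG] _ [k kH]|G H GH _ [g gG]].
- exists 'X_(cidx a i j).
  by move=> h; rewrite /fn mevalXU /coords enum_rankK.
- by exists c%:MP => h; rewrite /fn mevalC.
- by exists (g + k) => h; rewrite /fn mevalD -/(fn g h) -/(fn k h) gG kH.
- by exists (g * k) => h; rewrite /fn mevalM -/(fn g h) -/(fn k h) gG kH.
- by exists g => h; rewrite gG GH.
Qed.

Lemma fn_homog f k : (forall c h, c != 0 -> fn f (fun a => c *: h a) = c ^+ k * fn f h) ->
  f \is k.-homog.
Proof.
move=> hf; apply: mpoly_homog => c x nz_c.
rewrite -[in RHS](meval_eq f (of_coordsK x)) -[RHS]hf //; apply: meval_eq => k'.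
by rewrite -[in LHS](of_coordsK x) /coords [in RHS]mxE.
Qed.

End MpolyFun.

(** * Minimal generating systems and the number D *)

Section Generators.

Variables (K : fieldType) (Q : quiver).
Hypothesis K_infinite : infinite_type K.

Local Notation Rp := (arr Q -> 'M[K]_2).
Local Notation cring := (coord_ring K (@dim2 Q)).
Implicit Types (f g : cring) (h : Rp) (F : Rp -> K) (p : seq (arr Q)).

Lemma falg_pmat p i j : falg (fun h => pmat h p i j).
Proof.
elim: p i j => [|a p IHp] i j /=; first by apply: (alg_const _ ((1%:M : 'M[K]_2) i j)).
apply: (alg_ext (f := fun h => \sum_k pmat h p i k * h a k j)) => [h|]; first by rewrite mxE.
by apply: alg_sum => k _; apply: alg_mul; [apply: IHp | apply: falg_entry].
Qed.

Lemma pmat_gl u p v (g : ver Q -> 'M[K]_2) h : (forall v, g v \in unitmx) -> ptv u p v ->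
  pmat (gl_act g h) p = g v *m pmat h p *m invmx (g u).
Proof.
move=> gu; elim: p u => [|a p IHp] u /=; first by move/eqP->; rewrite mulmx1 mulmxV.
by case/andP => /eqP <- /IHp ->; rewrite /gl_act !mulmxA mulmxKV.
Qed.

Lemma pmat_scale c h p : pmat (fun a => c *: h a) p = c ^+ size p *: pmat h p.
Proof.
elim: p => [|a p IHp] /=; first by rewrite expr0 scale1r.
by rewrite IHp -scalemxAl -scalemxAr scalerA exprS mulrC.
Qed.

Lemma tp_ginv u p : ptv u p u -> @ginv K Q (tp p).
Proof.
by move=> up g h gu; rewrite /tp (pmat_gl h gu up) mxtrace_mulC mulmxA mulVmx ?mul1mx.
Qed.

Lemma dp_ginv u p : ptv u p u -> @ginv K Q (dp p).
Proof.
move=> up g h gu; rewrite /dp (pmat_gl h gu up) !det_mulmx mulrC mulrA -det_mulmx mulVmx //.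
by rewrite det1 mul1r.
Qed.

Lemma tp_falg p : @falg K Q (tp p).
Proof. by apply: alg_sum => i _; apply: falg_pmat. Qed.

Lemma dp_falg p : @falg K Q (dp p).
Proof.
apply: alg_ext (fun h => esym (det_mx2 _)) _.
by apply: alg_sub; apply: alg_mul; apply: falg_pmat.
Qed.

Definition inv_upto B f := invariant f /\ exists2 k, (k <= B)%N & f \is k.-homog.

Lemma bgen_mpoly B F : bgen B F -> exists2 f, inv_upto B f & fn f =1 F.
Proof.
case=> u [p [_ up [[-> pB]|[-> pB]]]].
  have [f fE] := falg_mpoly (tp_falg p); exists f => //; split.
    by move=> g h gu; have := tp_ginv up h gu; rewrite -!fE.
  exists (size p) => //; apply: (fn_homog K_infinite) => c h _.
  by rewrite !fE /tp pmat_scale mxtraceZ.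
have [f fE] := falg_mpoly (dp_falg p); exists f => //; split.
  by move=> g h gu; have := dp_ginv up h gu; rewrite -!fE.
exists (2 * size p)%N => //; apply: (fn_homog K_infinite) => c h _.
by rewrite !fE /dp pmat_scale detZ mulnC exprM.
Qed.

(** There are finitely many paths of length at most B; whether each gives a generator is decided
    classically. *)
Lemma bgen_list B : exists s : seq cring, (forall f, f \in s -> inv_upto B f) /\
  forall F, bgen B F -> exists2 f, f \in s & fn f =1 F.
Proof.
suff E (P : seq (seq (arr Q))) : exists s : seq cring, (forall f, f \in s -> inv_upto B f) /\
    forall F p, p \in P -> F = tp p \/ F = dp p -> bgen B F -> exists2 f, f \in s & fn f =1 F.
  have [s [sB sP]] := E (flatten [seq [seq val t | t : k.-tuple (arr Q)] | k <- iota 0 B.+1]).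
  exists s; split=> // F bF; have [u [p [p0 _ H]]] := bF.
  apply: (sP F p _ _ bF); last by case: H => -[-> _]; [left | right].
  apply/flatten_mapP; exists (size p); last by apply/mapP; exists (in_tuple p); rewrite ?mem_enum.
  rewrite mem_iota /= add0n ltnS; case: H => -[_] //.
  by apply: leq_trans; rewrite leq_pmull.
elim: P => [|p P [s [sB sP]]]; first by exists [::].
have add1 (s1 : seq cring) F1 : (forall f, f \in s1 -> inv_upto B f) ->
    exists s2 : seq cring, [/\ forall f, f \in s2 -> inv_upto B f, {subset s1 <= s2}
      & bgen B F1 -> exists2 f, f \in s2 & fn f =1 F1].
  move=> s1B; have [bF|nF] := Classical_Prop.classic (bgen B F1).
    have [f fB fE] := bgen_mpoly bF; exists (f :: s1); split=> [g|g gs|_].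
    - by rewrite inE => /predU1P[->|/s1B].
    - by rewrite inE gs orbT.
    by exists f; rewrite ?mem_head.
  by exists s1; split=> // /nF.
have [s1 [s1B ss1 s1p]] := add1 s (tp p) sB; have [s2 [s2B s12 s2p]] := add1 s1 (dp p) s1B.
exists s2; split=> // F q; rewrite inE => /predU1P[->|qP] FE bF.
  case: FE bF => -> bF; last exact: s2p.
  by have [f fs fF] := s1p bF; exists f => //; apply: s12.
by have [f fs fF] := sP F q qP FE bF; exists f => //; apply/s12/ss1.
Qed.

Lemma subalg_gen_sub (S S' : cring -> Prop) : (forall f, S f -> subalg_gen S' f) ->
  forall f, subalg_gen S f -> subalg_gen S' f.
Proof.
move=> SS' f; elim=> [g /SS'//|c|g k _ Ig _ Ik|g k _ Ig _ Ik].
- exact: subalg_gen_const.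
- exact: subalg_gen_add.
- exact: subalg_gen_mul.
Qed.

Lemma subalg_gen_invariant (S : cring -> Prop) : (forall f, S f -> invariant f) ->
  forall f, subalg_gen S f -> invariant f.
Proof.
move=> SS' f; elim=> [g /SS'//|c|g k _ Ig _ Ik|g k _ Ig _ Ik] g' h' gu.
- by rewrite !mevalC.
- by rewrite !mevalD Ig ?Ik.
- by rewrite !mevalM Ig ?Ik.
Qed.

Definition generated_upto B := exists s : seq cring,
  (forall f, f \in s -> inv_upto B f) /\ generates_invariants (fun f => f \in s).

Lemma generated_upto_bgen B : (forall F, alg (@rgen K Q) F -> alg (bgen B) F) -> generated_upto B.
Proof.
move=> rb; have [s [sB sP]] := bgen_list B; exists s; split=> // f; split.
  by apply: subalg_gen_invariant => g /sB[].
move=> fi; have := rb _ (first_fundamental_theorem K_infinite (fn_falg f) fi).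
suff E F : alg (bgen B) F -> exists2 g, subalg_gen (fun f => f \in s) g & fn g =1 F.
  by move=> /E[g gs gf]; rewrite -(fn_inj K_infinite gf).
elim=> [G /sP[g gs gG]|c|G H _ [g gs gG] _ [k ks kH]|G H _ [g gs gG] _ [k ks kH]|G H GH _ [g gs gG]].
- by exists g => //; apply: subalg_gen_in.
- by exists c%:MP; [apply: subalg_gen_const | move=> h; rewrite /fn mevalC].
- exists (g + k); first exact: subalg_gen_add.
  by move=> h; rewrite /fn mevalD -/(fn g h) -/(fn k h) gG kH.
- exists (g * k); first exact: subalg_gen_mul.
  by move=> h; rewrite /fn mevalM -/(fn g h) -/(fn k h) gG kH.
- by exists g => // h; rewrite gG GH.
Qed.

Lemma minimal_sublist (s : seq cring) : generates_invariants (fun f => f \in s) ->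
  exists s' : seq cring, [/\ {subset s' <= s}, generates_invariants (fun f => f \in s')
    & forall S' : cring -> Prop, (forall f, S' f -> f \in s') -> generates_invariants S' ->
      forall f, f \in s' -> S' f].
Proof.
have [n] := ubnP (size s); elim: n s => // n IHn s sn gs.
have [[g [gin gg]]|ng] := Classical_Prop.classic
    (exists g, g \in s /\ generates_invariants (fun f => f \in [seq x <- s | x != g])).
  have [|s' [s's gs' ms']] := IHn _ _ gg.
    rewrite -ltnS; apply: leq_trans sn; rewrite ltnS size_filter -(count_predC (pred1 g) s).
    by rewrite -[X in (X < _)%N]add0n ltn_add2r -has_count has_pred1.
  by exists s'; split=> // f /s's; rewrite mem_filter => /andP[].
exists s; split=> // S' S's gS' f fs; apply: Classical_Prop.NNPP => nf; apply: ng.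
exists f; split=> // f'; split.
  move=> H; apply/gs; apply: subalg_gen_sub H => g.
  by rewrite mem_filter => /andP[_ ?]; apply: subalg_gen_in.
move=> /gS'; apply: subalg_gen_sub => g Sg; apply: subalg_gen_in.
by rewrite mem_filter S's // andbT; apply: contra_notN nf => /eqP <-.
Qed.

Lemma homog_deg_le k B f : (k <= B)%N -> f \is k.-homog -> ((msize f).-1 <= B)%N.
Proof.
move=> kB; have [->|f0] := eqVneq f 0; first by rewrite msize0.
by move=> fk; have <- := dhomog_uniq f0 fk (dhomog_msize fk).
Qed.

Lemma is_D_exists B : generated_upto B -> exists D, is_D K (@dim2 Q) D /\ (D <= B)%N.
Proof.
case=> s [sB gs]; have [s' [s's gs' ms']] := minimal_sublist gs.
have deg_le f : f \in s' -> ((msize f).-1 <= B)%N.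
  by move=> /s's/sB[_ [k kB fk]]; apply: homog_deg_le fk.
exists (\max_(f <- s') (msize f).-1)%N; split; last by apply/bigmax_leqP_seq => f fs _; apply: deg_le.
exists (fun f => f \in s'); split.
  by split=> // f /s's/sB[_ [k _ fk]]; exists k.
split=> [k [f [fs <-]]|N' N'P]; first exact: (@leq_bigmax_seq _ s' xpredT (fun f => (msize f).-1) f fs).
by apply/bigmax_leqP_seq => f fs _; apply: N'P; exists f.
Qed.

Lemma is_D_generated N : is_D K (@dim2 Q) N ->
  forall f, invariant f -> subalg_gen (inv_upto N) f.
Proof.
case=> S [[gS hS _] [ubN _]] f /gS; apply: subalg_gen_sub => g Sg; apply: subalg_gen_in.
split; first by apply/gS; apply: subalg_gen_in.
have [k gk] := hS g Sg; have [->|g0] := eqVneq g 0; first by exists 0%N; rewrite ?rpred0.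
by exists (msize g).-1; [apply: ubN; exists g | apply: dhomog_msize gk].
Qed.

(** Degrees add in products, so a component of degree at most B involves no generator of larger
    degree. *)
Lemma pihomog_subalg (S : cring -> Prop) B : (forall f, S f -> exists k, f \is k.-homog) ->
  forall f, subalg_gen S f -> forall k, (k <= B)%N ->
    subalg_gen (fun g => S g /\ ((msize g).-1 <= B)%N) (pihomog mdeg k f).
Proof.
move=> hS; pose S' (g : cring) := S g /\ ((msize g).-1 <= B)%N.
have S0 : subalg_gen S' 0 by rewrite -(mpolyC0 _ K); apply: subalg_gen_const.
have Ssum (I : Type) (r : seq I) (G : I -> cring) :
    (forall i, subalg_gen S' (G i)) -> subalg_gen S' (\sum_(i <- r) G i).
  move=> GS; elim: r => [|i r IHr]; first by rewrite big_nil.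
  by rewrite big_cons; apply: subalg_gen_add.
move=> f; elim=> [g Sg|c|g g' _ Ig _ Ig'|g g' _ Ig _ Ig'] k kB.
- have [e ge] := hS g Sg; have [ek|ek] := eqVneq e k.
    subst e; rewrite pihomog_dE //; apply: subalg_gen_in; split=> //.
    exact: homog_deg_le ge.
  by rewrite (pihomog_ne0 _ ge).
- have c0 : (c%:MP : cring) \is 0.-homog.
    apply/dhomogP => m; rewrite msuppC; case: eqP => // _; rewrite inE => /eqP ->.
    exact: mdeg0.
  have [<-|k0] := eqVneq 0%N k; first by rewrite pihomog_dE //; apply: subalg_gen_const.
  by rewrite (pihomog_ne0 k0 c0).
- by rewrite pihomogD; apply: subalg_gen_add; [apply: Ig | apply: Ig'].
- rewrite (pihomog_partitionE (leqnn (msize g))) (pihomog_partitionE (leqnn (msize g'))).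
  rewrite mulr_suml linear_sum; apply: (Ssum) => i; rewrite mulr_sumr linear_sum; apply: (Ssum) => j /=.
  have ij : pihomog mdeg i g * pihomog mdeg j g' \is (i + j).-homog.
    by apply: dhomogM; apply: pihomogP.
  have [ijk|ijk] := eqVneq (i + j)%N k; last by rewrite (pihomog_ne0 ijk ij).
  rewrite -ijk pihomog_dE //; apply: subalg_gen_mul; [apply: Ig | apply: Ig'].
    by apply: leq_trans kB; rewrite -ijk leq_addr.
  by apply: leq_trans kB; rewrite -ijk leq_addl.
Qed.

(** In any minimal system the elements of degree at most B already generate, so by minimality there
    are no others. The bound therefore does not depend on the system that witnesses [is_D]. *)
Lemma is_D_le B N : generated_upto B -> is_D K (@dim2 Q) N -> (N <= B)%N.
Proof.
move=> [s [sB gs]] [S [[gS hS mS] [_ lubN]]]; apply: lubN => _ [f [Sf <-]].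
apply: (proj2 (mS (fun g => S g /\ ((msize g).-1 <= B)%N) _ _ f Sf)) => [g []//|g]; split.
  by apply: subalg_gen_invariant => k [Sk _]; apply/gS; apply: subalg_gen_in.
move/gs; apply: subalg_gen_sub => k /sB[ki [e eB ke]].
by rewrite -(pihomog_dE ke); apply: pihomog_subalg => //; apply/gS.
Qed.

End Generators.

(** * Indecomposable invariants *)

Section Indecomposable.

Variables (K : fieldType) (Q : quiver).
Hypothesis K_infinite : infinite_type K.

Local Notation Rp := (arr Q -> 'M[K]_2).
Local Notation cring := (coord_ring K (@dim2 Q)).
Implicit Types (f g : cring) (h : Rp) (F : Rp -> K) (del : arr Q -> nat).

Lemma falg_line F (h h' : Rp) : falg F ->
  exists P : {poly K}, forall c, F (fun a => h a + c *: h' a) = P.[c].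
Proof.
elim=> [_ [a [i [j ->]]]|c|G H _ [P GP] _ [R HR]|G H _ [P GP] _ [R HR]|G H GH _ [P GP]].
- by exists ((h a i j)%:P + h' a i j *: 'X) => c; rewrite !mxE !hornerE mulrC.
- by exists c%:P => c'; rewrite hornerC.
- by exists (P + R) => c; rewrite hornerD GP HR.
- by exists (P * R) => c; rewrite hornerM GP HR.
- by exists P => c; rewrite -GH.
Qed.

Lemma rhom_all F a k : falg F -> rhom a k F -> forall c h, F (rscm a c h) = c ^+ k * F h.
Proof.
move=> pF Fk c h.
have [P PE] := falg_line (fun b => if b == a then 0 else h b) (fun b => if b == a then h b else 0) pF.
have PE' c' : P.[c'] = F (rscm a c' h).
  rewrite -PE; apply: falg_ext_arg => // b; rewrite /rscm.
  by case: eqP => _; rewrite ?add0r // scaler0 addr0.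
rewrite -PE'; suff -> : P = F h *: 'X^k by rewrite !hornerE mulrC.
apply/eqP; rewrite -subr_eq0; apply/eqP/(poly_fun0_nz K_infinite) => c' nz_c.
by rewrite !hornerE PE' Fk // mulrC subrr.
Qed.

Lemma rhom_scale F del (c : arr Q -> K) h : falg F -> (forall a, rhom a (del a) F) ->
  F (fun a => c a *: h a) = (\prod_a c a ^+ del a) * F h.
Proof.
move=> pF Fd.
have E (s : seq (arr Q)) : uniq s ->
    F (fun a => if a \in s then c a *: h a else h a) = (\prod_(a <- s) c a ^+ del a) * F h.
  elim: s => [|a s IHs] /=; first by rewrite big_nil mul1r.
  case/andP => nas /IHs E; rewrite big_cons -mulrA -E -(rhom_all pF (Fd a)).
  apply: falg_ext_arg => // b; rewrite /rscm inE; case: eqP => //= ->.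
  by rewrite (negPf nas).
rewrite -big_enum -E ?enum_uniq //; apply: falg_ext_arg => // a.
by rewrite mem_enum.
Qed.

Variable hs : Rp.

Definition at_weights (x : 'I_#|arr Q| -> K) : Rp := fun a => x (enum_rank a) *: hs a.
(** G is F on the point [hs] with each arrow scaled separately; its coefficients are the values at
    [hs] of the multihomogeneous components of F. *)
Definition restr F (G : {mpoly K[#|arr Q|]}) := forall x, G.@[x] = F (at_weights x).
Definition mdel del : 'X_{1..#|arr Q|} := [multinom del (enum_val i) | i < #|arr Q|].

Definition vanish del := forall F, falg F -> ginv F -> (forall a, rhom a (del a) F) -> F hs = 0.

Lemma restr_exists F : falg F -> exists G, restr F G.
Proof.
elim=> [_ [a [i [j ->]]]|c|H H' _ [P GP] _ [R HR]|H H' _ [P GP] _ [R HR]|H H' HH _ [P GP]].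
- by exists (hs a i j *: 'X_(enum_rank a)) => x; rewrite mevalZ mevalXU mxE mulrC.
- by exists c%:MP => x; rewrite mevalC.
- by exists (P + R) => x; rewrite mevalD GP HR.
- by exists (P * R) => x; rewrite mevalM GP HR.
- by exists P => x; rewrite -HH.
Qed.

Lemma restr_rhom F del : falg F -> (forall a, rhom a (del a) F) ->
  restr F (F hs *: 'X_[mdel del]).
Proof.
move=> pF Fd x; rewrite mevalZ mevalX /at_weights.
rewrite (rhom_scale (fun a => x (enum_rank a)) hs pF Fd) mulrC; congr (_ * _).
rewrite (reindex (@enum_val (arr Q) (arr Q))) /=; last first.
  by apply: onW_bij; apply: enum_val_bij.
by apply: eq_bigr => i _; rewrite mnmE enum_valK.
Qed.

Lemma restr_inj F G G' : restr F G -> restr F G' -> G = G'.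
Proof. by move=> FG FG'; apply: (mpoly_fun_inj K_infinite) => x; rewrite FG FG'. Qed.

Lemma vanish_coef F (m : 'X_{1..#|arr Q|}) G : vanish (fun a => m (enum_rank a)) -> falg F -> ginv F ->
  restr F G -> G@_m = 0.
Proof.
move=> vm pF iF FG; suff [G' FG' G'0] : exists2 G, restr F G & G@_m = 0.
  by rewrite (restr_inj FG FG').
apply: (multigraded_ind K_infinite
  (P := fun F => exists2 G, restr F G & G@_m = 0)) pF iF =>
  {F FG} [F F' FF' [G' FG Gm]||F F' [G1 FG1 G1m] [G2 FG2 G2m]|F del pF iF Fd].
- by exists G' => // x; rewrite FG.
- by exists 0; rewrite ?mcoeff0 // => x; rewrite meval0.
- by exists (G1 + G2); rewrite ?mcoeffD ?G1m ?G2m ?addr0 // => x; rewrite mevalD FG1 FG2.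
exists (F hs *: 'X_[mdel del]); first exact: restr_rhom.
rewrite mcoeffZ mcoeffX; case: eqP => [dm|]; last by rewrite mulr0.
by rewrite vm ?mul0r // => a; rewrite -dm mnmE enum_rankK.
Qed.

Lemma homog_coef f k G (m : 'X_{1..#|arr Q|}) : f \is k.-homog -> restr (fn f) G -> mdeg m != k -> G@_m = 0.
Proof.
move=> fk fG mk.
suff /dhomogP Gk : G \is k.-homog.
  by apply: memN_msupp_eq0; apply: contra mk => /Gk ->.
apply: (mpoly_homog K_infinite) => c x _; rewrite !fG /fn !mevalE mulr_sumr.
apply: eq_big_seq => m' m'f; rewrite mulrCA; congr (_ * _).
have /dhomogP fk' := fk; have <- : mdeg m' = k by apply: fk'.
rewrite mdegE -prodrXr -big_split; apply: eq_bigr => i _.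
rewrite -[RHS]exprMn.
by congr (_ ^+ _); rewrite /coords /at_weights mxE [in RHS]mxE mulrA.
Qed.

(** The coefficient at [mdel del] vanishes on everything generated in degrees at most N, if N is
    smaller than the total degree: on generators by degree, on constants since [del] is nonzero, on
    products since each splitting of [del] has a factor that vanishes at [hs]. On T it does not
    vanish. *)
Lemma degree_lower_bound del (T : cring) N : invariant T ->
  (forall a, rhom a (del a) (fn T)) -> fn T hs != 0 ->
  (forall al be : arr Q -> nat, (forall a, al a + be a = del a)%N ->
     (exists a, al a != 0%N) -> (exists a, be a != 0%N) -> vanish al \/ vanish be) ->
  is_D K (@dim2 Q) N -> (\sum_a del a <= N)%N.
Proof.
move=> iT Td nzT van DN; rewrite leqNgt; apply/negP => ltN.
have dE : mdeg (mdel del) = (\sum_a del a)%N.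
  rewrite mdegE [RHS](reindex (@enum_val (arr Q) (arr Q))) /=; last first.
    by apply: onW_bij; apply: enum_val_bij.
  by apply: eq_bigr => i _; rewrite mnmE.
have d0 : mdel del != 0%MM by rewrite -mdeg_eq0 dE -lt0n (leq_ltn_trans _ ltN).
suff E f : subalg_gen (inv_upto N) f -> [/\ invariant f & forall G, restr (fn f) G -> G@_(mdel del) = 0].
  have [_ /(_ _ (restr_rhom (fn_falg T) Td))] := E T (is_D_generated DN iT).
  by rewrite mcoeffZ mcoeffX eqxx mulr1 => /eqP; rewrite (negPf nzT).
elim=> [g [ig [k kN gk]]|c|g g' _ [ig Ig] _ [ig' Ig']|g g' _ [ig Ig] _ [ig' Ig']].
- split=> // G gG; apply: homog_coef gk gG _.
  by rewrite dE gtn_eqF // (leq_ltn_trans kN).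
- split=> [g h gu|G cG]; first by rewrite !mevalC.
  rewrite (restr_inj cG (G' := c%:MP)) => [|x]; last by rewrite /fn !mevalC.
  by rewrite mcoeffC (negPf d0) mulr0.
- split=> [h h' hu|G GE]; first by rewrite !mevalD ig ?ig'.
  have [P gP] := restr_exists (fn_falg g); have [P' gP'] := restr_exists (fn_falg g').
  rewrite (restr_inj GE (G' := P + P')) => [|x]; last by rewrite /fn !mevalD gP gP'.
  by rewrite mcoeffD (Ig _ gP) (Ig' _ gP') addr0.
split=> [h h' hu|G GE]; first by rewrite !mevalM ig ?ig'.
have [P gP] := restr_exists (fn_falg g); have [P' gP'] := restr_exists (fn_falg g').
rewrite (restr_inj GE (G' := P * P')) => [|x]; last by rewrite /fn !mevalM gP gP'.
rewrite mcoeffM big1 // => -[m1 m2] /= /eqP; move: (bmnm m1) (bmnm m2) => {}m1 {}m2 dm.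
have [m10|m10] := eqVneq m1 0%MM.
  by rewrite m10 add0m in dm; rewrite -dm (Ig' _ gP') mulr0.
have [m20|m20] := eqVneq m2 0%MM.
  by rewrite m20 addm0 in dm; rewrite -dm (Ig _ gP) mul0r.
have nz (m : 'X_{1..#|arr Q|}) : m != 0%MM -> exists a, m (enum_rank a) != 0%N.
  rewrite -mdeg_eq0 mdegE sum_nat_eq0 negb_forall => /existsP[i /=].
  by exists (enum_val i); rewrite enum_valK.
have [|v1|v2] := van (fun a => m1 (enum_rank a)) (fun a => m2 (enum_rank a)) _ (nz _ m10) (nz _ m20).
- by move=> a; rewrite -mnmDE -dm mnmE enum_rankK.
- by rewrite (vanish_coef v1 (fn_falg g) ig gP) mul0r.
- by rewrite (vanish_coef v2 (fn_falg g') ig' gP') mulr0.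
Qed.

End Indecomposable.

(** * The line quiver *)

Section ClosedPaths.

Variable Q : quiver.
Implicit Types (a : arr Q) (p q : seq (arr Q)) (u v : ver Q).

Lemma ptv_cons u a q v :
  ptv u (a :: q) v = [&& atail a == u, path (@composable Q) a q & ahead (last a q) == v].
Proof.
elim: q u a => [|b q IHq] u a //=; move: (IHq (ahead a) b) => /= ->.
by rewrite /composable [ahead a == _]eq_sym !andbA.
Qed.

Lemma closed_pathP p : closed_path p <-> p != [::] /\ exists u, ptv u p u.
Proof.
case: p => [|a q]; first by split=> [|[]].
rewrite /closed_path [cycle _ _]/= rcons_path andTb /composable; split=> [/andP[aq al]|[_ [u]]].
  by split=> //; exists (atail a); rewrite ptv_cons eqxx aq.
by rewrite ptv_cons => /and3P[/eqP <- -> /eqP ->] /=.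
Qed.

Lemma pmat_rscm (K : fieldType) a (c : K) h p :
  pmat (rscm a c h) p = c ^+ count_mem a p *: pmat h p.
Proof.
elim: p => [|b p IHp] /=; first by rewrite scale1r.
rewrite IHp /rscm eq_sym; case: eqP => _ /=; last by rewrite add0n -scalemxAl.
by rewrite -scalemxAl -scalemxAr scalerA exprS mulrC.
Qed.

End ClosedPaths.

(** * The quiver, its primitive closed paths, the tour and the laps *)

Section LineQuiver.

Variables n m N : nat.
Hypotheses (m_gt0 : (0 < m)%N) (m_le : (m <= n.+1)%N).

(** There are n + 1 vertices. The second loops [lpe] at the two ends make up for the missing
    neighbours, so that the tour leaves each vertex exactly three times, as the upper bound
    allows. *)
Definition line_arr : finType := (('I_n + 'I_n) + ('I_n.+1 + bool) + 'I_N)%type.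

Definition fwd (i : 'I_n) : line_arr := inl (inl (inl i)).
Definition bwd (i : 'I_n) : line_arr := inl (inl (inr i)).
Definition lpv (v : 'I_n.+1) : line_arr := inl (inr (inl v)).
Definition lpe (b : bool) : line_arr := inl (inr (inr b)).
Definition back (j : 'I_N) : line_arr := inr j.

Definition line_head (a : line_arr) : 'I_n.+1 :=
  match a with
  | inl (inl (inl i)) => lift ord0 i
  | inl (inl (inr i)) => widen_ord (leqnSn n) i
  | inl (inr (inl v)) => v
  | inl (inr (inr b)) => if b then ord_max else ord0
  | inr _ => ord0
  end.

Definition line_tail (a : line_arr) : 'I_n.+1 :=
  match a with
  | inl (inl (inl i)) => widen_ord (leqnSn n) i
  | inl (inl (inr i)) => lift ord0 i
  | inl (inr (inl v)) => v
  | inl (inr (inr b)) => if b then ord_max else ord0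
  | inr _ => inord m.-1
  end.

Definition lineq : quiver := Quiver line_head line_tail.

Lemma card_line_arr : #|arr lineq| = (3 * n + 3 + N)%N.
Proof. by rewrite /= !card_sum !card_ord card_bool; lia. Qed.

(** Indexing by naturals permits recursion on k; the loop returned out of range is an arbitrary
    default. *)
Definition fwdn i : arr lineq := if insub i is Some k then fwd k else lpv ord0.
Definition bwdn i : arr lineq := if insub i is Some k then bwd k else lpv ord0.

Lemma fwdnE i (lt_i : (i < n)%N) : fwdn i = fwd (Ordinal lt_i).
Proof. by rewrite /fwdn insubT. Qed.

Lemma bwdnE i (lt_i : (i < n)%N) : bwdn i = bwd (Ordinal lt_i).
Proof. by rewrite /bwdn insubT. Qed.

Fixpoint up k : seq (arr lineq) :=
  if k is k'.+1 then up k' ++ [:: fwdn k'; lpv (inord k)] else [::].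
Fixpoint climb k : seq (arr lineq) :=
  if k is k'.+1 then climb k' ++ [:: fwdn k'] else [::].
Fixpoint down k : seq (arr lineq) :=
  if k is k'.+1 then bwdn k' :: down k' else [::].

Definition tour : seq (arr lineq) :=
  [:: lpe false; lpv ord0] ++ up n ++ lpe true :: down n.

Lemma lift0_inord i (lt_i : (i < n)%N) : lift ord0 (Ordinal lt_i) = inord i.+1 :> 'I_n.+1.
Proof. by apply: val_inj; rewrite /= inordK. Qed.

Lemma widen_inord i (lt_i : (i < n)%N) : widen_ord (leqnSn n) (Ordinal lt_i) = inord i :> 'I_n.+1.
Proof. by apply: val_inj; rewrite /= inordK // ltnW. Qed.

Lemma inord0 : inord 0 = ord0 :> 'I_n.+1.
Proof. by apply: val_inj; rewrite /= inordK. Qed.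

Lemma inord_max : inord n = ord_max :> 'I_n.+1.
Proof. by apply: val_inj; rewrite /= inordK. Qed.

Lemma ptv_up k : (k <= n)%N -> @ptv lineq ord0 (up k) (inord k).
Proof.
elim: k => [|k IHk] kn /=; first by rewrite inord0.
apply: ptv_cat (IHk (ltnW kn)) _; rewrite /= fwdnE /= widen_inord eqxx lift0_inord.
by rewrite !eqxx.
Qed.

Lemma ptv_climb k : (k <= n)%N -> @ptv lineq ord0 (climb k) (inord k).
Proof.
elim: k => [|k IHk] kn /=; first by rewrite inord0.
by apply: ptv_cat (IHk (ltnW kn)) _; rewrite /= fwdnE /= widen_inord !eqxx lift0_inord /=.
Qed.

Lemma ptv_down k : (k <= n)%N -> @ptv lineq (inord k) (down k) ord0.
Proof.
elim: k => [|k IHk] kn /=; first by rewrite inord0.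
by rewrite bwdnE /= widen_inord lift0_inord eqxx IHk // ltnW.
Qed.

Lemma ptv_tour : @ptv lineq ord0 tour ord0.
Proof.
rewrite /tour /=; apply: ptv_cat (ptv_up (leqnn n)) _.
by rewrite /= inord_max eqxx -inord_max; apply: ptv_down.
Qed.

Lemma count_up k a : (k <= n)%N -> count_mem a (up k) =
  match a : line_arr with
  | inl (inl (inl i)) => (i < k)%N : nat
  | inl (inr (inl v)) => (0 < v <= k)%N : nat
  | _ => 0%N
  end.
Proof.
elim: k => [|k IHk] kn; first by case: a => [[[]|[[[|v]]|]]|].
rewrite /= count_cat IHk ?(ltnW kn) //= fwdnE.
case: a {IHk} => [[[i|i]|[v|b]]|j] //=; rewrite ?addn0 ?add0n.
  have -> : (fwd (Ordinal kn) == inl (inl (inl i))) = (k == i :> nat) by [].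
  by move: (nat_of_ord i); clear; lia.
have -> : (lpv (inord k.+1) == inl (inr (inl v))) = (k.+1 == v :> nat).
  by rewrite -[LHS]/(inord k.+1 == v) -val_eqE /= inordK.
by move: (nat_of_ord v); clear; lia.
Qed.

Lemma count_down k a : (k <= n)%N -> count_mem a (down k) =
  (if a : line_arr is inl (inl (inr i)) then (i < k)%N else 0%N : nat).
Proof.
elim: k => [|k IHk] kn; first by case: a => [[[]|[[[|v]]|]]|].
rewrite /= IHk ?(ltnW kn) //= bwdnE.
case: a {IHk} => [[[i|i]|[v|b]]|j] //=; rewrite ?addn0 ?add0n.
have -> : (bwd (Ordinal kn) == inl (inl (inr i))) = (k == i :> nat) by [].
by move: (nat_of_ord i); clear; lia.
Qed.

Lemma count_tour a : count_mem a tour = (if a : line_arr is inr _ then 0 else 1)%N.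
Proof.
rewrite /tour !count_cat /= count_up // count_down //.
case: a => [[[i|i]|[[[|v] lt_v]|[]]]|j] //=; rewrite ?ltn_ord //.
by move: lt_v; rewrite ltnS => ->.
Qed.

Lemma size_tour : size tour = (3 * n.+1)%N.
Proof.
have su k : size (up k) = (2 * k)%N by elim: k => //= k IHk; rewrite size_cat IHk /=; clear; lia.
have sd k : size (down k) = k by elim: k => //= k ->.
by rewrite /tour !size_cat /= su sd; clear; lia.
Qed.

Lemma tour_heads v : v \in [seq ahead a | a <- tour].
Proof.
apply/mapP; exists (lpv v) => //.
by rewrite -has_pred1 has_count count_tour.
Qed.

Lemma line_strongly_connected : strongly_connected lineq.
Proof.
left; exists tour; split; last exact: tour_heads.
by apply/closed_pathP; split=> //; exists ord0; apply: ptv_tour.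
Qed.

(** If all heads are below m, there are at most m of them. Otherwise the path enters its highest
    vertex from below and, as [back] arrows start at m - 1, must return at once to where it came
    from, so its length is 2. A loop of length 1 is excluded there only by the size being compared
    with m. *)
Lemma line_prim_bound : (n = 0 \/ 1 < m)%N -> prim_bound lineq m.
Proof.
move=> nm u p p0 up pu.
have [b0 b0p] : exists b0, b0 \in p by case: (p) p0 => // b q _; exists b; apply: mem_head.
have [e ep emax] : exists2 e, e \in p & forall b, b \in p -> (line_head b <= line_head e)%N.
  case: (@arg_maxnP _ b0 (fun b => b \in p) (fun b => line_head b : nat) b0p) => e ep emax.
  by exists e.
have [tm|tm] := ltnP (line_head e) m.
  rewrite -(size_map (@ahead lineq)) -(card_uniqP pu) -(card_ord m).
  pose f (v : 'I_n.+1) : 'I_m := insubd (Ordinal tm) (v : nat).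
  have fi : {in [seq ahead a | a <- p] &, injective f}.
    move=> _ _ /mapP[b bp ->] /mapP[c cp ->] /(congr1 val).
    have lt d : d \in p -> (line_head d < m)%N by move=> dp; apply: leq_ltn_trans (emax d dp) tm.
    by rewrite !insubdK ?unfold_in ?lt //; apply: val_inj.
  by rewrite -(card_in_image fi) max_card.
have [i q pE] := seq.rot_to ep.
have [w wp] : exists w, ptv w (e :: q) w.
  rewrite -pE /rot; move: up; rewrite -{1}(cat_take_drop i p) => /ptv_catP[w h1 h2].
  by exists w; apply: ptv_cat h1.
have qu : uniq [seq ahead a | a <- e :: q] by rewrite -pE map_rot rot_uniq.
have emax' b : b \in e :: q -> (line_head b <= line_head e)%N by rewrite -pE mem_rot; apply: emax.
have -> : size p = size (e :: q) by rewrite -pE size_rot.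
case: q {pE} wp qu emax' => [//|f r] wp qu emax'.
have [ew fe fr] : [/\ line_tail e = w, line_tail f = line_head e & @ptv lineq (line_head f) r w].
  by move: wp => /= /and3P[/eqP -> /eqP -> ->].
have wr : w \in [seq line_head b | b <- f :: r].
  have : @ptv lineq (line_tail f) (f :: r) w by rewrite /= eqxx.
  by rewrite ptv_cons => /and3P[_ _ /eqP <-]; apply/map_f/mem_last.
have ne : line_head e \notin [seq line_head b | b <- f :: r] by case/andP: qu.
have lw : (w <= line_head e)%N.
  by case/mapP: wr => b bfr ->; apply: emax'; rewrite inE bfr orbT.
have ef : line_head f != line_head e by apply: contraNneq ne => <-; apply: mem_head.
have lf : (line_head f <= line_head e)%N by apply: emax'; rewrite !inE eqxx orbT.
have hf : line_head f = w.
  move: tm ew fe ne lw ef lf wr; clear -m_gt0 m_le.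
  case: e => [[[i|i]|[v|b]]|j] /= tm ew fe ne lw ef lf wr; subst w.
  - case: f fe ef lf {ne wr} => [[[k|k]|[v|b]]|j] /= fe ef lf.
    + by have := congr1 val fe; move: lf; rewrite /= /bump /=; lia.
    + by apply: val_inj; have := congr1 val fe; rewrite /= /bump /=; lia.
    + by rewrite fe eqxx in ef.
    + by rewrite fe eqxx in ef.
    + have := congr1 val fe; rewrite /= /bump /= inordK; last by lia.
      by move: tm; rewrite /= /bump; lia.
  - by move: lw; rewrite /= /bump /=; lia.
  - by rewrite wr in ne.
  - by rewrite wr in ne.
  - by move: tm; rewrite /=; lia.
case: r fr qu {emax' ne wr wp} => [_ _|b r fr /= /and3P[_ + _]] /=.
  case: nm => // n0; have := ltn_ord (line_head e); move: (nat_of_ord _) tm m_gt0 n0; clear; lia.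
have : @ptv lineq (line_tail b) (b :: r) w.
  by move: fr => /= /andP[/eqP -> ->]; rewrite eqxx.
by rewrite ptv_cons => /and3P[_ _ /eqP wE]; rewrite hf -wE (map_f (@ahead lineq) (mem_last b r)).
Qed.

Lemma map_head_climb k : (k <= n)%N ->
  [seq line_head a | a <- climb k] = [seq inord i.+1 | i <- iota 0 k].
Proof.
elim: k => [//|k IHk] kn; rewrite -[in RHS](addn1 k) iotaD [RHS]map_cat -(IHk (ltnW kn)) [LHS]/= map_cat.
by rewrite /= fwdnE /= lift0_inord add0n.
Qed.

Lemma size_climb k : size (climb k) = k.
Proof. by elim: k => //= k IHk; rewrite size_cat IHk addn1. Qed.

Lemma m1n : (m.-1 <= n)%N. Proof. by rewrite -ltnS prednK. Qed.

Lemma ptv_lap j : @ptv lineq (inord m.-1) (back j :: climb m.-1) (inord m.-1).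
Proof. by rewrite /= eqxx /=; apply: (ptv_climb m1n). Qed.

Lemma lap_primitive j : heads_uniq (Q := lineq) (back j :: climb m.-1).
Proof.
rewrite /heads_uniq /= (map_head_climb m1n); apply/andP; split.
  apply/mapP => -[i]; rewrite mem_iota add0n => /andP[_ im] /(congr1 val) /=.
  by rewrite inordK // ltnS (leq_trans im m1n).
rewrite map_inj_in_uniq ?iota_uniq // => i k; rewrite !mem_iota !add0n => /andP[_ im] /andP[_ km].
move/(congr1 val); rewrite /= !inordK ?ltnS ?(leq_trans _ m1n) //.
by case.
Qed.

Lemma line_class : (0 < N)%N -> (n = 0 \/ 1 < m)%N -> quiver_class n.+1 (3 * n + 3 + N) m lineq.
Proof.
move=> N0 nm; split.
- exact: line_strongly_connected.
- by rewrite card_ord.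
- exact: card_line_arr.
split=> [|k [p [/andP[/closed_pathP[p0 [u up]] pu] <-]]]; last exact: (line_prim_bound nm p0 up).
exists (back (Ordinal N0) :: climb m.-1); split; last by rewrite /= size_climb prednK.
apply/andP; split; last exact: lap_primitive.
by apply/closed_pathP; split=> //; exists (inord m.-1); apply: ptv_lap.
Qed.

Definition laps : seq (arr lineq) := flatten [seq back j :: climb m.-1 | j <- enum 'I_N].

Lemma ptv_laps : @ptv lineq (inord m.-1) laps (inord m.-1).
Proof.
rewrite /laps; elim: (enum _) => [|j s IHs]; first exact: eqxx.
exact: ptv_cat (ptv_lap j) IHs.
Qed.

Lemma size_laps : size laps = (m * N)%N.
Proof.
rewrite /laps -[in RHS](size_enum_ord N); elim: (enum _) => [|j s IHs]; first by rewrite muln0.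
by rewrite /= size_cat IHs size_climb /= mulnS; case: m m_gt0.
Qed.

Lemma count_climb k a : (k <= n)%N -> count_mem a (climb k) =
  (if a : line_arr is inl (inl (inl i)) then (i < k)%N else 0%N : nat).
Proof.
elim: k => [|k IHk] kn; first by case: a => [[[]|[[[|v]]|]]|].
rewrite /= count_cat IHk ?(ltnW kn) //= fwdnE.
case: a {IHk} => [[[i|i]|[v|b]]|j] //=; rewrite ?addn0 ?add0n.
have -> : (fwd (Ordinal kn) == inl (inl (inl i))) = (k == i :> nat) by [].
by move: (nat_of_ord i); clear; lia.
Qed.

Lemma count_laps a : count_mem a laps =
  match a : line_arr with
  | inr _ => 1%N
  | inl (inl (inl i)) => (N * (i < m.-1))%N
  | _ => 0%N
  end.
Proof.
rewrite /laps count_flatten -map_comp.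
have E (s : seq 'I_N) : sumn [seq (count_mem a \o (fun j => back j :: climb m.-1)) j | j <- s] =
    (if a : line_arr is inr j then count_mem j s else size s * count_mem a (climb m.-1))%N.
  elim: s => [|j s IHs] /=; first by case: a.
  by rewrite IHs; case: a {IHs} => [a|k] /=; rewrite ?mulSn ?add0n // (count_climb _ m1n) addn0.
rewrite E (count_climb _ m1n) size_enum_ord; case: a {E} => [[[i|i]|[v|b]]|j]; rewrite ?muln0 //.
by rewrite (count_uniq_mem _ (enum_uniq _)) mem_enum.
Qed.

End LineQuiver.

(** * Torus elements, coordinate swaps and linearity in one arrow *)

Section Gauge.

Variables (K : fieldType) (Q : quiver).
Hypothesis K_infinite : infinite_type K.

Local Notation Rp := (arr Q -> 'M[K]_2).
Implicit Types (h : Rp) (F : Rp -> K) (del : arr Q -> nat) (t : ver Q -> bool -> K).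

Lemma invmx_unique (A B : 'M[K]_2) : A *m B = 1%:M -> invmx A = B.
Proof.
move=> AB; have [uA _] := mulmx1_unit AB.
by rewrite -[LHS]mulmx1 -AB mulmxA mulVmx ?mul1mx.
Qed.

(** A group element that acts on h by scalars on the arrows equates F h with a multiple of itself,
    so F h = 0 unless the factor is 1. *)
Lemma gauge_eq F del (g : ver Q -> 'M[K]_2) h c : falg F -> ginv F ->
  (forall a, rhom a (del a) F) -> (forall v, g v \in unitmx) ->
  gl_act g h =1 (fun a => c a *: h a) -> F h = (\prod_a c a ^+ del a) * F h.
Proof.
move=> pF iF Fd gu gh; rewrite -(rhom_scale K_infinite c h pF Fd) -[LHS](iF g h gu).
exact: falg_ext_arg.
Qed.

Definition torus t v : 'M[K]_2 := diag_mx (\row_j t v (i2b j)).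

Lemma torus_inv t v : (forall v b, t v b != 0) ->
  torus t v *m torus (fun v b => (t v b)^-1) v = 1%:M.
Proof.
move=> nzt; rewrite /torus mul_diag_mx; apply/matrixP => i j; rewrite !mxE.
by case: eqP => [->|_]; rewrite ?mulr1n ?mulr0n ?mulr0 // divff.
Qed.

Lemma torus_unit t v : (forall v b, t v b != 0) -> torus t v \in unitmx.
Proof. by move=> nzt; case: (mulmx1_unit (torus_inv v nzt)). Qed.

Lemma gl_act_torus t h a i j : (forall v b, t v b != 0) ->
  gl_act (torus t) h a i j = t (ahead a) (i2b i) * h a i j / t (atail a) (i2b j).
Proof.
by move=> nzt; rewrite /gl_act (invmx_unique (torus_inv _ nzt)) mul_mx_diag mul_diag_mx !mxE.
Qed.

Definition swap_mx : 'M[K]_2 := \matrix_(i, j) (i != j)%:R.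

Lemma swap_mxK : swap_mx *m swap_mx = 1%:M.
Proof.
apply: eq_mx2 => i j; rewrite !mxE sum_I2 !mxE.
by case: i; case: j; rewrite /= ?mulr0 ?mul0r ?mulr1 ?addr0 ?add0r.
Qed.

Lemma swap_unit : swap_mx \in unitmx.
Proof. by case: (mulmx1_unit swap_mxK). Qed.

Lemma swap_conj (A : 'M[K]_2) i j :
  (swap_mx *m A *m invmx swap_mx) (b2i i) (b2i j) = A (b2i (~~ i)) (b2i (~~ j)).
Proof.
rewrite (invmx_unique swap_mxK) !mxE sum_I2 !mxE !sum_I2 !mxE.
by case: i; case: j; rewrite /= ?(mulr0, mul0r, mulr1, mul1r, addr0, add0r).
Qed.

Definition upd_arr h a (A : 'M[K]_2) : Rp := fun b => if b == a then A else h b.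

(** With cA put at a, F is a constant plus l(A) c plus terms of order c ^+ 2, where l is additive by
    induction over F. Degree one leaves only l. *)
Lemma rhom1_additive F a h A B : falg F -> rhom a 1 F ->
  F (upd_arr h a (A + B)) = F (upd_arr h a A) + F (upd_arr h a B).
Proof.
move=> pF F1.
have [k [l [lD lE]]] : exists k (l : 'M[K]_2 -> K), (forall A B, l (A + B) = l A + l B) /\
    forall A, exists q : {poly K}, forall c, F (upd_arr h a (c *: A)) = (k%:P + l A *: 'X + 'X^2 * q).[c].
  elim: pF => [_ [b [i [j ->]]]|c|G G' _ [k [l [lD lE]]] _ [k' [l' [lD' lE']]]
    |G G' _ [k [l [lD lE]]] _ [k' [l' [lD' lE']]]|G G' GG _ [k [l [lD lE]]]].
  - exists (if b == a then 0 else h b i j), (fun A => if b == a then A i j else 0).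
    split=> [A' B'|A']; first by case: eqP; rewrite ?mxE ?addr0.
    exists 0 => c; rewrite /upd_arr mulr0 !hornerE; case: eqP => _; last by rewrite mul0r addr0.
    by rewrite mxE add0r mulrC.
  - exists c, (fun=> 0); split=> [A' B'|A']; first by rewrite addr0.
    by exists 0 => c'; rewrite !hornerE; ring.
  - exists (k + k'), (fun A => l A + l' A); split=> [A' B'|A']; first by rewrite lD lD'; ring.
    have [[q qE] [q' qE']] := (lE A', lE' A').
    by exists (q + q') => c; rewrite qE qE' !hornerE /=; ring.
  - exists (k * k'), (fun A => k * l' A + k' * l A); split=> [A' B'|A']; first by rewrite lD lD'; ring.
    have [[q qE] [q' qE']] := (lE A', lE' A').
    exists ((l A' * l' A')%:P + k%:P * q' + k'%:P * q + l A' *: 'X * q' + l' A' *: 'X * q + 'X^2 * q * q').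
    by move=> c; rewrite qE qE' !hornerE /=; ring.
  - exists k, l; split=> // A'; have [q qE] := lE A'; exists q => c; by rewrite -GG.
suff E A' : F (upd_arr h a A') = l A' by rewrite !E lD.
have [q qE] := lE A'.
have : k%:P + l A' *: 'X + 'X^2 * q = F (upd_arr h a A') *: 'X.
  apply/eqP; rewrite -subr_eq0; apply/eqP/(poly_fun0_nz K_infinite) => c nz_c.
  rewrite hornerD hornerN -qE hornerZ hornerX; apply/eqP; rewrite subr_eq0 mulrC; apply/eqP.
  rewrite -[in RHS](expr1 c) -F1 //; apply: falg_ext_arg => // b.
  by rewrite /upd_arr /rscm; case: eqP.
move/(congr1 (fun p : {poly K} => p`_1)).
by rewrite !coefD coefC !coefZ coefX coefXnM /= addr0 add0r !mulr1 => ->.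
Qed.

End Gauge.

(** * Vanishing at the point of the tour *)

Section LineVanishing.

Variables (K : fieldType) (n m N : nat).
Hypothesis K_infinite : infinite_type K.

Local Notation L := (lineq n m N).
Local Notation Rp := (arr L -> 'M[K]_2).
Local Notation e0 := (lpe n N false : arr L).
Implicit Types (F : Rp -> K) (al del : arr L -> nat) (a b : arr L).

Definition row_st (a : arr L) : bool :=
  match (a : line_arr n N) with inl (inl (inr _)) => true | inl (inr (inr b)) => b | _ => false end.
Definition col_st (a : arr L) : bool :=
  match (a : line_arr n N) with inl (inl (inr _)) => true | inl (inr (inr b)) => ~~ b | _ => false end.
Definition is_lpv (a : arr L) : bool := if (a : line_arr n N) is inl (inr (inl _)) then true else false.
Definition is_back (a : arr L) : bool := if (a : line_arr n N) is inr _ then true else false.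

(* The arrows other than the loops [lpv v] become matrix units moving the
   coordinate vectors (v, e1), (v, e2) along a single cycle of length 2 n + 2,
   in the order given by [pos]. *)
Definition tour_pt : Rp := fun a =>
  if is_back a then 0 else if is_lpv a then \matrix_(i, j) ((i == j)%:R * (-1) ^+ i2b i)
  else \matrix_(i, j) ((i2b i == row_st a) && (i2b j == col_st a))%:R.

Definition pos (v : ver L) (b : bool) : nat := (if b then n.*2.+1 - v else v)%N.

Lemma pos_succ a : ~~ is_back a -> ~~ is_lpv a -> a != e0 ->
  pos (ahead a) (row_st a) = (pos (atail a) (col_st a)).+1 /\
  (pos (atail a) (col_st a) < n.*2.+1)%N.
Proof.
case: a => [[[i|i]|[v|[]]]|j] //= _ _ _; rewrite /pos /= /bump /= ?add1n.
- by have := ltn_ord i; move: (nat_of_ord i); clear; lia.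
- by have := ltn_ord i; move: (nat_of_ord i); clear; lia.
- by clear; lia.
Qed.

Lemma pos_inj a b : ~~ is_back a -> ~~ is_lpv a -> ~~ is_back b -> ~~ is_lpv b ->
  pos (atail a) (col_st a) = pos (atail b) (col_st b) -> a = b.
Proof.
have lt := ltn_ord.
case: a b => [[[i|i]|[v|[]]]|j] // [[[k|k]|[w|[]]]|l] //= _ _ _ _; rewrite /pos /= /bump /= ?add1n => H //.
- by congr (inl (inl (inl _))); apply: val_inj.
- by have := lt _ i; have := lt _ k; move: H; move: (nat_of_ord i) (nat_of_ord k); clear; lia.
- by have := lt _ i; move: H; move: (nat_of_ord i); clear; lia.
- by have := lt _ i; move: H; move: (nat_of_ord i); clear; lia.
- by have := lt _ i; have := lt _ k; move: H; move: (nat_of_ord i) (nat_of_ord k); clear; lia.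
- congr (inl (inl (inr _))); apply: val_inj.
  by have := lt _ i; have := lt _ k; move: H; rewrite /=; move: (nat_of_ord i) (nat_of_ord k); clear; lia.
- by have := lt _ i; move: H; move: (nat_of_ord i); clear; lia.
- by have := lt _ i; move: H; move: (nat_of_ord i); clear; lia.
- by have := lt _ k; move: H; move: (nat_of_ord k); clear; lia.
- by have := lt _ k; move: H; move: (nat_of_ord k); clear; lia.
- by move: H; clear; lia.
- by have := lt _ k; move: H; move: (nat_of_ord k); clear; lia.
- by have := lt _ k; move: H; move: (nat_of_ord k); clear; lia.
- by move: H; clear; lia.
Qed.

(** The torus element equal to c up to the position where x starts and to 1 beyond it rescales only
    x and the closing arrow [lpe false] of the cycle, by inverse factors; hence their degrees
    agree. *)
Lemma tour_pt_degrees F al x : falg F -> ginv F -> (forall a, rhom a (al a) F) ->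
  F tour_pt != 0 -> ~~ is_back x -> ~~ is_lpv x -> al x = al e0.
Proof.
move=> pF iF Fd nzF xb xl; have [-> //|xe] := eqVneq x e0.
have [hx tx] := pos_succ xb xl xe; set k := pos (atail x) _ in hx tx.
have key (c : K) : c != 0 -> c ^+ al x = c ^+ al e0.
  move=> nz_c; pose t (v : ver L) (b : bool) : K := if (pos v b <= k)%N then c else 1.
  have nzt v (b : bool) : t v b != 0 by rewrite /t; case: ifP => _; rewrite ?oner_neq0.
  pose s a := if a == x then c^-1 else if a == e0 then c else 1.
  have sE : gl_act (torus t) tour_pt =1 (fun a => s a *: tour_pt a).
    move=> a; apply/matrixP => i j; rewrite gl_act_torus // [RHS]mxE /tour_pt.
    have [ab|ab] := boolP (is_back a); first by rewrite !mxE !mulr0 mul0r.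
    have [al1|al1] := boolP (is_lpv a).
      have -> : s a = 1.
        rewrite /s; case: eqP => [ax|_]; first by rewrite -ax al1 in xl.
        by case: eqP => // ae; rewrite ae in al1.
      rewrite !mxE; have [->|_] := eqVneq i j; last by rewrite !mul0r !mulr0 mul0r.
      have -> : ahead a = atail a by case: (a) al1 => [[[|]|[v|]]|].
      by rewrite !mul1r mulrAC divff ?nzt // mul1r.
    rewrite !mxE; have [ri|] := eqVneq (i2b i); last by rewrite !mulr0 mul0r.
    have [cj|] := eqVneq (i2b j); last by rewrite !mulr0 mul0r.
    rewrite !mulr1 ri cj /s; have [ae|ae] := eqVneq a e0.
      rewrite ae; have -> : (e0 == x) = false by rewrite eq_sym (negPf xe).
      by rewrite /t /pos /= subn0 (leqNgt n.*2.+1) tx /= divr1.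
    have [ha ta] := pos_succ ab al1 ae; rewrite /t ha.
    have [->|ax] := eqVneq a x; first by rewrite -/k ltnn leqnn mul1r.
    have : pos (atail a) (col_st a) != k.
      by apply: contraNneq ax => pk; apply/eqP; apply: pos_inj.
    by rewrite [(_ < k)%N]ltn_neqAle => ->; case: ifP => _; rewrite divff ?oner_neq0.
  have := gauge_eq K_infinite pF iF Fd (fun v => torus_unit v nzt) sE.
  rewrite (bigD1 x) //= (bigD1 e0) //=; last by rewrite eq_sym.
  rewrite big1 => [|a /andP[ax ae]]; last by rewrite /s (negPf ax) (negPf ae) expr1n.
  rewrite /s !eqxx (eq_sym e0) (negPf xe) mulr1 -[LHS]mul1r => /(mulIf nzF) /esym E.
  by apply: (mulfI (expf_neq0 (al x) (invr_neq0 nz_c))); rewrite E -exprMn mulVf ?expr1n.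
have sep i j : (forall c : K, c != 0 -> c ^+ i = c ^+ j) -> (i <= j)%N.
  move=> cij; rewrite leqNgt; apply/negP => ji.
  have ij0 : (0 < i - j)%N by rewrite subn_gt0.
  have [c [nz_c /eqP[]]] := exists_nonroot K_infinite ij0.
  by apply: (mulfI (expf_neq0 j nz_c)); rewrite -exprD subnKC ?(ltnW ji) // mulr1 cij.
by apply/eqP; rewrite eqn_leq !sep // => c nz_c; rewrite key.
Qed.

(** An invariant that misses [lpe false] misses the whole cycle and involves only the loops [lpv],
    whose matrices are diag(1, -1). Swapping coordinates at one vertex negates one of them, in which
    the degree is 1, so the value equals its negative. *)
Lemma vanish_tour al : 2%N \notin [pchar K] -> (forall a, (al a <= 1)%N) ->
  (forall a, is_back a -> al a = 0%N) -> al e0 = 0%N -> (exists a, al a != 0%N) ->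
  vanish tour_pt al.
Proof.
move=> ch2 al1 alb al0 [a0 na0] F pF iF Fd; apply/eqP; apply: contraT => nzF.
have reg0 a : ~~ is_lpv a -> al a = 0%N.
  have [ab|ab] := boolP (is_back a); first by rewrite alb.
  by move=> na; rewrite (tour_pt_degrees pF iF Fd nzF ab na).
have a0l : is_lpv a0 by apply: contraNT na0 => /reg0 ->.
have ala0 : al a0 = 1%N by case: (al a0) na0 (al1 a0) => [|[]].
pose c a : K := (is_lpv a)%:R; pose h0 : Rp := fun a => c a *: tour_pt a.
have h0E : F h0 = F tour_pt.
  rewrite (rhom_scale K_infinite _ _ pF Fd) big1 ?mul1r // => a _; rewrite /c.
  by have [_|/reg0 ->] := boolP (is_lpv a); rewrite ?expr1n.
pose g (v : ver L) : 'M[K]_2 := if v == ahead a0 then @swap_mx K else 1%:M.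
have gu v : g v \in unitmx by rewrite /g; case: ifP => _; rewrite ?unitmx1 ?swap_unit.
have gh : gl_act g h0 =1 (fun a => (if a == a0 then -1 else 1) *: h0 a).
  move=> a; rewrite /h0 /c; have [la|la] := boolP (is_lpv a); last first.
    by rewrite /gl_act (negPf la) scale0r mulmx0 mul0mx scaler0.
  have ha : ahead a = atail a by case: (a) la => [[[|]|[v|]]|].
  have hinj : (ahead a == ahead a0) = (a == a0).
    by case: (a) (a0) la a0l => [[[|]|[v|]]|] // [[[|]|[w|]]|].
  rewrite /gl_act -ha /g hinj la scale1r; have [aa|_] := eqVneq a a0; last first.
    by rewrite mul1mx invmx1 mulmx1 scale1r.
  apply: eq_mx2 => i j; rewrite swap_conj [RHS]mxE /tour_pt.
  have -> : is_back a = false by case: (a) la => [[[|]|[v|]]|].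
  by rewrite la !mxE; case: i; case: j; rewrite /= ?expr1 ?expr0; ring.
have := gauge_eq K_infinite pF iF Fd gu gh.
rewrite (bigD1 a0) //= eqxx ala0 big1 => [|a /negPf ->]; last by rewrite expr1n.
rewrite mulr1 h0E expr1 mulN1r => /eqP; rewrite -addr_eq0 -mulr2n -mulr_natl mulf_eq0 (negPf nzF) orbF.
by move=> two0; case/negP: ch2; rewrite inE /= two0.
Qed.

End LineVanishing.

(** * Lower bounds from the tour and the laps *)

Section LineDegrees.

Variables (K : fieldType) (n m N : nat).
Hypothesis K_infinite : infinite_type K.
Hypotheses (m_gt0 : (0 < m)%N) (m_le : (m <= n.+1)%N).

Local Notation L := (lineq n m N).
Local Notation Rp := (arr L -> 'M[K]_2).
Implicit Types (F : Rp -> K) (al del : arr L -> nat) (a b : arr L).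

Lemma tp_rhom a p : rhom a (count_mem a p) (tp p : Rp -> K).
Proof. by move=> c h _; rewrite /tp pmat_rscm mxtraceZ. Qed.

Lemma degree_lower_bound_tp p u D (hs : Rp) : ptv u p u -> tp p hs != 0 ->
  (forall al be : arr L -> nat, (forall a, al a + be a = count_mem a p)%N ->
     (exists a, al a != 0%N) -> (exists a, be a != 0%N) -> vanish hs al \/ vanish hs be) ->
  is_D K (@dim2 L) D -> (size p <= D)%N.
Proof.
move=> up nz van DD; have [T TE] := falg_mpoly (tp_falg K p).
rewrite -count_predT -sum_count_mem.
apply: (degree_lower_bound K_infinite (hs := hs) (T := T)) van DD; last by rewrite TE.
  by move=> g h gu; have := tp_ginv up h gu; rewrite -!TE.
by move=> a c h nz_c; rewrite !TE; apply: tp_rhom.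
Qed.

Definition mx_unit (r s : bool) : 'M[K]_2 := \matrix_(i, j) ((i2b i == r) && (i2b j == s))%:R.

Lemma mx_unitM r s t : mx_unit r s *m mx_unit s t = mx_unit r t.
Proof.
apply: eq_mx2 => i j; rewrite !mxE sum_I2 !mxE.
by case: r; case: s; case: t; case: i; case: j; rewrite /= ?(mulr0, mul0r, mulr1, addr0, add0r).
Qed.

Lemma mx_unit_diag : mx_unit false false + mx_unit true true = 1%:M.
Proof. by apply: eq_mx2 => i j; rewrite !mxE; case: i; case: j; rewrite /= ?addr0 ?add0r. Qed.

Local Notation tpt := (@tour_pt K n m N).

Lemma tour_pt_fwd i : (i < n)%N -> tpt (fwdn n m N i) = mx_unit false false.
Proof. by move=> lt_i; rewrite fwdnE. Qed.

Lemma tour_pt_bwd i : (i < n)%N -> tpt (bwdn n m N i) = mx_unit true true.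
Proof. by move=> lt_i; rewrite bwdnE. Qed.

Lemma tour_pt_lpv v (b : bool) : tpt (lpv N v) *m mx_unit false b = mx_unit false b.
Proof.
apply: eq_mx2 => i j; rewrite !mxE sum_I2 !mxE.
by case: b; case: i; case: j; rewrite /= ?expr0 ?(mulr0, mul0r, mulr1, addr0, add0r).
Qed.

Lemma pmat_up k (b : bool) : (k <= n)%N -> pmat tpt (up n m N k) *m mx_unit false b = mx_unit false b.
Proof.
elim: k => [|k IHk] kn /=; first by rewrite mul1mx.
rewrite pmat_cat -mulmxA IHk ?(ltnW kn) //= mul1mx -mulmxA tour_pt_fwd // mx_unitM.
exact: tour_pt_lpv.
Qed.

Lemma pmat_down k (b : bool) : (k <= n)%N -> pmat tpt (down n m N k) *m mx_unit true b = mx_unit true b.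
Proof.
elim: k => [|k IHk] kn /=; first by rewrite mul1mx.
by rewrite -mulmxA tour_pt_bwd // mx_unitM IHk // ltnW.
Qed.

Lemma tp_tour : tp (tour n m N) tpt = 1.
Proof.
rewrite /tp /tour /= pmat_cat /=.
have -> : tpt (lpe n N false) = mx_unit false true by [].
have -> : tpt (lpe n N true) = mx_unit true false by [].
rewrite -!mulmxA. rewrite tour_pt_lpv pmat_up // mx_unitM pmat_down //.
by rewrite tr_mx2 !mxE /= add0r.
Qed.

Lemma tour_lower D : 2%N \notin [pchar K] -> is_D K (@dim2 L) D -> (3 * n.+1 <= D)%N.
Proof.
move=> ch2; rewrite -(size_tour n m N).
apply: (degree_lower_bound_tp (ptv_tour _ _ _) (hs := tpt)); first by rewrite tp_tour oner_neq0.
move=> al be ab nal nbe; have := ab (lpe n N false); rewrite count_tour /=.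
have le1 a : (count_mem a (tour n m N) <= 1)%N by rewrite count_tour; case: a => [[[|]|[|]]|].
have le0 a : is_back a -> count_mem a (tour n m N) = 0%N by rewrite count_tour; case: a.
(* The tour uses [lpe false] once, so one of the two factors misses it. *)
case E: (al _) => [|[|k]] // E'; [left|right].
- apply: vanish_tour => // a; first by rewrite (leq_trans _ (le1 a)) // -ab leq_addr.
  by move=> /le0/eqP; rewrite -ab addn_eq0 => /andP[/eqP].
- apply: vanish_tour => // [a|a|]; first by rewrite (leq_trans _ (le1 a)) // -ab leq_addl.
    by move=> /le0/eqP; rewrite -ab addn_eq0 => /andP[_ /eqP].
  by case: E'.
Qed.

(** The laps pass through identity matrices except at one [back] arrow, which carries a matrix unit:
    in characteristic 2 the trace of the identity would be 0. *)
Definition laps_pt : Rp := fun a =>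
  match (a : line_arr n N) with
  | inl (inl (inl i)) => if (i < m.-1)%N then 1%:M else 0
  | inr j => if j == 0%N :> nat then mx_unit true true else 1%:M
  | _ => 0
  end.

Lemma pmat_climb k : (k <= m.-1)%N -> pmat laps_pt (climb n m N k) = 1%:M.
Proof.
elim: k => [//|k IHk] km /=.
have kn : (k < n)%N by apply: leq_trans km (m1n m_gt0 m_le).
by rewrite pmat_cat IHk ?(ltnW km) // /= fwdnE /= km !mulmx1.
Qed.

Lemma tp_laps : (0 < N)%N -> tp (laps n m N) laps_pt = 1.
Proof.
move=> N0; rewrite /tp /laps.
have E (s : seq 'I_N) : pmat laps_pt (flatten [seq (back n j : arr L) :: climb n m N m.-1 | j <- s]) =
    if has (fun j : 'I_N => j == 0%N :> nat) s then mx_unit true true else 1%:M.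
  elim: s => [//|j s IHs] /=; rewrite pmat_cat IHs pmat_climb // mulmx1 /=.
  by case: (_ == _); case: (has _ _); rewrite ?mulmx1 ?mul1mx ?mx_unitM.
rewrite E; have -> : has (fun j : 'I_N => j == 0%N :> nat) (enum 'I_N).
  by apply/hasP; exists (Ordinal N0); rewrite ?mem_enum.
by rewrite tr_mx2 !mxE /= add0r.
Qed.

(** A factor without the distinguished [back] arrow sees only identity and zero matrices. If it is
    linear in another [back j], the identity there is the sum of two matrix units exchanged by the
    swap, and two equal values add up to 0. If it has no [back] arrow, some [fwd i] remains, and a
    torus element changes its scale. *)
Lemma vanish_laps al : 2%N \in [pchar K] -> (0 < N)%N ->
  (forall j, al (back n j : arr L) <= 1)%N ->
  (forall j : 'I_N, j = 0%N :> nat -> al (back n j : arr L) = 0%N) ->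
  (forall a, al a != 0%N -> match (a : line_arr n N) with
     | inl (inl (inl i)) => (i < m.-1)%N | inr _ => true | _ => false end) ->
  (exists a, al a != 0%N) -> vanish laps_pt al.
Proof.
move=> ch2 N0 al1 al0 als [a0 na0] F pF iF Fd.
have two0 (x : K) : x + x = 0 by rewrite -mulr2n -mulr_natl (pcharf0 ch2) mul0r.
pose h1 : Rp := fun a => if (a : line_arr n N) is inr _ then 1%:M else laps_pt a.
pose j0 := Ordinal N0.
(* Degree 0 allows the distinguished matrix to be scaled by 0, hence to be exchanged for the
   identity. *)
have F1 : F laps_pt = F h1.
  have E h : F (rscm (back n j0 : arr L) 0 h) = F h.
    by rewrite (rhom_all K_infinite pF (Fd _)) al0 // mul1r.
  rewrite -(E laps_pt) -(E h1); apply: falg_ext_arg => // a; rewrite /rscm.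
  case: eqP => [_|aj]; first by rewrite !scale0r.
  case: a aj => [a _|j aj] //=; case: eqP => // jj0; case: aj.
  by congr (inr _); apply: val_inj.
have [/existsP[j nj]|/existsPn alb] := boolP [exists j, al (back n j : arr L) != 0%N].
  have alj : al (back n j : arr L) = 1%N by case: (al _) nj (al1 j) => [|[]].
  have := Fd (back n j : arr L); rewrite alj => F1j.
  pose h r := upd_arr h1 (back n j : arr L) (mx_unit r r).
  have -> : F laps_pt = F (h false) + F (h true).
    rewrite F1 -(rhom1_additive K_infinite _ _ _ pF F1j) mx_unit_diag.
    apply: falg_ext_arg => // a; rewrite /upd_arr; case: eqP => // ->.
    by [].
  have su (v : ver L) : @swap_mx K \in unitmx by apply: swap_unit.
  rewrite -(iF _ (h false) su).
  suff -> : F (gl_act (fun=> @swap_mx K) (h false)) = F (h true) by apply: two0.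
  apply: falg_ext_arg => // a; rewrite /gl_act /h /upd_arr; case: eqP => [_|_].
    by apply: eq_mx2 => r s; rewrite swap_conj !mxE; case: r; case: s.
  have h1a : h1 a = 1%:M \/ h1 a = 0.
    by case: a => [[[i|i]|[v|b]]|k]; rewrite /h1 /laps_pt /=;
      try (by left); try (by right); case: ifP => _; [left|right].
  by case: h1a => ->; rewrite ?mulmx0 ?mul0mx // mulmx1 mulmxV ?swap_unit.
have [i a0E im] : exists2 i, a0 = fwd N i & (i < m.-1)%N.
  have := als a0 na0; case: (a0) na0 => [[[i|i]|[v|b]]|j] //= nz im; first by exists i.
  by case/negP: (alb j).
subst a0; have al_gt0 : (0 < al (fwd N i : arr L))%N by rewrite lt0n.
have [c [nz_c c1]] := exists_nonroot K_infinite al_gt0.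
(* Only [fwd i] and the [back] arrows are rescaled, and in the latter F has degree 0. *)
pose t (v : ver L) (b : bool) : K := if (v <= i)%N then c^-1 else 1.
have nzt v (b : bool) : t v b != 0 by rewrite /t; case: ifP; rewrite ?invr_neq0 ?oner_neq0.
pose s (a : arr L) : K := if a == fwd N i then c else if is_back a then c^-1 else 1.
have sE : gl_act (torus t) laps_pt =1 (fun a => s a *: laps_pt a).
  move=> a; apply/matrixP => r q; rewrite gl_act_torus // [RHS]mxE.
  case: a => [[[k|k]|[v|b]]|j]; rewrite /laps_pt ?mxE ?mulr0 ?mul0r //=.
    case: ifP => km; last by rewrite !mxE mulr0 mul0r mulr0.
    rewrite /s mulrAC; congr (_ * _); rewrite /t /= /bump /= add1n.
    have -> : ((fwd N k : arr L) == fwd N i) = (k == i :> nat) by [].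
    case: ltngtP => ki; rewrite ?mulfV ?oner_neq0 ?invr_neq0 //.
    by rewrite mul1r invrK.
  rewrite /s /t /= inordK ?prednK // leqNgt im /= divr1; congr (_ * _).
have := gauge_eq K_infinite pF iF Fd (fun v => torus_unit v nzt) sE.
rewrite (bigD1 (fwd N i : arr L)) //= /s eqxx big1 => [|a /negPf ->]; last first.
  case: a => [a|j] /=; first by rewrite expr1n.
  by have := alb j; rewrite negbK => /eqP ->.
rewrite mulr1 => /esym/eqP; rewrite -subr_eq0 -[X in _ - X]mul1r -mulrBl mulf_eq0 subr_eq0 (negPf c1).
by move/eqP.
Qed.

Lemma laps_lower D : 2%N \in [pchar K] -> is_D K (@dim2 L) D -> (m * N <= D)%N.
Proof.
move=> ch2; have [->|N0] := posnP N; first by rewrite muln0.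
rewrite -(size_laps n N m_gt0).
apply: (degree_lower_bound_tp (ptv_laps N m_gt0 m_le) (hs := laps_pt)); first by rewrite tp_laps ?oner_neq0.
move=> al be ab nal nbe.
have cE := @count_laps n m N m_gt0 m_le.
have side (de de' : arr L -> nat) : (forall a, de a + de' a = count_mem a (laps n m N))%N ->
    (exists a, de a != 0%N) -> de (back n (Ordinal N0)) = 0%N -> vanish laps_pt de.
  move=> dd nde d0; apply: vanish_laps => // [j|j j0|a na].
  - by have := dd (back n j); rewrite cE /= => <-; apply: leq_addr.
  - by rewrite -d0; congr (de (inr _)); apply: val_inj.
  have := dd a; rewrite cE; case: (a) na => [[[i|i]|[v|b]]|j] //=; try by case: (de _).
  by case: ltnP => // _; rewrite muln0; case: (de _).
have := ab (back n (Ordinal N0)); rewrite cE /=; case E: (al _) => [|[|k]] // E'; [left|right].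
- exact: side ab nal E.
- by apply: (side be al) => // [a|]; [rewrite addnC ab | case: E'].
Qed.

End LineDegrees.

(** * The bounds *)

Section QuiverClass.

Variables (n m d : nat) (Q : quiver).
Hypotheses (d_ge2 : (2 <= d)%N) (Qc : quiver_class n d m Q).

Lemma class_prim_bound : prim_bound Q m.
Proof.
move=> u c c0 uc cu; case: Qc => _ _ _ [_]; apply; exists c; split=> //.
by apply/andP; split=> //; apply/closed_pathP; split=> //; exists u.
Qed.

Lemma class_tour : exists r (P : seq (arr Q)),
  [/\ P != [::], ptv r P r & forall v, v \in [seq ahead a | a <- P]].
Proof.
case: Qc => [[[P [/closed_pathP[P0 [r rP]] Pall]]|[_ d0]] _ dE _]; first by exists r, P.
by move: d_ge2; rewrite -dE d0.
Qed.

Lemma size_prim (c : seq (arr Q)) : heads_uniq c -> (size c <= n)%N.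
Proof.
move=> cu; case: Qc => _ <- _ _.
by rewrite -(size_map (@ahead Q)) -(card_uniqP cu) max_card.
Qed.

Lemma class_m_le : (m <= n)%N.
Proof. by case: Qc => _ _ _ [[p [/andP[_ pu] <-]] _]; apply: size_prim. Qed.

Lemma prim_bound1_loops u p : prim_bound Q 1 -> ptv u p u ->
  all (fun a : arr Q => ahead a == atail a) p.
Proof.
move=> p1; have [k] := ubnP (size p); elim: k u p => // k IHk u p pk up.
have [->//|p0] := eqVneq p [::].
have loop1 v c : c != [::] -> ptv v c v -> heads_uniq c -> all (fun a : arr Q => ahead a == atail a) c.
  move=> c0 vc cu; have := p1 v c c0 vc cu; move: vc; case: (c) c0 => [//|a [|//]] _ /=.
  by case/andP => /eqP -> /eqP ->; rewrite eqxx.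
have [pu|npu] := boolP (heads_uniq p); first exact: loop1 up pu.
have [q1 [c [q2 [v [pE q10 c0 cu [uq1 vc vq2]]]]]] := primitive_cut up npu.
have sz : (size (q1 ++ q2) < k)%N.
  rewrite -ltnS; apply: leq_trans pk; rewrite ltnS pE !size_cat.
  by case: (c) c0 => //= a c' _; rewrite addSn addnS ltnS leq_add2l leq_addl.
by move: (IHk u _ sz (ptv_cat uq1 vq2)); rewrite pE !all_cat (loop1 v c c0 vc cu).
Qed.

(** For m = 1 every closed path consists of loops, so the one through all vertices never leaves its
    first vertex. *)
Lemma class_m_ge2 : (1 < n)%N -> (0 < m)%N -> (1 < m)%N.
Proof.
move=> n2 m0; rewrite ltn_neqAle m0 andbT; apply/eqP => m1.
have p1 := class_prim_bound; rewrite -m1 in p1.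
have [r [P [P0 rP Pall]]] := class_tour.
have loops := prim_bound1_loops p1 rP.
have hr a : a \in P -> ahead a = r.
  move: rP loops; elim: (P) {1 3}r => [//|b p IHp] u /= /andP[/eqP bu up] /andP[/eqP hb lp].
  rewrite inE => /predU1P[->|ap]; first by rewrite hb.
  by rewrite -bu -hb; apply: IHp.
have : (#|ver Q| <= 1)%N.
  apply/fintype_le1P => v w.
  by have /mapP[a /hr -> ->] := Pall v; have /mapP[b /hr -> ->] := Pall w.
by case: Qc => _ -> _ _; rewrite leqNgt n2.
Qed.

Variable K : fieldType.
Hypothesis K_infinite : infinite_type K.

Lemma generated_char2 : (0 < m)%N -> 2%N \in [pchar K] -> generated_upto K Q (m * d).
Proof.
move=> m0 ch2; case: (Qc) => _ nE dE _.
apply: (generated_upto_bgen K_infinite); apply: bounded_generation => [u c c0 uc cu|u p up p_long].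
  (* The determinant of a primitive closed path has degree at most 2 m; this is where d >= 2
     enters. *)
  by rewrite mulnC leq_mul // (class_prim_bound c0 uc cu).
have [n2|n1] := ltnP 1 n.
  by apply: (dec_char2 ch2 class_prim_bound _ class_tour up); rewrite ?nE ?dE.
have n1E : #|ver Q| = 1%N.
  by apply/eqP; rewrite eqn_leq nE n1 -nE; apply/card_gt0P; exists u.
by apply: (dec_one_vertex ch2 n1E up); rewrite dE; apply: leq_ltn_trans p_long; rewrite leq_pmull.
Qed.

Lemma generated_not_char2 : 2%N \notin [pchar K] -> generated_upto K Q (3 * n).
Proof.
move=> ch2; case: (Qc) => _ nE _ _.
apply: (generated_upto_bgen K_infinite); apply: bounded_generation => [u c c0 uc cu|u p up p_long].
  by rewrite leq_mul // size_prim.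
by apply: (dec_long ch2 up); rewrite nE.
Qed.

End QuiverClass.

(** These are the conditions under which the line quiver belongs to the class; any member of the
    class with at least two arrows forces them. *)
Lemma inhabited_shape n m : (0 < n)%N -> (0 < m)%N -> eventually_inhabited n m ->
  (m <= n)%N /\ (n.-1 = 0 \/ 1 < m)%N.
Proof.
move=> n0 m0 [d0 /(_ (maxn d0 2) (leq_maxl _ _))[Q Qc]]; split; first exact: class_m_le Qc.
case: n n0 Qc => // -[|n] _ Qc; [by left | right].
exact: class_m_ge2 (leq_maxr _ _) Qc isT m0.
Qed.

Lemma ex_max (E : nat -> Prop) B : (exists k, E k) -> (forall k, E k -> (k <= B)%N) ->
  exists N, is_max E N.
Proof.
elim: B => [|B IHB] [k Ek] EB; first by exists k; split=> // j /EB; rewrite leqn0 => /eqP->.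
have [EB1|nEB1] := Classical_Prop.classic (E B.+1); first by exists B.+1; split.
apply: IHB => [|j Ej]; first by exists k.
by have := EB j Ej; rewrite leq_eqVlt => /predU1P[jB|//]; case: nEB1; rewrite -jB.
Qed.

(** With n vertices the line has 3 n fixed arrows, and the other d - 3 n go from m - 1 to 0. *)
Lemma line_values n m d : (0 < m)%N -> (0 < n)%N ->
  (m <= n)%N -> (n.-1 = 0 \/ 1 < m)%N -> (3 * n < d)%N ->
  let Q := lineq n.-1 m (d - 3 * n) in quiver_class n d m Q.
Proof.
case: n => [//|n] m0 _ mn nm dn /=.
have -> : d = (3 * n + 3 + (d - 3 * n.+1))%N by move: dn; clear; lia.
have -> : (3 * n + 3 + (d - 3 * n.+1) - 3 * n.+1 = d - 3 * n.+1)%N by clear; lia.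
by apply: line_class => //; rewrite subn_gt0.
Qed.

Section RatioLimit.
Import Order.TTheory Num.Theory.

Lemma ratio_limit (m c d1 : nat) (D : nat -> nat) : (0 < m)%N ->
  (forall d, (d1 <= d)%N -> (m * (d - c) <= D d)%N /\ (D d <= m * d)%N) ->
  seq_tends_to (fun d => (D d)%:R / (m * d)%:R) 1.
Proof.
move=> m0 DB eps eps0.
(* The ratio differs from 1 by at most c / k, which is below [eps] beyond this bound. *)
pose k0 := Num.bound (c%:R / eps).
exists (maxn d1 k0.+1) => k; rewrite geq_max => /andP[kd kk].
have [lo hi] := DB k kd; have k_gt0 : (0 < k)%N by apply: leq_trans kk.
have mk : (0 : rat) < (m * k)%:R by rewrite ltr0n muln_gt0 m0.
have ck : c%:R < eps * k%:R.
  rewrite mulrC -ltr_pdivrMr //; apply: lt_le_trans (archi_boundP _) _.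
    by rewrite divr_ge0 ?ler0n ?ltW.
  by rewrite ler_nat ltnW.
rewrite distrC ger0_norm; last by rewrite subr_ge0 ler_pdivrMr // mul1r ler_nat.
rewrite ltrBlDr -ltrBlDl ltr_pdivlMr // mulrBl mul1r ltrBlDr.
have : ((m * k)%:R : rat) <= (D k)%:R + (m * c)%:R.
  by rewrite -natrD ler_nat; move: lo; rewrite mulnBr; lia.
move/le_lt_trans; apply; rewrite ltrD2l !natrM mulrCA ltr_pM2l ?ltr0n //.
Qed.

End RatioLimit.

Theorem theorem1p1 (n m : nat) (n_gt0 : (0 < n)%N) (m_gt0 : (0 < m)%N) :
  exists d0 : nat, (* "sufficiently large with respect to n, m" in part 2 *)
  forall (K : fieldType) (K_infinite : infinite_type K),
  (2%N \in [pchar K] ->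
     (forall (d : nat) (Q : quiver), (2 <= d)%N -> quiver_class n d m Q ->
        exists D : nat, is_D K (@dim2 Q) D /\ (D <= m * d)%N) /\
     (eventually_inhabited n m ->
        exists maxD : nat -> nat,
          (exists d1 : nat, forall d : nat, (d1 <= d)%N ->
             is_max (D_values K n d m) (maxD d)) /\
          seq_tends_to (fun d : nat => (maxD d)%:R / (m * d)%:R) 1)) /\
  (2%N \notin [pchar K] ->
     (forall (d : nat) (Q : quiver), (2 <= d)%N -> quiver_class n d m Q ->
        exists D : nat, is_D K (@dim2 Q) D /\ (D <= 3 * n)%N) /\
     (eventually_inhabited n m ->
        forall d : nat, (d0 <= d)%N ->
          is_max (D_values K n d m) (3 * n))).
Proof.
(* One arrow more than the 3 n fixed ones, so that a [back] arrow exists and a primitive closed path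
   of length m is present. *)
exists (3 * n).+1 => K K_inf; split=> ch2; split.
- move=> d Q d2 Qc; apply: is_D_exists.
  exact: (generated_char2 d2 Qc K_inf m_gt0 ch2).
- move=> inh; have [mn nm] := inhabited_shape n_gt0 m_gt0 inh.
  have d2 d : (3 * n < d)%N -> (2 <= d)%N by move: n_gt0; clear; lia.
  have val d : (3 * n < d)%N -> exists2 D, D_values K n d m D & (m * (d - 3 * n) <= D)%N.
    move=> nd; have Qc := line_values m_gt0 n_gt0 mn nm nd.
    have [D [QD _]] := is_D_exists (generated_char2 (d2 d nd) Qc K_inf m_gt0 ch2).
    exists D; first by exists (lineq n.-1 m (d - 3 * n)).
    by apply: (laps_lower K_inf m_gt0 _ ch2 QD); rewrite prednK.
  have ub d D : (3 * n < d)%N -> D_values K n d m D -> (D <= m * d)%N.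
    move=> nd [Q [Qc QD]]; apply: is_D_le QD => //.
    exact: (generated_char2 (d2 d nd) Qc K_inf m_gt0 ch2).
  have ex d : exists D, (3 * n < d)%N -> is_max (D_values K n d m) D.
    have [nd|] := boolP (3 * n < d)%N; last by exists 0%N.
    have [||D DM] := @ex_max (D_values K n d m) (m * d); last by exists D.
      by have [D] := val d nd; exists D.
    by move=> D; apply: ub.
  (* The maxima for the single values of d are collected into one function by choice. *)
  have [maxD maxDP] := IndefiniteDescription.functional_choice _ ex.
  exists maxD; split; first by exists (3 * n).+1.
  apply: (@ratio_limit m (3 * n) (3 * n).+1) => // d nd.
  have [MD leM] := maxDP d nd; have [D DD lowD] := val d nd; split; last exact: ub MD.
  exact: leq_trans lowD (leM D DD).
- move=> d Q d2 Qc; apply: is_D_exists.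
  exact: (generated_not_char2 Qc K_inf ch2).
move=> inh d nd; have [mn nm] := inhabited_shape n_gt0 m_gt0 inh.
have ub D : D_values K n d m D -> (D <= 3 * n)%N.
  by move=> [Q [Qc QD]]; apply: is_D_le QD => //; apply: (generated_not_char2 Qc K_inf ch2).
split=> //; have Qc := line_values m_gt0 n_gt0 mn nm nd.
have [D [QD _]] := is_D_exists (generated_not_char2 Qc K_inf ch2).
have DV : D_values K n d m D by exists (lineq n.-1 m (d - 3 * n)).
suff -> : (3 * n = D)%N by [].
apply/eqP; rewrite eqn_leq ub // andbT; have := tour_lower K_inf ch2 QD.
by rewrite prednK.
Qed.
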